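(* For every $n\in\mathbb N$ there exist positive constants $\sigma_2, C_{11}, C_{12}$ depending only on $n$, and, for every $k\in\mathbb N$, a positive constant $C_{13}(n,k)$, such that the following holds. Let $E$ be a separable Hilbert space, $X\subset E$, $r>0$ and $0<\delta<\sigma_2 r$. Suppose that $X$ is $\delta$-close to $n$-flats at scale $r$, with $A_x$ ($x\in X$) denoting the corresponding $n$-dimensional affine subspaces. Then there exists a closed $n$-dimensional smooth submanifold $M\subset E$ such that: (1) $d_H(X,M)\le 5\delta$. (2) The second fundamental form of $M$ at every point is bounded by $C_{11}\,\delta r^{-2}$. (3) $\operatorname{Reach}(M)\ge r/3$. (4) The normal projection $P_M:\mathcal U_{r/3}(M)\to M$ is smooth and satisfies, for all $x\in\mathcal U_{r/3}(M)$, $\|d^k_xP_M\|<C_{13}(n,k)\,\delta r^{-k}$ for all $k\ge2$, and $\|d_xP_M-P_{\vec T_yM}\|<C_{13}(n,1)\,\delta r^{-1}$, where $y=P_M(x)$ and $P_{\vec T_yM}$ is the orthogonal projector onto $\vec T_yM$. (5) If $x\in X$ and $y=P_M(x)$, then $\angle(A_x,T_yM)<C_{12}\,\delta r^{-1}$.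
   Context: $B_r^E(x)$ is the open ball in $E$; $d_H$ is the Hausdorff distance in $E$; $\mathcal U_r(A)$ is the set of points of $E$ at distance less than $r$ from $A$. A set $X\subset E$ is $\delta$-close to $n$-flats at scale $r$ if for every $x\in X$ there is an $n$-dimensional affine subspace $A_x\subset E$ through $x$ with $d_H(X\cap B_r^E(x),A_x\cap B_r^E(x))\le\delta$. A closed submanifold of $E$ is a finite-dimensional smooth submanifold that is a closed subset of $E$. $\operatorname{Reach}(M)$ is the supremum of all $r>0$ such that every $x\in\mathcal U_r(M)$ has a unique nearest point in $M$; this nearest point is denoted $P_M(x)$ and $P_M$ is the normal projection. $T_xM$ is the tangent space of $M$ at $x$ regarded as an affine subspace of $E$ containing $x$, and $\vec T_xM$ is the linear subspace parallel to it. $d_x$ and $d_x^k$ denote the first and $k$-th differentials at $x$, with norms derived in the standard way from the norm of $E$. For $n$-dimensional linear subspaces $A_1,A_2\subset E$, $\angle(A_1,A_2)=\max_{0\ne u_1\in A_1}\min_{0\ne u_2\in A_2}\angle(u_1,u_2)$ with $\angle(u_1,u_2)=\arccos\frac{\langle u_1,u_2\rangle}{|u_1||u_2|}$; the angle between affine subspaces is the angle between their parallel translates through the origin. *)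

(* Defs.v *)
From HB Require Import structures.
From mathcomp Require Import all_boot all_order all_algebra sesquilinear.
From mathcomp Require Import all_classical all_reals all_analysis.

Set Implicit Arguments.
Unset Strict Implicit.
Unset Printing Implicit Defensive.

Import Order.TTheory GRing.Theory Num.Theory.
Import numFieldNormedType.Exports.

Local Open Scope classical_set_scope.
Local Open Scope ring_scope.

HB.mixin Record NormedModule_isPreHilbert (R : realType) E
    & NormedModule R E := {
  inner : {dot E for (idfun : R -> R)} ;
  inner_norm : forall x : E, inner x x = `|x| ^+ 2
}.

#[short(type="hilbertType")]
HB.structure Definition Hilbert (R : realType) :=
  {E of CompleteNormedModule R E & NormedModule_isPreHilbert R E}.

Definition separable (T : topologicalType) :=
  exists2 D : set T, countable D & dense D.

Section BoundedLinear.
Context {R : realType} (V W : normedModType R).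

Definition blin_pred : {pred V -> W} :=
  mem [set f : V -> W | linear f /\ continuous f].
Definition blin_key : pred_key blin_pred. Proof. exact. Qed.
Canonical blin_keyed := KeyedPred blin_key.

Record blin := BLin { blin_fun :> V -> W ; blin_funP : blin_fun \in blin_pred }.

HB.instance Definition _ := [isSub for blin_fun].
HB.instance Definition _ := [Choice of blin by <:].

Lemma blin_submod_closed : submod_closed blin_pred.
Proof.
split.
  rewrite inE; split; last exact: cst_continuous.
  by move=> a u v; rewrite -[LHS]/0 -[0 u]/0 -[0 v]/0 scaler0 addr0.
move=> a f g; rewrite !inE => -[fl fc] [gl gc]; split.
  move=> b u v; rewrite -[LHS]/(a *: f _ + g _) fl gl.
  rewrite -[(a *: f + g) u]/(a *: f u + g u) -[(a *: f + g) v]/(a *: f v + g v).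
  by rewrite !scalerDr !scalerA mulrC addrACA.
by move=> x; apply: cvgD; [apply: cvgZl_tmp; exact: fc | exact: gc].
Qed.

HB.instance Definition _ :=
  GRing.isSubmodClosed.Build _ _ blin_pred blin_submod_closed.
HB.instance Definition _ := [SubChoice_isSubLmodule of blin by <:].

Lemma blin_linear (f : blin) : linear f.
Proof. by have := blin_funP f; rewrite inE => -[]. Qed.

HB.instance Definition _ (f : blin) :=
  GRing.isLinear.Build R V W *:%R (blin_fun f) (blin_linear f).

Lemma blin_continuous (f : blin) : continuous f.
Proof. by have := blin_funP f; rewrite inE => -[]. Qed.

Definition opnorm (f : blin) : R :=
  sup [set `|f x| | x in [set x : V | `|x| <= 1]].

Lemma has_sup_opnorm (f : blin) :
  has_sup [set `|f x| | x in [set x : V | `|x| <= 1]].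
Proof.
split; first by exists `|f 0|; exists 0 => //=; rewrite normr0 ler01.
have /linear_bounded_continuous/bounded_funP/(_ 1) [M Mf] := @blin_continuous f.
by exists M => _ [x x1 <-]; exact: Mf.
Qed.

Lemma opnorm_ge (f : blin) x : `|x| <= 1 -> `|f x| <= opnorm f.
Proof.
by move=> x1; apply: sup_upper_bound (has_sup_opnorm f) _ _; exists x.
Qed.

Lemma opnorm_le (f : blin) M :
  (forall x, `|x| <= 1 -> `|f x| <= M) -> opnorm f <= M.
Proof.
move=> fM; apply: ge_sup; first by case: (has_sup_opnorm f).
by move=> _ [x x1 <-]; exact: fM.
Qed.

Lemma opnorm_ge0 (f : blin) : 0 <= opnorm f.
Proof.
by rewrite (le_trans (normr_ge0 (f 0)))// opnorm_ge// normr0 ler01.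
Qed.

Lemma opnormD (f g : blin) : opnorm (f + g) <= opnorm f + opnorm g.
Proof.
apply: opnorm_le => x x1.
by rewrite (le_trans (ler_normD _ _))// lerD// opnorm_ge.
Qed.

Lemma opnormZ_le (a : R) (f : blin) : opnorm (a *: f) <= `|a| * opnorm f.
Proof.
by apply: opnorm_le => x x1; rewrite normrZ ler_wpM2l// opnorm_ge.
Qed.

Lemma opnormZ (a : R) (f : blin) : opnorm (a *: f) = `|a| * opnorm f.
Proof.
apply/le_anti; rewrite opnormZ_le /=.
have [->|a0] := eqVneq a 0; first by rewrite normr0 mul0r opnorm_ge0.
rewrite -ler_pdivlMl ?normr_gt0// -normfV.
by rewrite -[in leLHS](scalerK a0 f) opnormZ_le.
Qed.

Lemma opnorm_eq0 (f : blin) : opnorm f = 0 -> f = 0.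
Proof.
move=> f0; apply: val_inj; apply/funext => x /=.
have [->|x0] := eqVneq x 0; first exact: (raddf0 f).
have nx0 : `|x| != 0 by rewrite normr_eq0.
have : `|f (`|x|^-1 *: x)| <= 0.
  by rewrite -f0 opnorm_ge// normrZ normfV normr_id mulVf.
rewrite normr_le0 linearZ/= scaler_eq0 invr_eq0 (negbTE nx0) /=.
by move/eqP.
Qed.

HB.instance Definition _ :=
  @Lmodule_isNormed.Build R blin opnorm opnormD opnormZ opnorm_eq0.

End BoundedLinear.

Section Differentials.
Context {R : realType}.

(* The k-linear continuous maps from [V] to [W], curried; the iterated operator
   norm is the usual norm [sup |B(v_1, ..., v_k)|] over unit vectors. *)
Fixpoint multilin (V W : normedModType R) (k : nat) : normedModType R :=
  if k is k'.+1 then (blin V (multilin V W k') : normedModType R) else W.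

(* ['d f x] as a point of the normed space [blin V W], see [fdiffE]; the default
   [0] is irrelevant where [f] is differentiable. *)
Definition fdiff (V W : normedModType R) (f : V -> W) (x : V) : blin V W :=
  insubd (0 : blin V W) ('d f x : V -> W).

Lemma fdiffE (V W : normedModType R) (f : V -> W) (x v : V) :
  differentiable f x -> fdiff f x v = 'd f x v.
Proof.
move=> df; congr (_ v); rewrite /fdiff insubdK// inE.
by split; [exact: linearP | exact: diff_continuous].
Qed.

Fixpoint fdiffn (V W : normedModType R) (k : nat) (f : V -> W) :
    V -> multilin V W k :=
  if k is k'.+1 then fdiff (fdiffn k' f) else f.

(* [differentiable] looks at a full neighbourhood of [x]: this is meant for open [U]. *)
Definition smooth_on (V W : normedModType R) (U : set V) (f : V -> W) :=
  forall k x, U x -> differentiable (fdiffn k f) x.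

End Differentials.

Section Metric.
Context {R : realType} {E : normedModType R}.
Implicit Types (A B M : set E) (x y : E).

Definition tube (r : R) A : set E := [set x | (edist_inf A x < r%:E)%E].

(* [d_H(set0, set0) = 0], and [d_H(set0, A) = +oo] for nonempty [A]. *)
Definition hausdorff_dist A B : \bar R :=
  ereal_inf [set e%:E | e in [set e : R |
    [/\ 0 < e, A `<=` tube e B & B `<=` tube e A]]].

Definition nearest_point M x y := M y /\ forall z, M z -> `|x - y| <= `|x - z|.

Definition reach M : \bar R :=
  ereal_sup [set r%:E | r in [set r : R |
    0 < r /\ forall x, tube r M x -> exists! y, nearest_point M x y]].

(* The point given by [xget] is the nearest point where that is unique. *)
Definition nproj M x : E := xget 0 (nearest_point M x).

End Metric.

Section Flats.
Context {R : realType} {E : lmodType R}.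

Definition lin_indep n (e : 'I_n -> E) :=
  forall c : 'I_n -> R, \sum_i c i *: e i = 0 -> forall i, c i = 0.

Definition lin_subspace n (V : set E) :=
  exists2 e : 'I_n -> E, lin_indep e &
    V = [set \sum_i c i *: e i | c in [set: 'I_n -> R]].

Definition affine_subspace n (A : set E) :=
  exists x V, lin_subspace n V /\ A = [set x + v | v in V].

Definition direction (A : set E) : set E := [set a.1 - a.2 | a in A `*` A].

End Flats.

Section CloseToFlats.
Context {R : realType} {E : normedModType R}.

Definition close_to_flats_with n (delta r : R) (X : set E) (A : E -> set E) :=
  forall x, X x -> [/\ affine_subspace n (A x), A x x &
    (hausdorff_dist (X `&` ball x r) (A x `&` ball x r) <= delta%:E)%E].

End CloseToFlats.

Section Angles.
Context {R : realType} {E : hilbertType R}.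
Implicit Types (u v : E) (A B V : set E).

Definition vangle u v : R := acos (inner u v / (`|u| * `|v|)).

(* For subspaces of positive finite dimension the sup and the inf are attained;
   for zero subspaces [sup set0 = 0]. *)
Definition angle A B : R :=
  sup [set inf [set vangle u v | v in B `\ 0] | u in A `\ 0].

Definition affine_angle A B : R := angle (direction A) (direction B).

Definition is_orth_projector V (P : blin E E) :=
  forall x, V (P x) /\ forall v, V v -> inner (x - P x) v = 0.

Definition orth_projector V : blin E E := xget 0 (is_orth_projector V).

End Angles.

Section Submanifolds.
Context {R : realType}.

(* Charts are smooth diffeomorphisms [phi : U -> W] between open subsets of [E],
   with inverse [psi], which flatten [M]. *)
Definition submanifold (E : normedModType R) (n : nat) (M : set E) :=
  forall x, M x -> exists (U W V : set E) (phi psi : E -> E),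
    [/\ [/\ open U, open W & U x],
        smooth_on U phi, smooth_on W psi,
        (forall y, U y -> W (phi y) /\ psi (phi y) = y) /\
        (forall z, W z -> U (psi z) /\ phi (psi z) = z) &
        lin_subspace n V /\ phi @` (M `&` U) = V `&` W].

Definition closed_submanifold (E : normedModType R) (n : nat) (M : set E) :=
  closed M /\ submanifold n M.

(* The linear tangent space: velocities at [x] of smooth curves in [M]. *)
Definition tangent_dir (E : normedModType R) (M : set E) (x : E) : set E :=
  [set v | exists (e : R) (g : R -> E),
    [/\ 0 < e, smooth_on (ball (0 : R) e) g,
        forall t, ball (0 : R) e t -> M (g t), g 0 = x & derive1 g 0 = v]].

Definition tangent_space (E : normedModType R) (M : set E) (x : E) : set E :=
  [set x + v | v in tangent_dir M x].

(* [II_x(u, v)] is the normal component of the derivative along [u] of a smooth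
   field which is tangent to [M] on [M] and takes the value [v] at [x]; it does
   not depend on the field. *)
Definition second_fundamental_form (E : hilbertType R) (M : set E)
    (x u v : E) : E :=
  xget 0 [set w | exists (U : set E) (Y : E -> E),
    [/\ open U /\ U x, smooth_on U Y,
        forall y, (M `&` U) y -> tangent_dir M y (Y y),
        Y x = v &
        w = fdiff Y x u - orth_projector (tangent_dir M x) (fdiff Y x u)]].

End Submanifolds.

(* Main.v *)
Require Import Defs.
From HB Require Import structures.
From mathcomp Require Import all_boot all_order all_algebra.
From mathcomp Require Import all_classical all_reals all_analysis.
From mathcomp Require Import sesquilinear.
From mathcomp Require Import ring lra.

Set Implicit Arguments.
Unset Strict Implicit.
Unset Printing Implicit Defensive.

Import Order.TTheory GRing.Theory Num.Theory.
Import numFieldNormedType.Exports.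

Local Open Scope classical_set_scope.
Local Open Scope ring_scope.

(* Scale to r = 1.  Choose a maximal 1/100-separated subset (q_i) of X; near any
   point a number of them bounded in terms of n is relevant, since X lies close
   to n-flats.  With a partition of unity subordinate to balls about the q_i,
   let T and G be the averages of the orthogonal projectors P_i onto the flats
   and of the normal displacements z |-> (1 - P_i) (z - q_i).  The operator
   S = 2 T - 1 is close to a reflection and its positive spectral subspace has
   dimension n; M is the zero set of (|S| - S) G.  The factor |S| - S kills this
   subspace, so that locally the equation is equivalent to its projection
   to the normal space of one flat, which is solved by the fixed point of a small
   map: M is a local graph over each flat, of a function whose derivatives
   are all O(delta).  Its nearest point map comes from inverting a small
   perturbation of the identity, and is a small perturbation of the affine
   projection.  The differential of the projection at y in M is the orthogonal
   projector onto the tangent space, and its second differential gives the second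
   fundamental form; hence the remaining bounds. *)

(** Why [|S| - S] and not [1 - T]: an average of projectors is not idempotent, and [1 - T] may well
    be injective, so that [(1 - T) G = 0] would impose conditions in every direction of [E] and need
    not follow from its projection to a normal space. The equation involves no base point, so the
    local graphs are parts of one set and nothing has to be glued. Two demands shape the estimates.
    All bounds must be linear in [d]: averages enter only through their difference from the value at
    one base point, and the lemmas on composition and inversion have constants that multiply the
    small bound. The threshold must not depend on the order: smallness is used for at most two
    derivatives, to get contractions and the uniqueness of nearest points, while higher derivatives
    solve linear equations with a fixed contraction constant. Radii at scale 1: points of the tube
    of radius [1 / 3] are within [3 / 8] of [X], and all candidates for their nearest points lie in
    the graph ball of radius [4 / 5]. *)

(* Identities in modules are decided by comparing the coefficients of the atoms. *)
Section ModuleIdentities.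
Context {K : comNzRingType} {V : lmodType K}.

Inductive mexp :=
  MVar of nat | MAdd of mexp & mexp | MOpp of mexp | MScale of K & mexp | MZero.

Fixpoint meval (env : seq V) e : V :=
  match e with
  | MVar i => env`_i
  | MAdd a b => meval env a + meval env b
  | MOpp a => - meval env a
  | MScale r a => r *: meval env a
  | MZero => 0
  end.

(** [eqn] reduces on numerals, so [cbn] leaves equations between ring expressions, which are passed
    to [ring] or [field]. *)
Fixpoint mcoef e i : K :=
  match e with
  | MVar j => if eqn i j then 1 else 0
  | MAdd a b => mcoef a i + mcoef b i
  | MOpp a => - mcoef a i
  | MScale r a => r * mcoef a i
  | MZero => 0
  end.

Lemma mevalE env e :
  meval env e = \sum_(i < size env) mcoef e i *: env`_i.
Proof.
elim: e => [j|a IHa b IHb|a IHa|r a IHa|] /=.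
- have E k l : eqn k l = (k == l) by [].
  have [js|js] := ltnP j (size env); last first.
    rewrite nth_default// big1// => i _.
    by rewrite E (ltn_eqF (leq_trans (ltn_ord i) js)) scale0r.
  rewrite (bigD1 (Ordinal js)) //= E eqxx scale1r big1 ?addr0// => i.
  by rewrite E -val_eqE/= => /negbTE->; rewrite scale0r.
- by rewrite IHa IHb -big_split; apply: eq_bigr => i _; rewrite scalerDl.
- by rewrite IHa -sumrN; apply: eq_bigr => i _; rewrite scaleNr.
- by rewrite IHa scaler_sumr; apply: eq_bigr => i _; rewrite scalerA.
- by rewrite big1// => i _; rewrite scale0r.
Qed.

Fixpoint mcheck e1 e2 n :=
  if n is n'.+1 then mcoef e1 n' = mcoef e2 n' /\ mcheck e1 e2 n' else True.

Lemma mcheckP env e1 e2 :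
  mcheck e1 e2 (size env) -> meval env e1 = meval env e2.
Proof.
rewrite !mevalE => ok; apply: eq_bigr => -[i /= ie] _; congr (_ *: _).
elim: (size env) ok ie => // n IH /= [e12 /IH {}IH].
by rewrite ltnS leq_eqVlt => /orP[/eqP->|].
Qed.

End ModuleIdentities.

Ltac matoms t l :=
  lazymatch t with
  | (?a + ?b)%R => let l := matoms a l in matoms b l
  | (- ?a)%R => matoms a l
  | (?r *: ?a)%R => matoms a l
  | 0%R => l
  | _ => let rec mem l' :=
           lazymatch l' with
           | nil => constr:(cons t l)
           | cons t _ => l
           | cons _ ?l'' => mem l''
           end in mem l
  end.

Ltac mindex x l :=
  lazymatch l with
  | cons x _ => constr:(0%N)
  | cons _ ?l' => let i := mindex x l' in constr:(S i)
  end.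

Ltac mreify K t l :=
  lazymatch t with
  | (?a + ?b)%R => let x := mreify K a l in let y := mreify K b l in
                   constr:(@MAdd K x y)
  | (- ?a)%R => let x := mreify K a l in constr:(@MOpp K x)
  | (?r *: ?a)%R => let x := mreify K a l in constr:(@MScale K r x)
  | 0%R => constr:(@MZero K)
  | _ => let i := mindex t l in constr:(@MVar K i)
  end.

Ltac modeq K V :=
  lazymatch goal with
  | |- @eq _ ?a ?b =>
    let l0 := constr:(@nil V) in
    let l1 := matoms a l0 in let l := matoms b l1 in
    let x := mreify K a l in let y := mreify K b l in
    refine (@mcheckP K V l x y _);
    cbn [mcheck mcoef eqn size];
    repeat (split; [try (first [ring | by field])|]); try exact I
  end.

(** * Bounded operators *)

Section Blin.
Context {R : realType}.
Implicit Types V W Z : normedModType R.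

Lemma blinP V W (f g : blin V W) : (forall x, f x = g x) -> f = g.
Proof. by move=> fg; apply: val_inj; apply/funext. Qed.

Lemma blinD V W (f : blin V W) u v : f (u + v) = f u + f v.
Proof. exact: linearD. Qed.

Lemma blinB V W (f : blin V W) u v : f (u - v) = f u - f v.
Proof. exact: linearB. Qed.

Lemma blinN V W (f : blin V W) u : f (- u) = - f u.
Proof. exact: linearN. Qed.

Lemma blinZ V W (f : blin V W) a u : f (a *: u) = a *: f u.
Proof. exact: linearZ. Qed.

Lemma blin0 V W (f : blin V W) : f 0 = 0.
Proof. exact: linear0. Qed.

Lemma blin_sum V W (f : blin V W) I (r : seq I) (F : I -> V) :
  f (\sum_(i <- r) F i) = \sum_(i <- r) f (F i).
Proof. exact: linear_sum. Qed.

Lemma blinDE V W (f g : blin V W) x : (f + g) x = f x + g x.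
Proof. by []. Qed.

Lemma blinNE V W (f : blin V W) x : (- f) x = - f x.
Proof. by []. Qed.

Lemma blinBE V W (f g : blin V W) x : (f - g) x = f x - g x.
Proof. by []. Qed.

Lemma blinZE V W a (f : blin V W) x : (a *: f) x = a *: f x.
Proof. by []. Qed.

Lemma blin0E V W x : (0 : blin V W) x = 0.
Proof. by []. Qed.

Lemma blin_norm_le V W (f : blin V W) x : `|f x| <= `|f| * `|x|.
Proof.
have [->|x0] := eqVneq x 0; first by rewrite linear0 !normr0 mulr0.
have nx0 : 0 < `|x| by rewrite normr_gt0.
have : `|f (`|x|^-1 *: x)| <= `|f|.
  by apply: opnorm_ge; rewrite normrZ normfV normr_id mulVf ?gt_eqF.
by rewrite linearZ/= normrZ normfV normr_id ler_pdivrMl// mulrC.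
Qed.

Lemma blin_le V W (f : blin V W) c x d :
  `|f| <= c -> `|x| <= d -> `|f x| <= c * d.
Proof.
move=> fc xd; apply: le_trans (blin_norm_le _ _) _.
by apply: ler_pM.
Qed.

Lemma norm_blin_le V W (f : blin V W) c :
  0 <= c -> (forall x, `|f x| <= c * `|x|) -> `|f| <= c.
Proof.
move=> c0 fc; apply: opnorm_le => x x1.
by apply: le_trans (fc x) _; rewrite ler_piMr.
Qed.

Definition bounded_linear V W (f : V -> W) :=
  linear f /\ exists c, forall x, `|f x| <= c * `|x|.

Lemma bounded_linear_pred V W (f : V -> W) :
  bounded_linear f -> f \in @blin_pred R V W.
Proof.
move=> [fl [c fc]]; rewrite inE; split=> //.
pose g : {linear V -> W} := HB.pack f (GRing.isLinear.Build _ _ _ _ f fl).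
rewrite -[f]/(g : V -> W).
apply/linear_bounded_continuous/bounded_funP => r.
exists (`|c| * `|r|) => x xr; apply: le_trans (fc x) _.
apply: le_trans (ler_norm _) _; rewrite normrM normr_id ler_wpM2l//.
exact: le_trans xr (ler_norm _).
Qed.

Definition mkblin V W (f : V -> W) (fP : bounded_linear f) : blin V W :=
  BLin (bounded_linear_pred fP).

Lemma mkblinE V W (f : V -> W) (fP : bounded_linear f) x : mkblin fP x = f x.
Proof. by []. Qed.

Lemma idb_subproof V : bounded_linear (@id V).
Proof. by split; [|exists 1 => x; rewrite mul1r]. Qed.
Definition idb V : blin V V := mkblin (idb_subproof V).

Lemma norm_idb V : `|idb V| <= 1.
Proof. by apply: norm_blin_le => // x; rewrite mul1r. Qed.

Lemma compb_subproof V W Z (g : blin W Z) (f : blin V W) :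
  bounded_linear (fun x => g (f x)).
Proof.
split; first by move=> a u v; rewrite !linearP.
exists (`|g| * `|f|) => x; rewrite -mulrA.
by apply: blin_le => //; apply: blin_norm_le.
Qed.
Definition compb V W Z (g : blin W Z) (f : blin V W) : blin V Z :=
  mkblin (compb_subproof g f).

Lemma compbE V W Z (g : blin W Z) (f : blin V W) x : compb g f x = g (f x).
Proof. by []. Qed.

Lemma norm_compb V W Z (g : blin W Z) (f : blin V W) :
  `|compb g f| <= `|g| * `|f|.
Proof.
apply: norm_blin_le => [|x]; first by rewrite mulr_ge0.
rewrite -mulrA [compb g f x]/(g (f x)).
by apply: blin_le => //; apply: blin_norm_le.
Qed.

Lemma compbP_subproof V W Z (g : blin W Z) :
  bounded_linear (fun f : blin V W => compb g f).
Proof.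
split; first by move=> a u v; apply: blinP => x /=; rewrite linearP.
by exists `|g| => f; apply: norm_compb.
Qed.
Definition compbl V W Z (g : blin W Z) : blin (blin V W) (blin V Z) :=
  mkblin (@compbP_subproof V W Z g).

Lemma compbB_subproof V W Z :
  bounded_linear (fun g : blin W Z => @compbl V W Z g).
Proof.
split; first by move=> a u v; apply: blinP => f; apply: blinP => x.
exists 1 => g; rewrite mul1r; apply: norm_blin_le => // f.
exact: norm_compb.
Qed.
(** Composition is itself a bounded bilinear operator. Derivatives of compositions and products are
    thereby again values of bilinear operators, and the inductions on the order of differentiation
    only change the spaces. *)
Definition compbb V W Z : blin (blin W Z) (blin (blin V W) (blin V Z)) :=
  mkblin (@compbB_subproof V W Z).

Lemma compbbE V W Z g f : compbb V W Z g f = compb g f.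
Proof. by []. Qed.

Lemma norm_compbb V W Z : `|compbb V W Z| <= 1.
Proof.
apply: norm_blin_le => // g; rewrite mul1r; apply: norm_blin_le => // f.
exact: norm_compb.
Qed.

Lemma flipb1_subproof V W Z (B : blin V (blin W Z)) (y : W) :
  bounded_linear (fun x => B x y).
Proof.
split; first by move=> a u v; rewrite linearP.
exists (`|B| * `|y|) => x; rewrite mulrAC.
by apply: blin_le => //; apply: blin_norm_le.
Qed.
Definition flipb1 V W Z (B : blin V (blin W Z)) y : blin V Z :=
  mkblin (flipb1_subproof B y).

Lemma norm_flipb1 V W Z (B : blin V (blin W Z)) y :
  `|flipb1 B y| <= `|B| * `|y|.
Proof.
apply: norm_blin_le => [|x]; first by rewrite mulr_ge0.
rewrite mulrAC [flipb1 B y x]/(B x y).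
by apply: blin_le => //; apply: blin_norm_le.
Qed.

Lemma flipb_subproof V W Z (B : blin V (blin W Z)) :
  bounded_linear (fun y => flipb1 B y).
Proof.
split; first by move=> a u v; apply: blinP => x /=; rewrite linearP.
by exists `|B| => y; apply: norm_flipb1.
Qed.
Definition flipb V W Z (B : blin V (blin W Z)) : blin W (blin V Z) :=
  mkblin (flipb_subproof B).

Lemma norm_flipb V W Z (B : blin V (blin W Z)) : `|flipb B| <= `|B|.
Proof. by apply: norm_blin_le => // y; apply: norm_flipb1. Qed.

Lemma scaleb_subproof V (v : V) : bounded_linear (fun a : R^o => a *: v).
Proof.
split=> [a u w|]; first by rewrite scalerDl scalerA.
by exists `|v| => a; rewrite normrZ mulrC.
Qed.
Definition scaleb V (v : V) : blin R^o V := mkblin (scaleb_subproof v).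

Lemma scalebb_subproof V : bounded_linear (@scaleb V).
Proof.
split=> [a u w|].
  apply: blinP => b; rewrite mkblinE blinDE blinZE !mkblinE scalerDr !scalerA [b * a]mulrC; by [].
exists 1 => v; rewrite mul1r; apply: norm_blin_le => // a.
by rewrite normrZ mulrC.
Qed.
Definition scalebb V : blin V (blin R^o V) := mkblin (@scalebb_subproof V).

Lemma norm_scalebb V : `|scalebb V| <= 1.
Proof.
apply: norm_blin_le => // v; rewrite mul1r; apply: norm_blin_le => // a.
by rewrite normrZ mulrC.
Qed.

End Blin.

Section BlinComplete.
Context {R : realType} (V : normedModType R) (W : completeNormedModType R).

(** Completeness of operator spaces is what allows the contraction principle to be applied to
    differentials and to the square root of an operator. *)
Lemma blin_complete (F : set_system (blin V W)) :
  ProperFilter F -> cauchy F -> cvg F.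
Proof.
move=> FF /cauchy_ballP Fc.
pose near_bl (e : R) (f g : blin V W) := forall x, `|f x - g x| <= e * `|x|.
pose near_fun (e : R) (g : V -> W) (f : blin V W) := forall x, `|f x - g x| <= e * `|x|.
have Fsm (e : R) : 0 < e ->
    \forall f \near F, \forall g \near F, near_bl e f g.
  move=> e0; have /cauchy_ballP/cauchyP/(_ e e0) [f0 Ff0] := Fc.
  have /cauchy_ballP/cauchyP/(_ (e / 2) ltac:(by rewrite divr_gt0)) [f1 Ff1] := Fc.
  near=> f; near=> g => x.
  have f1f : ball f1 (e / 2) f by near: f.
  have f1g : ball f1 (e / 2) g by near: g.
  have : `|f - g| <= e.
    rewrite (splitr e) -(subrKA f1); apply: le_trans (ler_normD _ _) _.
    by rewrite lerD// ltW// distrC.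
  move=> fg; rewrite -[f x - g x]/((f - g) x).
  by apply: blin_le.
pose Fx x := (fun f : blin V W => f x) @ F.
have Fxc x : cvg (Fx x).
  apply: cauchy_cvg; apply: cauchy_exP => e e0.
  have x1 : 0 < `|x| + 1 by rewrite ltr_wpDl.
  have ex0 : 0 < e / (`|x| + 1) by rewrite divr_gt0.
  have [f0 f0P] := filter_ex (Fsm _ ex0).
  exists (f0 x); suff : F [set g : blin V W | ball (f0 x) e (g x)] by [].
  apply: filterS f0P => g f0P /=.
  rewrite -ball_normE /=; apply: le_lt_trans (f0P x) _.
  by rewrite mulrAC ltr_pdivrMr// ltr_pM2l// ltrDl.
pose g x := lim (Fx x).
have gP x (e : R) : 0 < e -> F [set h : blin V W | `|h x - g x| < e].
  move=> e0; have /cvgrPdist_lt/(_ e e0) := Fxc x.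
  move=> Fh; suff : F [set h : blin V W | `|g x - h x| < e].
    by apply: filterS => h /=; rewrite distrC.
  exact: Fh.
(* The Cauchy estimate holds for all [x] at once; passing to the limit in [h] separately for each
   [x] preserves it. *)
have Fg (e : R) : 0 < e -> \forall f \near F, near_fun e g f.
  move=> e0; near=> f => x; apply/ler_addgt0Pl => d d0.
  have fP : \forall h \near F, near_bl e f h.
    by near: f; exact: Fsm.
  have [h [h1 h2]] := filter_ex (filterI fP (gP x d d0)).
  by rewrite -(subrKA (h x)) addrC; apply: le_trans (ler_normD _ _) _; rewrite lerD// ltW.
have gB : bounded_linear g.
  have lt01' : (0 : R) < 1 by [].
  split; last first.
    have [f fP] := filter_ex (Fg 1 lt01'); exists (`|f| + 1) => x.
    have -> : g x = f x - (f x - g x) by rewrite opprB addrCA subrr addr0.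
    apply: le_trans (ler_normB _ _) _.
    by rewrite mulrDl lerD// blin_norm_le.
  move=> a u v; apply/eqP; rewrite -subr_eq0 -normr_le0; apply/ler_addgt0Pl => e e0.
  pose K := `|a *: u + v| + `|a| * `|u| + `|v| + 1.
  have K0 : 0 < K by rewrite ltr_wpDl// !addr_ge0// mulr_ge0.
  have eK : 0 < e / K by exact: divr_gt0.
  have [f fP] := filter_ex (Fg (e / K) eK).
  have -> : g (a *: u + v) - (a *: g u + g v) =
     a *: (f u - g u) + (f v - g v) - (f (a *: u + v) - g (a *: u + v)).
    by rewrite blinD blinZ; modeq R W.
  rewrite addr0; apply: le_trans (ler_normB _ _) _.
  apply: le_trans (lerD (ler_normD _ _) (lexx _)) _; rewrite normrZ.
  apply: (@le_trans _ _ (`|a| * (e / K * `|u|) + e / K * `|v| + e / K * `|a *: u + v|)).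
    by rewrite !lerD// ler_wpM2l.
  rewrite mulrCA -!mulrDr mulrAC ler_pdivrMr// ler_pM2l// /K; lra.
apply/cvg_ex; exists (mkblin gB).
apply/cvgrPdist_le => e e0.
have := Fg e e0; apply: filterS => f fP; rewrite distrC.
by apply: norm_blin_le => [|x]; [exact: ltW|exact: fP].
Unshelve. all: by end_near. Qed.

HB.instance Definition _ := Uniform_isComplete.Build (blin V W) blin_complete.

End BlinComplete.

(** * Differentials as bounded operators *)

Section Derivative.
Context {R : realType}.
Implicit Types U V W X Y Z : normedModType R.

(** [fdiff] is total, so its value alone does not express differentiability. *)
Definition isd V W (f : V -> W) x (L : blin V W) :=
  differentiable f x /\ fdiff f x = L.

Definition epsd V W (f : V -> W) x (L : blin V W) :=
  forall e : R, 0 < e -> exists2 d : R, 0 < d &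
    forall h, `|h| < d -> `|f (x + h) - f x - L h| <= e * `|h|.

Lemma isd_diffE V W (f : V -> W) x (L : blin V W) :
  differentiable f x -> 'd f x = L :> (V -> W) -> isd f x L.
Proof.
by move=> df dfL; split=> //; apply: blinP => v; rewrite fdiffE// dfL.
Qed.

Lemma isd_diff V W (f : V -> W) x (L : blin V W) :
  isd f x L -> 'd f x = L :> (V -> W).
Proof. by move=> [df <-]; apply/funext => v; rewrite fdiffE. Qed.

Lemma diff_isd V W (f : V -> W) x : differentiable f x -> isd f x (fdiff f x).
Proof. by []. Qed.

Lemma epsdP V W (f : V -> W) x (L : blin V W) : epsd f x L <-> isd f x L.
Proof.
split=> [fL|[df <-]].
  have H : f \o shift x = cst (f x) + L +o_ (0 : V) id.
    apply/eqaddoP => e e0; have [d d0 dP] := fL e e0.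
    apply/nbhs_normP; exists d => // h /=; rewrite sub0r normrN => hd.
    by rewrite -[_ h]/(f (h + x) - (f x + L h)) opprD addrA addrC [h + x]addrC addrC dP.
  have dL := diff_unique (@blin_continuous _ _ _ L) H.
  apply: isd_diffE => //; apply/diff_locallyP; rewrite dL; split=> //.
  exact: blin_continuous.
move=> e e0; have /diff_locallyP[_] := df => /eqaddoP/(_ e e0)/nbhs_normP[d d0 dP].
exists d => // h hd.
have := dP h; rewrite /= sub0r normrN => /(_ hd).
by rewrite -[_ h]/(f (h + x) - (f x + 'd f x h)) fdiffE// opprD addrA [h + x]addrC.
Qed.

Lemma isd_near V W (f g : V -> W) x L d : 0 < d ->
  (forall y, `|y - x| < d -> f y = g y) -> isd f x L -> isd g x L.
Proof.
move=> d0 fg /epsdP fL; apply/epsdP => e e0; have [d' d'0 d'P] := fL e e0.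
exists (Num.min d d'); first by rewrite lt_min d0.
move=> h; rewrite lt_min => /andP[hd hd'].
have <- : f x = g x by apply: fg; rewrite subrr normr0.
have <- : f (x + h) = g (x + h) by apply: fg; rewrite addrC addKr.
exact: d'P.
Qed.

Lemma open_ball (T : normedModType R) (A : set T) x : open A -> A x ->
  exists2 d : R, 0 < d & forall y, `|y - x| < d -> A y.
Proof.
move=> oA Ax; have /nbhs_normP[d /= d0 dA] : nbhs x A by apply: open_nbhs_nbhs.
by exists d => // y yx; apply: dA => /=; rewrite distrC.
Qed.

Lemma isd_eq_on V W (A : set V) (f g : V -> W) x L : open A -> A x ->
  (forall y, A y -> f y = g y) -> isd f x L -> isd g x L.
Proof.
move=> oA Ax fg; have [d d0 dA] := open_ball oA Ax.
by apply: isd_near d0 _ => y /dA; apply: fg.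
Qed.

Lemma isd_cst V W (c : W) x : isd (fun _ : V => c) x 0.
Proof.
apply: isd_diffE; first exact: differentiable_cst.
by rewrite diff_cst.
Qed.

Lemma isd_blin V W (L : blin V W) x : isd L x L.
Proof.
apply/epsdP => e e0; exists 1 => // h _.
have -> : L (x + h) - L x - L h = 0 by rewrite blinD; modeq R W.
by rewrite normr0 mulr_ge0// ltW.
Qed.

Lemma isd_id V (x : V) : isd id x (idb V).
Proof. exact: (isd_blin (idb V)). Qed.

Lemma isdD V W (f g : V -> W) x L M :
  isd f x L -> isd g x M -> isd (fun y => f y + g y) x (L + M).
Proof.
move=> fL gM; have [df _] := fL; have [dg _] := gM.
apply: isd_diffE; first exact: differentiableD.
by rewrite (diffD df dg) (isd_diff fL) (isd_diff gM).
Qed.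

Lemma isd_comp U V W (g : V -> W) (f : U -> V) x L M :
  isd f x L -> isd g (f x) M -> isd (fun y => g (f y)) x (compb M L).
Proof.
move=> fL gM; apply: isd_diffE; first by apply: differentiable_comp; [case: fL|case: gM].
by rewrite diff_comp ?(isd_diff fL) ?(isd_diff gM)//; [case: fL|case: gM].
Qed.

Lemma isd_blinl V W Z (L : blin W Z) (f : V -> W) x M :
  isd f x M -> isd (fun y => L (f y)) x (compb L M).
Proof. by move=> fM; apply: isd_comp fM (isd_blin _ _). Qed.

Lemma isdN V W (f : V -> W) x L : isd f x L -> isd (fun y => - f y) x (- L).
Proof.
move=> /(isd_blinl (- idb W)); rewrite (_ : compb _ _ = - L)//.
exact: blinP.
Qed.

Lemma isdB V W (f g : V -> W) x L M :
  isd f x L -> isd g x M -> isd (fun y => f y - g y) x (L - M).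
Proof. by move=> fL gM; apply: isdD => //; apply: isdN. Qed.

Lemma isdZ V W a (f : V -> W) x L : isd f x L -> isd (fun y => a *: f y) x (a *: L).
Proof.
move=> /(isd_blinl (a *: idb W)); rewrite (_ : compb _ _ = a *: L)//.
exact: blinP.
Qed.

Definition dbil V X Y Z (B : blin X (blin Y Z)) (a : X) (b : Y)
    (L : blin V X) (M : blin V Y) : blin V Z :=
  compbb V Y Z (B a) M + compbb V X Z (flipb B b) L.

Lemma epsd_lip V W (f : V -> W) x L : isd f x L -> exists2 d : R, 0 < d &
  forall h, `|h| < d -> `|f (x + h) - f x| <= (`|L| + 1) * `|h|.
Proof.
move=> /epsdP/(_ 1 ltr01)[d d0 dP]; exists d => // h /dP; rewrite mul1r => H.
rewrite -(subrK (L h) (f (x + h) - f x)); apply: le_trans (ler_normD _ _) _.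
by rewrite addrC mulrDl mul1r lerD// blin_norm_le.
Qed.

Lemma isd_cont V W (f : V -> W) x L : isd f x L -> forall e : R, 0 < e ->
  exists2 d : R, 0 < d & forall h, `|h| < d -> `|f (x + h) - f x| < e.
Proof.
move=> /epsd_lip[d d0 dP] e e0; have K0 : 0 < `|L| + 1 by rewrite ltr_wpDl.
exists (Num.min d (e / (`|L| + 1))); first by rewrite lt_min d0 divr_gt0.
move=> h; rewrite lt_min => /andP[hd he]; apply: le_lt_trans (dP _ hd) _.
by rewrite mulrC -ltr_pdivlMr.
Qed.

Lemma isd_bilin V X Y Z (B : blin X (blin Y Z)) (f : V -> X) (g : V -> Y) x L M :
  isd f x L -> isd g x M ->
  isd (fun y => B (f y) (g y)) x (dbil B (f x) (g x) L M).
Proof.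
move=> fL gM; apply/epsdP => e e0.
have /epsdP fe := fL; have /epsdP ge := gM.
(* The increment is a sum of three terms: the remainder of [g], the remainder of [f], and the
   product of both increments. The constants [a], [b], [c] bound their coefficients, and each term
   receives a third of [e]. *)
pose a := `|B| * (`|f x| + 1) + 1; pose b := `|B| * `|g x| + 1.
pose c := `|B| * (`|L| + 1) * (`|M| + 1) + 1.
have a0 : 0 < a by rewrite ltr_wpDl// mulr_ge0// addr_ge0.
have b0 : 0 < b by rewrite ltr_wpDl// mulr_ge0// addr_ge0.
have c0 : 0 < c by rewrite ltr_wpDl// !mulr_ge0// addr_ge0.
have [d1 d10 d1P] := fe (e / (3 * b)) ltac:(by rewrite divr_gt0// mulr_gt0).
have [d2 d20 d2P] := ge (e / (3 * a)) ltac:(by rewrite divr_gt0// mulr_gt0).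
have [d3 d30 d3P] := epsd_lip fL.
have [d4 d40 d4P] := epsd_lip gM.
exists (Num.min (Num.min d1 d2) (Num.min (Num.min d3 d4) (e / (3 * c)))).
  by rewrite !lt_min d10 d20 d30 d40/= divr_gt0// mulr_gt0.
move=> h; rewrite !lt_min => /andP[/andP[h1 h2] /andP[/andP[h3 h4] h5]].
have -> : B (f (x + h)) (g (x + h)) - B (f x) (g x) - dbil B (f x) (g x) L M h =
   B (f x) (g (x + h) - g x - M h) + B (f (x + h) - f x - L h) (g x)
   + B (f (x + h) - f x) (g (x + h) - g x).
  rewrite /dbil blinDE !compbbE.
  rewrite -[compb (B (f x)) M h]/(B (f x) (M h)).
  rewrite -[compb (flipb B (g x)) L h]/(B (L h) (g x)).
  by rewrite ?blinB ?blinBE ?blinB; modeq R Z.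
have A1 : `|B (f x) (g (x + h) - g x - M h)| <= e / 3 * `|h|.
  apply: le_trans (blin_le (blin_norm_le _ _) (d2P _ h2)) _.
  rewrite mulrA ler_wpM2r// mulrA ler_pdivrMr ?mulr_gt0//.
  have -> : e / 3 * (3 * a) = a * e by field.
  by rewrite ler_wpM2r ?(ltW e0)// /a; have := normr_ge0 B; lra.
have A2 : `|B (f (x + h) - f x - L h) (g x)| <= e / 3 * `|h|.
  apply: le_trans (blin_le (blin_le (lexx _) (d1P _ h1)) (lexx _)) _.
  rewrite mulrAC mulrA ler_wpM2r// mulrA ler_pdivrMr ?mulr_gt0//.
  have -> : e / 3 * (3 * b) = b * e by field.
  by rewrite ler_wpM2r ?(ltW e0)// /b; lra.
have A3 : `|B (f (x + h) - f x) (g (x + h) - g x)| <= e / 3 * `|h|.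
  apply: le_trans (blin_le (blin_le (lexx _) (d3P _ h3)) (d4P _ h4)) _.
  rewrite [leLHS](_ : _ = (c - 1) * `|h| * `|h|); last by rewrite /c; ring.
  rewrite ler_wpM2r//; apply: (@le_trans _ _ (c * `|h|)).
    by rewrite ler_wpM2r// gerBl.
  rewrite mulrC -ler_pdivlMr// (le_trans (ltW h5))//.
  by rewrite invfM mulrA.
apply: le_trans (ler_normD _ _) _; apply: le_trans (lerD (ler_normD _ _) (lexx _)) _.
apply: le_trans (lerD (lerD A1 A2) A3) _.
by rewrite -!mulrDl ler_wpM2r//; lra.
Qed.

End Derivative.

(** * Bounds for all derivatives up to a given order *)

Section BoundedDerivatives.
Context {R : realType}.
Implicit Types V W X Y Z : normedModType R.

(* The derivatives of order at most [k] exist and are bounded by [c] on [U]. *)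
Fixpoint cb (k : nat) V W (c : R) (U : set V) (f : V -> W) : Prop :=
  (forall x, U x -> `|f x| <= c) /\
  (if k is k'.+1 then
    (forall x, U x -> differentiable f x) /\ cb k' c U (fdiff f)
   else True).

(** The values of [f] are left free: the inner function of a composition, such as [x + f x], has
    controlled derivatives while its values depend on the position in space. *)
Definition dcb k V W (c : R) (U : set V) (f : V -> W) :=
  (forall x, U x -> differentiable f x) /\ cb k c U (fdiff f).

Lemma cb_norm k V W c (U : set V) (f : V -> W) x :
  cb k c U f -> U x -> `|f x| <= c.
Proof. by case: k => [|k] [H _]; apply: H. Qed.

Lemma cb_dcb k V W c (U : set V) (f : V -> W) : cb k.+1 c U f -> dcb k c U f.
Proof. by case. Qed.

Lemma cbS k V W c (U : set V) (f : V -> W) :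
  (forall x, U x -> `|f x| <= c) -> dcb k c U f -> cb k.+1 c U f.
Proof. by []. Qed.

Lemma cb_isd k V W c (U : set V) (f : V -> W) x :
  cb k.+1 c U f -> U x -> isd f x (fdiff f x).
Proof. by move=> [_ [df _]] Ux; split=> //; apply: df. Qed.

Lemma cb_sub k V W c (U U' : set V) (f : V -> W) :
  U' `<=` U -> cb k c U f -> cb k c U' f.
Proof.
move=> UU; elim: k W f => [|k IH] W f [fc H]; split=> //.
- by move=> x /UU; apply: fc.
- by move=> x /UU; apply: fc.
- by case: H => df /IH ?; split=> // x /UU; apply: df.
Qed.

Lemma cb_mono k V W c c' (U : set V) (f : V -> W) :
  c <= c' -> cb k c U f -> cb k c' U f.
Proof.
move=> cc; elim: k W f => [|k IH] W f [fc H]; split=> //.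
- by move=> x Ux; apply: le_trans (fc x Ux) cc.
- by move=> x Ux; apply: le_trans (fc x Ux) cc.
- by case: H => df /IH.
Qed.

Lemma cb_pred k V W c (U : set V) (f : V -> W) : cb k.+1 c U f -> cb k c U f.
Proof.
elim: k W f => [|k IH] W f; first by case.
by move=> [fc [df H]]; split=> //; split=> //; apply: IH.
Qed.

Lemma cb_eq k V W c (U : set V) (f g : V -> W) : open U ->
  (forall x, U x -> f x = g x) -> cb k c U f -> cb k c U g.
Proof.
move=> oU; elim: k W f g => [|k IH] W f g fg [fc H].
  by split=> // x Ux; rewrite -(fg x Ux); apply: fc.
split; first by move=> x Ux; rewrite -(fg x Ux); apply: fc.
have [df H'] := H.
have E x : U x -> isd g x (fdiff f x).
  by move=> Ux; exact: (isd_eq_on oU Ux fg (diff_isd (df _ Ux))).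
split=> [x /E[]//|]; apply: IH H' => x /E[_ ->//].
Qed.

(** The derivative may be given by a formula that is valid on [U] only; since [U] is open, the
    formula can replace [fdiff f] in all further derivatives. *)
Lemma cbSI k V W c (U : set V) (f : V -> W) (f' : V -> blin V W) : open U ->
  (forall x, U x -> `|f x| <= c) -> (forall x, U x -> isd f x (f' x)) ->
  cb k c U f' -> cb k.+1 c U f.
Proof.
move=> oU fc ff' H; split=> //; split=> [x /ff'[]//|].
by apply: cb_eq oU _ H => x /ff'[_ ->].
Qed.

Lemma dcbI k V W c (U : set V) (f : V -> W) (f' : V -> blin V W) : open U ->
  (forall x, U x -> isd f x (f' x)) -> cb k c U f' -> dcb k c U f.
Proof.
move=> oU ff' H; split=> [x /ff'[]//|].
by apply: cb_eq oU _ H => x /ff'[_ ->].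
Qed.

Lemma cb_cst k V W c (U : set V) (a : W) : open U -> `|a| <= c ->
  cb k c U (fun=> a).
Proof.
move=> oU; elim: k W a => [|k IH] W a ac; first by split.
apply: (cbSI (f' := fun=> 0)) => // [x _|]; first exact: isd_cst.
by apply: IH; rewrite normr0 (le_trans _ ac).
Qed.

Lemma cb_affine k V W c (U : set V) (f : V -> W) (L : blin V W) : open U ->
  (forall x, U x -> `|f x| <= c) -> (forall x, U x -> isd f x L) ->
  `|L| <= c -> cb k c U f.
Proof.
case: k => [|k] oU fc fL Lc; first by split.
by apply: (cbSI (f' := fun=> L)) => //; apply: cb_cst.
Qed.

Lemma cbD k V W c d (U : set V) (f g : V -> W) : open U ->
  cb k c U f -> cb k d U g -> cb k (c + d) U (fun x => f x + g x).
Proof.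
move=> oU; elim: k W f g => [|k IH] W f g fP gP.
  split=> // x Ux; apply: le_trans (ler_normD _ _) _.
  by rewrite lerD// ?(cb_norm fP)// (cb_norm gP).
apply: (cbSI (f' := fun x => fdiff f x + fdiff g x)) => //.
- move=> x Ux; apply: le_trans (ler_normD _ _) _.
  by rewrite lerD// ?(cb_norm fP)// (cb_norm gP).
- by move=> x Ux; apply: isdD; [apply: cb_isd fP _|apply: cb_isd gP _].
- by apply: IH; [case: fP => _ []|case: gP => _ []].
Qed.

Lemma dcb_addid k V c (U : set V) (f : V -> V) : open U ->
  cb k.+1 c U f -> dcb k (1 + c) U (fun x => x + f x).
Proof.
move=> oU fP; apply: (dcbI (f' := fun x => idb V + fdiff f x)) => // [x Ux|].
  by apply: isdD (isd_id x) _; apply: cb_isd fP Ux.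
by apply: cbD => //; [apply: cb_cst => //; apply: norm_idb|case: fP => _ []].
Qed.

Lemma cb_blinl k V W Z c l (U : set V) (L : blin W Z) (f : V -> W) : open U ->
  0 <= c -> `|L| <= l -> cb k c U f -> cb k (l * c) U (fun x => L (f x)).
Proof.
move=> oU c0; elim: k W Z L f => [|k IH] W Z L f Ll fP.
  by split=> // x Ux; apply: blin_le => //; apply: cb_norm fP Ux.
apply: (cbSI (f' := fun x => compbl V L (fdiff f x))) => //.
- by move=> x Ux; apply: blin_le => //; apply: cb_norm fP Ux.
- by move=> x Ux; apply: isd_blinl; apply: cb_isd fP Ux.
apply: IH; last by case: fP => _ [].
apply: le_trans Ll; apply: norm_blin_le => // g; exact: norm_compb.
Qed.

Lemma cbN k V W c (U : set V) (f : V -> W) : open U -> 0 <= c ->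
  cb k c U f -> cb k c U (fun x => - f x).
Proof.
move=> oU c0 fP; rewrite -(mul1r c).
apply: (@cb_blinl _ _ _ _ _ _ _ (- idb W)) => //.
by rewrite normrN norm_idb.
Qed.

Lemma cbB k V W c d (U : set V) (f g : V -> W) : open U -> 0 <= d ->
  cb k c U f -> cb k d U g -> cb k (c + d) U (fun x => f x - g x).
Proof. by move=> oU d0 fP gP; apply: cbD => //; apply: cbN. Qed.

Lemma cbZ k V W c a (U : set V) (f : V -> W) : open U -> 0 <= c ->
  cb k c U f -> cb k (`|a| * c) U (fun x => a *: f x).
Proof.
move=> oU c0 fP; apply: (@cb_blinl _ _ _ _ _ _ _ (a *: idb W)) => //.
rewrite normrZ -[leRHS]mulr1; apply: ler_pM => //; exact: norm_idb.
Qed.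

Lemma cb_sum k V W (I : eqType) (r : seq I) c (U : set V) (F : I -> V -> W) : open U ->
  0 <= c -> (forall i, i \in r -> cb k c U (F i)) ->
  cb k ((size r)%:R * c) U (fun x => \sum_(i <- r) F i x).
Proof.
move=> oU c0; elim: r => [|i r IH] H /=.
  rewrite mul0r; apply: (@cb_eq _ _ _ _ _ (fun=> 0)) => // [x _|].
    by rewrite big_nil.
  by apply: cb_cst => //; rewrite normr0.
rewrite -addn1 natrD mulrDl mul1r addrC.
apply: (@cb_eq _ _ _ _ _ (fun x => F i x + \sum_(i <- r) F i x)) => // [x _|].
  by rewrite big_cons.
apply: cbD => //; first by apply: H; rewrite in_cons eqxx.
by apply: IH => j jr; apply: H; rewrite in_cons jr orbT.
Qed.

Lemma cb_ge0 k V W c (U : set V) (f : V -> W) x : U x -> cb k c U f -> 0 <= c.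
Proof. by move=> Ux fP; apply: le_trans (cb_norm fP Ux). Qed.

(** Each differentiation doubles the number of terms in the Leibniz rule, whence [2 ^+ k]. The
    operator [B] and its spaces vary in the induction, because the two terms of the derivative are
    governed by operators built from [compbb]. *)
Lemma cb_bil k V X Y Z (B : blin X (blin Y Z)) b c d (U : set V)
    (f : V -> X) (g : V -> Y) : open U -> 0 <= c -> 0 <= d -> `|B| <= b ->
  cb k c U f -> cb k d U g ->
  cb k (b * (2 ^+ k * (c * d))) U (fun x => B (f x) (g x)).
Proof.
move=> oU c0 d0; elim: k X Y Z B f g => [|k IH] X Y Z B f g Bb fP gP.
  split=> // x Ux; rewrite expr0 mul1r mulrA.
  by apply: blin_le; [apply: blin_le => //; apply: cb_norm fP Ux|apply: cb_norm gP Ux].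
have b0 : 0 <= b by apply: le_trans Bb.
apply: (cbSI (f' := fun x => compb (compbb V Y Z) B (f x) (fdiff g x)
                   + compb (compbb V X Z) (flipb B) (g x) (fdiff f x))) => //.
- move=> x Ux; apply: (@le_trans _ _ (b * (c * d))).
    rewrite mulrA; apply: blin_le; last exact: cb_norm gP Ux.
    by apply: blin_le => //; apply: cb_norm fP Ux.
  by rewrite ler_wpM2l// ler_peMl ?mulr_ge0// exprn_ege1// ler1n.
- by move=> x Ux; apply: isd_bilin; [apply: cb_isd fP Ux|apply: cb_isd gP Ux].
have -> : b * (2 ^+ k.+1 * (c * d)) =
  b * (2 ^+ k * (c * d)) + b * (2 ^+ k * (d * c)) by rewrite exprS; ring.
apply: cbD => //.
- apply: IH; [|exact: cb_pred fP|by case: gP => _ []].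
  apply: le_trans (norm_compb _ _) _; rewrite -[leRHS]mul1r.
  by apply: ler_pM => //; apply: norm_compbb.
- rewrite [d * c]mulrC.
  (* The induction hypothesis fixes [c] for the first and [d] for the second argument, so the
     operator is flipped to put [fdiff f] first. *)
  have -> : cb k (b * (2 ^+ k * (c * d))) U (fun x : V => compb (compbb V X Z) (flipb B) (g x) (fdiff f x)) =
     cb k (b * (2 ^+ k * (c * d))) U (fun x : V => flipb (compb (compbb V X Z) (flipb B)) (fdiff f x) (g x)) by [].
  apply: IH; [|by case: fP => _ []|exact: cb_pred gP].
  apply: le_trans (norm_flipb _) _.
  apply: le_trans (norm_compb _ _) _; rewrite -[leRHS]mul1r.
  apply: ler_pM => //; first exact: norm_compbb.
  exact: le_trans (norm_flipb _) Bb.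
Qed.

(* The bound for [g \o f] is linear in the bound for [g]; only the derivatives
   of [f] enter. *)
Fixpoint compK (b : R) k : R :=
  if k is k'.+1 then Num.max 1 b * (2 ^+ k' * compK b k') else 1.

Lemma compK_ge1 b k : 1 <= compK b k.
Proof.
elim: k => //= k IH.
by rewrite !mulr_ege1// ?le_max ?lexx// exprn_ege1// ler1n.
Qed.

(** The chain rule gives a product of [fdiff g] composed with [f] and [fdiff f]; the induction
    hypothesis applies to the former with [fdiff g] in the place of [g]. *)
Lemma cb_comp k (U : normedModType R) V W b c (A : set U) (D : set V) (g : V -> W) (f : U -> V) :
  open A -> 0 <= c -> (forall x, A x -> D (f x)) ->
  cb k c D g -> (if k is k'.+1 then dcb k' b A f else True) -> cb k (compK b k * c) A (fun x => g (f x)).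
Proof.
move=> oA c0 AD; elim: k W g => [|k IH] W g gP fP.
  by split=> // x /AD Dx; rewrite mul1r; apply: cb_norm gP Dx.
have K1 := compK_ge1 b k.
apply: (cbSI (f' := fun x => compbb U V W (fdiff g (f x)) (fdiff f x))) => //.
- move=> x Ax; apply: le_trans (cb_norm gP (AD _ Ax)) _.
  by rewrite ler_peMl// compK_ge1.
- move=> x Ax; apply: isd_comp; first exact: diff_isd (fP.1 x Ax).
  exact: cb_isd gP (AD _ Ax).
have -> : compK b k.+1 * c = 1 * (2 ^+ k * ((compK b k * c) * Num.max 1 b)).
  by rewrite /=; ring.
apply: cb_bil => //.
- by rewrite mulr_ge0// (le_trans _ K1).
- by rewrite le_max ler01.
- exact: norm_compbb.
- apply: IH; first by case: gP => _ [].
  case: k {K1 gP} fP => [|k] [] // df fP; split=> //=.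
  exact: cb_pred fP.
- apply: cb_mono (proj2 fP); by rewrite le_max lexx orbT.
Qed.

(** [fdiffn] adds derivatives on the outside, whereas [cb] peels them off on the inside. The two
    types of multilinear maps agree for each numeral but are not convertible for a variable [k], so
    the equality is stated between dependent pairs and transported along predicates on them. *)
Lemma fdiffnSr V W (f : V -> W) k :
  existT (fun Z : normedModType R => V -> Z) (multilin V (blin V W) k) (fdiffn k (fdiff f))
  = existT (fun Z : normedModType R => V -> Z) (multilin V W k.+1) (fdiffn k.+1 f).
Proof.
elim: k => // k IH.
pose F (s : {Z : normedModType R & V -> Z}) :=
  existT (fun Z : normedModType R => V -> Z)
    (blin V (projT1 s) : normedModType R) (fdiff (projT2 s)).
exact: (congr1 F IH).
Qed.

Lemma smooth_onP V W (U : set V) (f : V -> W) :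
  (forall k, exists c, cb k c U f) -> smooth_on U f.
Proof.
move=> H k; have [c] := H k.+1; elim: k c W f {H} => [|k IH] c W f.
  by move=> [_ [df _]] x /df.
move=> [_ [df /IH H]] x /H.
pose P (s : {Z : normedModType R & V -> Z}) := differentiable (projT2 s) x.
by have := congr1 P (fdiffnSr f k); rewrite /P /= => ->.
Qed.

Lemma cb_fdiffn k V W c (U : set V) (f : V -> W) x :
  cb k c U f -> U x -> `|fdiffn k f x| <= c.
Proof.
elim: k c W f => [|k IH] c W f; first by move=> [fc _] /fc.
move=> [_ [df /IH H]] /H.
pose P (s : {Z : normedModType R & V -> Z}) := `|projT2 s x| <= c.
by have := congr1 P (fdiffnSr f k); rewrite /P /= => ->.
Qed.

End BoundedDerivatives.

(** * Fixed points and inverse maps *)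

Section FixedPoints.
Context {R : realType}.

Lemma contraction_fixpoint (W : completeNormedModType R) (U : set W) (f : W -> W)
    (q : R) : closed U -> U !=set0 -> 0 <= q < 1 ->
  (forall x, U x -> U (f x)) ->
  (forall x y, U x -> U y -> `|f x - f y| <= q * `|x - y|) ->
  exists2 p, U p & p = f p.
Proof.
move=> cU U0 /andP[q0 q1] fU fq.
have fU' : set_fun U U f by [].
pose g : {fun U >-> U} := HB.pack f (isFun.Build _ _ _ _ f fU').
apply: (@banach_fixed_point _ _ _ g) => //.
exists (NngNum q0); split => //= -[x y] [Ux Uy] /=; exact: fq.
Qed.

Variables (V : normedModType R) (W : completeNormedModType R).
Implicit Types (q : R) (U : set V).

(** The solution is [(1 - D2)^-1 D1], obtained as the fixed point of a contraction. *)
Lemma linear_fixpoint q (D1 : blin V W) (D2 : blin W W) : q < 1 ->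
  `|D2| <= q -> exists L : blin V W, L = D1 + compb D2 L.
Proof.
move=> q1 Dq; have q0 : 0 <= q by apply: le_trans Dq.
have q01 : 0 <= q < 1 by rewrite q0.
have n0 : [set: blin V W] !=set0 by exists 0.
have ctr (L M : blin V W) : [set: blin V W] L -> [set: blin V W] M ->
    `|(D1 + compb D2 L) - (D1 + compb D2 M)| <= q * `|L - M|.
  move=> _ _; rewrite (_ : _ - _ = compb D2 (L - M)).
    by apply: le_trans (norm_compb _ _) _; rewrite ler_wpM2r.
  apply: blinP => v; rewrite blinDE blinNE !blinDE !compbE blinBE blinB.
  by modeq R W.
have [L _ LP] := contraction_fixpoint closedT n0 q01 (fun _ _ => I) ctr.
by exists L.
Qed.

(** Implicit differentiation with no regularity of [u] presupposed. With [k] the increment of [u],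
    the hypothesis says that [k = D1 h + D2 k] up to a small error. As [D2] contracts, this first
    gives [|k| <= C |h|], and then bounds [k - L h], where [L] solves the same equation exactly. *)
Lemma isd_implicit q (u : V -> W) x (D1 : blin V W) (D2 : blin W W) : q < 1 ->
  `|D2| <= q ->
  (forall e : R, 0 < e -> exists2 d : R, 0 < d & forall h, `|h| < d ->
    `|u (x + h) - u x - D1 h - D2 (u (x + h) - u x)|
      <= e * (`|h| + `|u (x + h) - u x|)) ->
  differentiable u x /\ fdiff u x = D1 + compb D2 (fdiff u x).
Proof.
move=> q1 Dq H; have [L LP] := linear_fixpoint D1 q1 Dq.
suff : isd u x L by move=> [du ->].
have q10 : 0 < 1 - q by rewrite subr_gt0.
(* Half of the gap [1 - q] absorbs the part of the error proportional to [|k|]; the other half is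
   the denominator of [C]. *)
pose r := (1 - q) / 2.
have r0 : 0 < r by rewrite divr_gt0.
pose C := (`|D1| + r) / r.
have C0 : 0 <= C by rewrite divr_ge0 ?addr_ge0// ltW.
have [d1 d10 d1P] := H r r0.
apply/epsdP => e e0.
have [d2 d20 d2P] := H (e * (1 - q) / (1 + C))
  ltac:(by rewrite divr_gt0 ?mulr_gt0// ltr_pwDl).
exists (Num.min d1 d2); first by rewrite lt_min d10.
move=> h; rewrite lt_min => /andP[h1 h2]; have {d1P d2P} := (d1P _ h1, d2P _ h2).
move: (u (x + h) - u x) => k [H1 H2].
have Dk : `|D2 k| <= q * `|k| by apply: blin_le.
have kC : `|k| <= C * `|h|.
  have E : k = (k - D1 h - D2 k) + D1 h + D2 k by modeq R W.
  have : `|k| <= r * (`|h| + `|k|) + `|D1| * `|h| + q * `|k|.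
    rewrite {1}E; apply: le_trans (ler_normD _ _) _; apply: lerD => //.
    by apply: le_trans (ler_normD _ _) _; apply: lerD => //; apply: blin_norm_le.
  move=> K; rewrite /C mulrAC ler_pdivlMr//; move: K; have -> : q = 1 - 2 * r by rewrite /r; field.
  lra.
have E : k - L h = (k - D1 h - D2 k) + D2 (k - L h).
  have Lh : L h = D1 h + D2 (L h) by rewrite {1}LP blinDE compbE.
  by rewrite blinB {1}Lh; modeq R W.
have : (1 - q) * `|k - L h| <= (1 - q) * (e * `|h|).
  have : `|k - L h| <= `|k - D1 h - D2 k| + q * `|k - L h|.
    by rewrite {1}E; apply: le_trans (ler_normD _ _) _; rewrite lerD// blin_le.
  move=> K; have {}K : (1 - q) * `|k - L h| <= `|k - D1 h - D2 k|.
    by rewrite mulrBl mul1r lerBlDr.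
  apply: le_trans K _; apply: le_trans H2 _.
  rewrite mulrAC ler_pdivrMr ?ltr_pwDl//.
  rewrite [leRHS](_ : _ = e * (1 - q) * (`|h| + C * `|h|)); last by ring.
  by rewrite ler_wpM2l ?lerD2l// mulr_ge0// ltW.
by rewrite ler_pM2l.
Qed.

(** The differential of a solution of [u = A u + B] solves an equation of the same kind, with
    composition by [A x] as its operator and hence the same [q]. This makes the induction in
    [cb_linfix] possible. [flipb (idb _)] is evaluation of an operator at a vector. *)
Lemma isd_linfix q U (A : V -> blin W W) (B u : V -> W) x : open U -> U x ->
  q < 1 -> (forall y, U y -> `|A y| <= q) ->
  (forall y, U y -> u y = A y (u y) + B y) ->
  differentiable A x -> differentiable B x ->
  differentiable u x /\
  fdiff u x = compbb V W W (A x) (fdiff u x)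
    + (compb (compbb V (blin W W) W) (flipb (idb (blin W W))) (u x) (fdiff A x)
       + fdiff B x).
Proof.
move=> oU Ux q1 Aq uE dA dB.
pose D1 := compb (compbb V (blin W W) W) (flipb (idb (blin W W))) (u x) (fdiff A x) + fdiff B x.
suff: differentiable u x /\ fdiff u x = D1 + compb (A x) (fdiff u x).
  by move=> [? E]; split=> //; rewrite addrC.
apply: isd_implicit q1 (Aq _ Ux) _ => e e0.
have [dU dU0 dUP] := open_ball oU Ux.
have /epsdP HA := diff_isd dA; have /epsdP HB := diff_isd dB.
have [d1 d10 d1P] := HA (e / 2 / (`|u x| + 1))
  ltac:(by rewrite !divr_gt0// ltr_wpDl).
have [d2 d20 d2P] := HB (e / 2) ltac:(by rewrite divr_gt0).
have [d3 d30 d3P] := isd_cont (diff_isd dA) e0.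
exists (Num.min (Num.min dU d1) (Num.min d2 d3)); first by rewrite !lt_min dU0 d10 d20.
move=> h; rewrite !lt_min => /andP[/andP[hU h1] /andP[h2 h3]].
have Uxh : U (x + h) by apply: dUP; rewrite addrC addKr.
set k := u (x + h) - u x.
have -> : k - D1 h - A x k = (A (x + h) - A x - fdiff A x h) (u x)
    + (A (x + h) - A x) k + (B (x + h) - B x - fdiff B x h).
  have -> : D1 h = (fdiff A x h) (u x) + fdiff B x h by [].
  have Ek : u (x + h) = u x + k by rewrite /k; modeq R W.
  have E1 := uE _ Ux; have E2 := uE _ Uxh.
  have Ek2 : k = A (x + h) (u x) + A (x + h) k + B (x + h) - (A x (u x) + B x).
    by rewrite -blinD -Ek -E1 -E2.
  move: k {Ek} Ek2 => k Ek2; rewrite !blinBE.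
  rewrite {1}Ek2; modeq R W.
have F1 : `|(A (x + h) - A x - fdiff A x h) (u x)| <= e / 2 * `|h|.
  apply: le_trans (blin_le (d1P _ h1) (lexx _)) _.
  rewrite mulrAC ler_wpM2r// mulrAC ler_pdivrMr ?ltr_wpDl//.
  by rewrite ler_wpM2l ?lerDl// ltW// divr_gt0.
have F2 : `|(A (x + h) - A x) k| <= e * `|k| by apply: blin_le => //; apply/ltW/d3P.
have F3 := d2P _ h2.
apply: le_trans (ler_normD _ _) _; apply: le_trans (lerD (ler_normD _ _) (lexx _)) _.
by move: F1 F2 F3; lra.
Qed.

End FixedPoints.

Section FixedPointBounds.
Context {R : realType} (V : normedModType R).

Fixpoint linK (q a : R) k : R :=
  if k is k'.+1 then linK q a k' * (2 ^+ k' * (a * linK q a k') + 1)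
  else (1 - q)^-1.

Lemma linK_gt0 q a k : q < 1 -> 0 <= a -> 0 < linK q a k.
Proof.
move=> q1 a0; elim: k => /= [|k IH]; first by rewrite invr_gt0 subr_gt0.
by rewrite mulr_gt0// ltr_wpDl// !mulr_ge0// ?exprn_ge0// ltW.
Qed.

(** Only the bound [q] on the values of [A] has to be less than 1; the bound [a] on its derivatives
    is arbitrary and enters the constant. The result is linear in [c]. *)
Lemma cb_linfix k (W : completeNormedModType R) q a c (U : set V)
    (A : V -> blin W W) (B u : V -> W) : open U -> 0 <= q < 1 -> 0 <= a -> 0 <= c ->
  (forall y, U y -> `|A y| <= q) -> cb k a U A -> cb k c U B ->
  (forall y, U y -> u y = A y (u y) + B y) ->
  cb k (linK q a k * c) U u.
Proof.
move=> oU /andP[q0 q1] a0.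
elim: k W c A B u => [|k IH] W c A B u c0 Aq cA cB uE.
  split=> // x Ux; rewrite mulrC ler_pdivlMr ?subr_gt0// mulrBr mulr1 lerBlDr.
  rewrite {1}uE//; apply: le_trans (ler_normD _ _) _; rewrite addrC lerD//.
    exact: cb_norm cB Ux.
  by rewrite mulrC; apply: blin_le => //; apply: Aq.
have L0 := linK_gt0 k q1 a0.
have u1 : cb k (linK q a k * c) U u.
  exact: IH c0 Aq (cb_pred cA) (cb_pred cB) uE.
have D x (Ux : U x) := isd_linfix oU Ux q1 Aq uE (proj1 (cb_isd cA Ux)) (proj1 (cb_isd cB Ux)).
have uS x : U x -> `|u x| <= linK q a k.+1 * c.
  move=> Ux; apply: le_trans (cb_norm u1 Ux) _; rewrite ler_wpM2r//=.
  by rewrite ler_peMr ?(ltW L0)// lerDr !mulr_ge0 ?exprn_ge0// ltW.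
apply: cbS => //; split=> [x /D[]//|].
have -> : linK q a k.+1 * c = linK q a k * (2 ^+ k * (linK q a k * c * a) + c).
  by rewrite /=; ring.
apply: (IH (blin V W) _ (fun x => compbb V W W (A x)) (fun x =>
   compb (compbb V (blin W W) W) (flipb (idb (blin W W))) (u x) (fdiff A x)
       + fdiff B x) (fdiff u)).
- by rewrite addr_ge0// !mulr_ge0 ?exprn_ge0// ltW.
- move=> y Uy; apply: le_trans (Aq _ Uy); rewrite -[leRHS]mul1r.
  by apply: blin_le => //; apply: norm_compbb.
- rewrite -(mul1r a); apply: cb_blinl => //; first exact: norm_compbb.
  exact: cb_pred cA.
- apply: cbD => //; last by case: cB => _ [].
  rewrite -[2 ^+ k * _]mul1r; apply: cb_bil => //; first by rewrite mulr_ge0// ltW.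
  + apply: le_trans (norm_compb _ _) _; rewrite -[leRHS]mul1r.
    apply: ler_pM => //; first exact: norm_compbb.
    by apply: le_trans (norm_flipb _) _; apply: norm_idb.
  + by case: cA => _ [].
- by move=> y /D[].
Qed.

End FixedPointBounds.

(** * Inverting a perturbation of the identity *)

Section InverseFunction.
Context {R : realType} (V : completeNormedModType R).
Variables (s t : V -> V) (D D' : set V) (q : R).
Hypotheses (q01 : 0 <= q < 1) (oD : open D) (oD' : open D').
Hypothesis sq : forall x y, D x -> D y -> `|s x - s y| <= q * `|x - y|.

(** The point [y = x + u] satisfies [y - s y = x], so that solving for [u] inverts the map
    [y |-> y - s y]. *)
Lemma perturb_fixpoint r x : 0 <= r -> (forall u, `|u| <= r -> D (x + u)) ->
  (forall y, D y -> `|s y| <= r) -> exists2 u, `|u| <= r & u = s (x + u).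
Proof.
move=> r0 rD sr.
have cU : closed [set u : V | `|u| <= r].
  by apply: (closed_comp _ (@closed_le R r)) => u _; exact: norm_continuous.
have n0 : [set u : V | `|u| <= r] !=set0 by exists 0 => /=; rewrite normr0.
have H1 u : [set u : V | `|u| <= r] u -> [set u : V | `|u| <= r] (s (x + u)).
  by move=> /= ur; apply/sr/rD.
have H2 u v : [set u : V | `|u| <= r] u -> [set u : V | `|u| <= r] v ->
    `|s (x + u) - s (x + v)| <= q * `|u - v|.
  move=> /= ur vr; apply: le_trans (sq (rD _ ur) (rD _ vr)) _.
  by rewrite opprD addrACA subrr add0r.
by have [u ur uE] := contraction_fixpoint cU n0 q01 H1 H2; exists u.
Qed.

Lemma perturb_fixpoint_unique x u v : D (x + u) -> D (x + v) ->
  u = s (x + u) -> v = s (x + v) -> u = v.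
Proof.
move=> Du Dv uE vE; have /andP[q0 q1] := q01.
have := sq Du Dv; rewrite -uE -vE opprD addrACA subrr add0r => H.
apply/eqP; rewrite -subr_eq0 -normr_le0.
have : (1 - q) * `|u - v| <= 0 by lra.
by rewrite pmulr_rle0// subr_gt0.
Qed.

Hypothesis tD : forall x, D' x -> D (x + t x).
Hypothesis tE : forall x, D' x -> t x = s (x + t x).
Hypothesis sd : forall x, D x -> differentiable s x.
Hypothesis sdq : forall x, D x -> `|fdiff s x| <= q.

Lemma isd_perturb x : D' x -> differentiable t x /\
  fdiff t x = fdiff s (x + t x) + compbb V V V (fdiff s (x + t x)) (fdiff t x).
Proof.
move=> Dx; have /andP[q0 q1] := q01.
suff: differentiable t x /\
    fdiff t x = fdiff s (x + t x) + compb (fdiff s (x + t x)) (fdiff t x) by [].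
apply: (isd_implicit q1 (sdq (tD Dx))) => e e0.
have q10 : 0 < 1 - q by rewrite subr_gt0.
have [d1 d10 d1P] := open_ball oD' Dx.
have /epsdP/(_ e e0)[d2 d20 d2P] := diff_isd (sd (tD Dx)).
exists (Num.min d1 (d2 * (1 - q))); first by rewrite lt_min d10 mulr_gt0.
move=> h; rewrite lt_min => /andP[h1 h2].
have Dxh : D' (x + h) by apply: d1P; rewrite addrC addKr.
set k := t (x + h) - t x.
have xhE : x + h + t (x + h) = x + t x + (h + k).
  by rewrite /k; modeq R V.
have kE : k = s (x + t x + (h + k)) - s (x + t x).
  by rewrite -xhE -(tE Dx) -(tE Dxh).
(* The contraction property of [s] makes [t] Lipschitz, hence [h + k] is small when [h] is and the
   differentiability of [s] can be used at it. *)
have kq : (1 - q) * `|k| <= q * `|h|.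
  have : `|k| <= q * `|h + k|.
    rewrite {1}kE; apply: le_trans (sq _ (tD Dx)) _; first by rewrite -xhE; apply: tD.
    by rewrite addrC addKr.
  by have := ler_normD h k; nra.
have hk : `|h + k| < d2.
  rewrite -(ltr_pM2r q10); apply: le_lt_trans h2.
  by have := ler_normD h k; nra.
have := d2P _ hk; rewrite -kE blinD => H.
rewrite (_ : k - _ - _ = k - (fdiff s (x + t x) h + fdiff s (x + t x) k)); last by modeq R V.
by apply: le_trans H _; rewrite ler_wpM2l ?(ltW e0)//; apply: ler_normD.
Qed.

Fixpoint invK (m : R) k : R :=
  if k is k'.+1 then
    let b := 1 + invK m k' * m in
    Num.max (invK m k') (linK q (compK b k' * m) k' * compK b k')
  else 1.

Lemma invK_ge1 m k : 1 <= invK m k.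
Proof. by elim: k => //= k IH; rewrite le_max IH. Qed.

(** The constant [invK m k] uses only the crude bound [m], so the estimate remains linear in the
    possibly much smaller [c]. Differentiating [t x = s (x + t x)] gives a linear fixed point
    equation for [fdiff t], whose coefficients involve [t] only up to the order already treated. *)
Lemma cb_perturb k m c : 0 <= c <= m -> cb k c D s -> cb k (invK m k * c) D' t.
Proof.
move=> /andP[c0 cm]; have /andP[q0 q1] := q01; have m0 := le_trans c0 cm.
elim: k => [|k IH] sc.
  by split=> // x Dx; rewrite mul1r tE//; apply: cb_norm sc (tD Dx).
have K1 := invK_ge1 m k; have K0 := le_trans ler01 K1.
have {}IH := IH (cb_pred sc).
pose b := 1 + invK m k * m.
have Cb := compK_ge1 b k; have Cb0 := le_trans ler01 Cb.
have cA : cb k (compK b k * c) D' (fun x => fdiff s (x + t x)).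
  apply: (cb_comp (D := D)) => //; first by case: sc => _ [].
  case: k IH {sc K1 K0 Cb Cb0} @b => // k IH b.
  have [dt bt] := dcb_addid oD' IH; split=> //; apply: cb_mono bt.
  by rewrite lerD2l ler_wpM2l// (le_trans ler01)// invK_ge1.
have L0 := linK_gt0 k q1 (mulr_ge0 Cb0 m0).
apply: cbS => [x Dx|].
  by apply: le_trans (cb_norm IH Dx) _; rewrite ler_wpM2r// le_max lexx.
split=> [x Dx|]; first by case: (isd_perturb Dx).
apply: (@cb_mono _ _ _ _ (linK q (compK b k * m) k * (compK b k * c))).
  by rewrite mulrA ler_wpM2r//= le_max lexx orbT.
apply: (cb_linfix (A := fun x => compbb V V V (fdiff s (x + t x)))
   (B := fun x => fdiff s (x + t x))) => //.
- by rewrite mulr_ge0.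
- by rewrite mulr_ge0.
- move=> y Dy; rewrite -[leRHS]mul1r; apply: blin_le; first exact: norm_compbb.
  exact: sdq (tD Dy).
- rewrite -(mul1r (compK b k * m)); apply: cb_blinl => //.
  + by rewrite mulr_ge0.
  + exact: norm_compbb.
  + by apply: cb_mono cA; rewrite ler_wpM2l.
- by move=> y Dy; rewrite addrC; case: (isd_perturb Dy).
Qed.

End InverseFunction.

(** * Orthogonal projectors *)

Section InnerProduct.
Context {R : realType} {E : hilbertType R}.
Implicit Types (x y z v w : E) (a : R).

Lemma innerC x y : inner x y = inner y x.
Proof. by rewrite (@hermC _ _ _ _ (@inner R E) x y) expr0 mul1r. Qed.

Lemma innerDl x y z : inner (x + y) z = inner x z + inner y z.
Proof. exact: (linearDl (@inner R E)). Qed.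

Lemma innerZl a x z : inner (a *: x) z = a * inner x z.
Proof. exact: (linearZl_LR (@inner R E)). Qed.

Lemma innerDr x y z : inner z (x + y) = inner z x + inner z y.
Proof. by rewrite innerC innerDl !(innerC z). Qed.

Lemma innerZr a x z : inner z (a *: x) = a * inner z x.
Proof. by rewrite innerC innerZl innerC. Qed.

Lemma innerNl x z : inner (- x) z = - inner x z.
Proof. by rewrite -scaleN1r innerZl mulN1r. Qed.

Lemma innerNr x z : inner z (- x) = - inner z x.
Proof. by rewrite innerC innerNl innerC. Qed.

Lemma innerBl x y z : inner (x - y) z = inner x z - inner y z.
Proof. by rewrite innerDl innerNl. Qed.

Lemma innerBr x y z : inner z (x - y) = inner z x - inner z y.
Proof. by rewrite innerDr innerNr. Qed.

Lemma inner0l x : inner 0 x = 0.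
Proof. by rewrite -(scale0r x) innerZl mul0r. Qed.

Lemma inner0r x : inner x 0 = 0.
Proof. by rewrite innerC inner0l. Qed.

Lemma inner_suml I (r : seq I) (P : pred I) (F : I -> E) y :
  inner (\sum_(i <- r | P i) F i) y = \sum_(i <- r | P i) inner (F i) y.
Proof.
by apply: (big_morph (fun x => inner x y)); [move=> *; rewrite innerDl|rewrite inner0l].
Qed.

Lemma normDsq x y : `|x + y| ^+ 2 = `|x| ^+ 2 + 2 * inner x y + `|y| ^+ 2.
Proof.
by rewrite -!inner_norm innerDl !innerDr (innerC y x); ring.
Qed.

Lemma normBsq x y : `|x - y| ^+ 2 = `|x| ^+ 2 - 2 * inner x y + `|y| ^+ 2.
Proof. by rewrite normDsq normrN innerNr; ring. Qed.

Lemma inner_le x y : `|inner x y| <= `|x| * `|y|.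
Proof.
have [->|y0] := eqVneq y 0; first by rewrite inner0r !normr0 mulr0.
have ny0 : 0 < `|y| by rewrite normr_gt0.
rewrite -(@ler_pXn2r _ 2) ?nnegrE ?mulr_ge0// exprMn real_normK ?num_real//.
have := exprn_ge0 2 (normr_ge0 (`|y| ^+ 2 *: x - inner x y *: y)).
rewrite normBsq !normrZ !exprMn innerZl innerZr !real_normK ?num_real//.
set i := inner x y; set a := `|x|; set b := `|y| => H.
have : 0 <= b ^+ 2 * (a ^+ 2 * b ^+ 2 - i ^+ 2).
  by rewrite (_ : _ * _ = (b ^+ 2) ^+ 2 * a ^+ 2 - 2 * (b ^+ 2 * (i * i)) + i ^+ 2 * b ^+ 2)//; ring.
by rewrite pmulr_rge0 ?exprn_gt0// subr_ge0.
Qed.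

Lemma inner_le' x y : inner x y <= `|x| * `|y|.
Proof. exact: le_trans (ler_norm _) (inner_le x y). Qed.

Lemma innerb1_subproof y : bounded_linear (fun x => inner y x : R^o).
Proof.
split=> [a u v|]; first by rewrite innerDr innerZr.
by exists `|y| => x; apply: inner_le.
Qed.
Definition innerb y : blin E R^o := mkblin (innerb1_subproof y).

Lemma norm_inner_le x c : 0 <= c -> inner x x <= c * `|x| -> `|x| <= c.
Proof.
move=> c0; rewrite inner_norm => H.
have [->|x0] := eqVneq x 0; first by rewrite normr0.
by rewrite -(@ler_pM2r _ `|x|) ?normr_gt0.
Qed.

Lemma inner0_eq x : inner x x = 0 -> x = 0.
Proof.
move=> x0; apply/normr0_eq0/eqP; rewrite -sqrf_eq0 -inner_norm x0 //.
Qed.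

(* By the scalar mean value theorem applied to
   [s |-> <f (x + s (y - x)), f y - f x>]. *)
Lemma mean_value (V : normedModType R) (U : set V) (f : V -> E) (c : R) (x y : V) :
  0 <= c ->
  (forall s : R, 0 <= s <= 1 -> U (x + s *: (y - x))) ->
  (forall z : V, U z -> differentiable f z) ->
  (forall z : V, U z -> `|fdiff f z (y - x)| <= c) ->
  `|f y - f x| <= c.
Proof.
move=> c0 Uxy df fc; set w := f y - f x.
pose p (s : R^o) := x + s *: (y - x).
pose g (s : R^o) : R^o := inner w (f (p s)).
have gd (s : R^o) : 0 <= s <= 1 ->
    isd g s (compb (innerb w) (compb (fdiff f (p s)) (scaleb (y - x)))).
  move=> s01; apply: (@isd_blinl _ R^o E R^o (innerb w) (fun r : R^o => f (p r))).
  apply: (@isd_comp _ R^o V E f p).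
    have -> : scaleb (y - x) = 0 + scaleb (y - x) by rewrite add0r.
    by apply: (isdD (isd_cst x s)); apply: (isd_blin (scaleb (y - x))).
  exact/diff_isd/df/Uxy.
have gd' (s : R) : 0 <= s <= 1 -> is_derive s (1 : R) (g : R -> R) (inner w (fdiff f (p s) (y - x))).
  move=> /gd H; split; first by apply/derivable1_diffP; case: H.
  rewrite deriveE; last by case: H.
  by rewrite (isd_diff H) /= scale1r.
have cg : {within `[0, 1], continuous (g : R -> R)}.
  apply: derivable_within_continuous => s; rewrite in_itv/= => s01.
  by case: (gd' s s01).
have gd2 (s : R) : s \in `]0, 1[ -> is_derive s (1 : R) (g : R -> R) (inner w (fdiff f (p s) (y - x))).
  by rewrite in_itv/= => /andP[s0 s1]; apply: gd'; rewrite !ltW.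
have [s] := MVT ltr01 gd2 cg.
rewrite in_itv/= => /andP[s0 s1]; rewrite subr0 mulr1 => gE.
have : inner w w <= c * `|w|.
  rewrite {2}/w innerBr.
  have -> : inner w (f y) = g 1 by rewrite /g /p scale1r addrC subrK.
  have -> : inner w (f x) = g 0 by rewrite /g /p scale0r addr0.
  rewrite gE; apply: le_trans (inner_le' _ _) _; rewrite mulrC ler_wpM2r//.
  by apply/fc/Uxy; rewrite !ltW.
exact: norm_inner_le.
Qed.

End InnerProduct.

Section Projections.
Context {R : realType} {E : hilbertType R}.

Definition orthonormal n (e : 'I_n -> E) :=
  forall i j, inner (e i) (e j) = (i == j)%:R.

Lemma inner_sume n (e : 'I_n -> E) (c : 'I_n -> R) j : orthonormal e ->
  inner (\sum_i c i *: e i) (e j) = c j.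
Proof.
move=> oe; rewrite inner_suml (bigD1 j)//= big1 ?addr0 => [|i ij].
  by rewrite innerZl oe eqxx mulr1.
by rewrite innerZl oe (negbTE ij) mulr0.
Qed.

(** Gram-Schmidt by induction: [v] is the component of the last vector orthogonal to the span of the
    others, nonzero by independence. *)
Lemma orthonormal_basis n (V : set E) : lin_subspace n V ->
  exists2 e : 'I_n -> E, orthonormal e &
    V = [set \sum_i c i *: e i | c in [set: 'I_n -> R]].
Proof.
move=> [e li ->] {V}; elim: n e li => [|n IH] e li.
  by exists e => // -[].
pose e' (i : 'I_n) := e (lift ord_max i).
have spl (f : 'I_n.+1 -> E) (c : 'I_n.+1 -> R) : \sum_(i < n.+1) c i *: f i =
   \sum_(i < n) c (lift ord_max i) *: f (lift ord_max i) + c ord_max *: f ord_max.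
  rewrite big_ord_recr/=; congr (_ + _); apply: eq_bigr => j _.
  by congr (c _ *: f _); apply: val_inj; rewrite /= /bump leqNgt ltn_ord.
pose ext T (c : 'I_n -> T) a (i : 'I_n.+1) := if unlift ord_max i is Some j then c j else a.
have extl T (c : 'I_n -> T) a i : ext T c a (lift ord_max i) = c i.
  by rewrite /ext liftK.
have extm T (c : 'I_n -> T) a : ext T c a ord_max = a by rewrite /ext unlift_none.
have sple (f : 'I_n.+1 -> E) (c : 'I_n -> R) a : \sum_(i < n.+1) ext R c a i *: f i =
   \sum_(i < n) c i *: f (lift ord_max i) + a *: f ord_max.
  by rewrite spl extm; congr (_ + _); apply: eq_bigr => j _; rewrite extl.
have li' : lin_indep e'.
  move=> c c0 i; rewrite -(extl R c 0); apply: li.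
  by rewrite sple scale0r addr0 c0.
have [f of_ fE] := IH e' li'.
have memf (c : 'I_n -> R) : exists d : 'I_n -> R, \sum_i c i *: f i = \sum_i d i *: e' i.
  have : [set \sum_i c i *: f i | c in [set: 'I_n -> R]] (\sum_i c i *: f i) by exists c.
  by rewrite -fE => -[d _ <-]; exists d.
have meme (c : 'I_n -> R) : exists d : 'I_n -> R, \sum_i c i *: e' i = \sum_i d i *: f i.
  have : [set \sum_i c i *: e' i | c in [set: 'I_n -> R]] (\sum_i c i *: e' i) by exists c.
  by rewrite fE => -[d _ <-]; exists d.
pose a i := inner (e ord_max) (f i).
pose v := e ord_max - \sum_i a i *: f i.
have vf i : inner v (f i) = 0.
  by rewrite /v innerBl inner_sume// subrr.
have v0 : v != 0.
  apply/eqP => v0; have [d dE] := memf a.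
  have := li (ext R (fun i => - d i) 1); rewrite sple scale1r.
  have -> : \sum_(i < n) - d i *: e (lift ord_max i) = - \sum_i a i *: f i.
    by rewrite dE -sumrN; apply: eq_bigr => i _; rewrite scaleNr.
  rewrite (addrC _ (e ord_max)) -[_ - _]/v v0 => /(_ erefl ord_max); rewrite extm => /eqP.
  by rewrite oner_eq0.
have nv : `|v| != 0 by rewrite normr_eq0.
pose fm := `|v|^-1 *: v.
have fmE : v = `|v| *: fm by rewrite /fm scalerA mulfV// scale1r.
have fmf i : inner fm (f i) = 0 by rewrite /fm innerZl vf mulr0.
have fmm : inner fm fm = 1.
  by rewrite inner_norm /fm normrZ normfV normr_id mulVf// expr1n.
exists (ext E f fm).
  move=> i j; have [i' ->|->] := unliftP ord_max i; have [j' ->|->] := unliftP ord_max j.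
  - by rewrite !extl of_ (inj_eq lift_inj).
  - by rewrite extl extm innerC fmf eq_sym (negbTE (neq_lift _ _)).
  - by rewrite extl extm fmf (negbTE (neq_lift _ _)).
  - by rewrite !extm fmm eqxx.
apply/seteqP; split=> [_ [c _ <-]|_ [c _ <-]].
  have [d dE] := meme (fun i => c (lift ord_max i)).
  exists (ext R (fun i => d i + c ord_max * a i) (c ord_max * `|v|)) => //.
  rewrite sple spl -/e' extm -/(e' _).
  have -> : \sum_(i < n) c (lift ord_max i) *: e (lift ord_max i) = \sum_i d i *: f i by [].
  have -> : e ord_max = \sum_i a i *: f i + `|v| *: fm by rewrite -fmE /v addrC subrK.
  rewrite scalerDr addrA; congr (_ + _); last by rewrite -scalerA.
  rewrite scaler_sumr -big_split /=; apply: eq_bigr => i _.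
  by rewrite extl scalerDl scalerA.
have [d dE] := memf (fun i => c (lift ord_max i) - c ord_max * `|v|^-1 * a i).
exists (ext R d (c ord_max * `|v|^-1)) => //.
rewrite sple spl extm.
pose S := \sum_i a i *: f i.
have -> : \sum_(i < n) d i *: e (lift ord_max i) =
    \sum_i c (lift ord_max i) *: f i - (c ord_max * `|v|^-1) *: S.
  rewrite -[LHS]/(\sum_i d i *: e' i) -dE /S scaler_sumr -sumrB.
  by apply: eq_bigr => i _; rewrite scalerBl scalerA.
have -> : \sum_(i < n) c (lift ord_max i) *: ext E f fm (lift ord_max i) =
    \sum_i c (lift ord_max i) *: f i by apply: eq_bigr => i _; rewrite extl.
have -> : e ord_max = v + S by rewrite /v subrK.
have -> : c ord_max *: fm = (c ord_max * `|v|^-1) *: v by rewrite -scalerA.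
by move: (c ord_max / _) => b; modeq R E.
Qed.

Definition rank_proj n (P : blin E E) :=
  exists2 e : 'I_n -> E, orthonormal e & forall x, P x = \sum_i inner (e i) x *: e i.

(** Orthogonal projectors described without range or rank, a form that can also be verified for the
    differential of the nearest point map. *)
Definition sym_idem (P : blin E E) :=
  (forall x y, inner (P x) y = inner x (P y)) /\ (forall x, P (P x) = P x).

Section SymIdem.
Variables (P : blin E E) (PP : sym_idem P).

Lemma sym_idem_orth x y : inner (P x) (y - P y) = 0.
Proof. by case: PP => Ps Pi; rewrite Ps blinB Pi subrr inner0r. Qed.

Lemma sym_idem_pyth x : `|x| ^+ 2 = `|P x| ^+ 2 + `|x - P x| ^+ 2.
Proof.
have {1}-> : x = P x + (x - P x) by rewrite addrC subrK.
by rewrite normDsq sym_idem_orth mulr0 addr0.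
Qed.

Lemma sym_idem_le x : `|P x| <= `|x|.
Proof.
rewrite -(@ler_pXn2r _ 2) ?nnegrE// (sym_idem_pyth x) lerDl exprn_ge0//.
Qed.

Lemma sym_idem_leC x : `|x - P x| <= `|x|.
Proof.
rewrite -(@ler_pXn2r _ 2) ?nnegrE// (sym_idem_pyth x) lerDr exprn_ge0//.
Qed.

Lemma sym_idem_norm : `|P| <= 1.
Proof. by apply: norm_blin_le => // x; rewrite mul1r sym_idem_le. Qed.

Lemma sym_idem_normC : `|idb E - P| <= 1.
Proof. by apply: norm_blin_le => // x; rewrite mul1r blinBE sym_idem_leC. Qed.

End SymIdem.

Lemma rank_proj_sym_idem n P : rank_proj n P -> sym_idem P.
Proof.
move=> [e oe PE]; split=> [x y|x].
  rewrite !PE inner_suml [RHS]innerC inner_suml.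
  by apply: eq_bigr => i _; rewrite !innerZl mulrC.
rewrite [in LHS]PE [in RHS]PE; apply: eq_bigr => i _; congr (_ *: _).
by rewrite innerC PE inner_sume.
Qed.

Lemma ex_rank_proj n (V : set E) : lin_subspace n V ->
  exists P, rank_proj n P /\ V = [set x | P x = x].
Proof.
move=> /orthonormal_basis[e oe ->].
pose p x := \sum_i inner (e i) x *: e i.
have bp : bounded_linear p.
  split.
    move=> a u v; rewrite /p scaler_sumr -big_split /=; apply: eq_bigr => i _.
    by rewrite innerDr innerZr scalerDl scalerA.
  exists (\sum_i `|e i| * `|e i|) => x; apply: le_trans (ler_norm_sum _ _ _) _.
  rewrite mulr_suml; apply: ler_sum => i _; rewrite normrZ mulrAC ler_wpM2r//.
  exact: inner_le.
exists (mkblin bp); split; first by exists e.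
have idp x : p (p x) = p x.
  apply: eq_bigr => i _; congr (_ *: _).
  by rewrite innerC inner_sume.
apply/seteqP; split=> [_ [c _ <-]|x /= <-]; last by exists (fun i => inner (e i) x).
by rewrite /= /p; apply: eq_bigr => i _; rewrite innerC inner_sume.
Qed.

Lemma sym_idem_orth_projector (V : set E) (P : blin E E) :
  sym_idem P -> V = [set x | P x = x] -> orth_projector V = P.
Proof.
move=> PP VE; have [Ps Pi] := PP.
have H : is_orth_projector V P.
  rewrite VE => x; split; first exact: Pi.
  by move=> v /= <-; rewrite innerC sym_idem_orth.
apply: xget_subset1 => // Q Q' HQ HQ'.
apply: blinP => x; have [Qx Qo] := HQ x; have [Q'x Q'o] := HQ' x.
apply/subr0_eq/inner0_eq.
have Vd : V (Q x - Q' x) by move: Qx Q'x; rewrite VE /= blinB => -> ->.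
have -> : inner (Q x - Q' x) (Q x - Q' x) =
    inner (x - Q' x) (Q x - Q' x) - inner (x - Q x) (Q x - Q' x).
  by rewrite -innerBl (_ : (x - Q' x) - (x - Q x) = Q x - Q' x)//; modeq R E.
by rewrite Qo// Q'o// subrr.
Qed.

(** [ad L] is the adjoint of [compb L P]. The finite rank of [P] makes it an explicit sum, and its
    being a bounded operator in [L] lets it be applied to the differential of a function under the
    estimates [cb]. *)
Lemma ex_adjoint n P : rank_proj n P -> exists ad : blin (blin E E) (blin E E),
  `|ad| <= 1 /\ forall L b v, inner (ad L b) v = inner b (L (P v)).
Proof.
move=> [e oe PE].
pose a (L : blin E E) b := \sum_i inner (L (e i)) b *: e i.
have aE L b v : inner (a L b) v = inner b (L (P v)).
  rewrite PE /a inner_suml.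
  have -> : L (\sum_i inner (e i) v *: e i) = \sum_i inner (e i) v *: L (e i).
    by rewrite blin_sum; apply: eq_bigr => i _; rewrite blinZ.
  rewrite innerC inner_suml; apply: eq_bigr => i _.
  by rewrite !innerZl mulrC.
have PP : sym_idem P by apply: (@rank_proj_sym_idem n); exists e.
have aP L b : P (a L b) = a L b.
  apply/subr0_eq/inner0_eq; case: PP => Ps Pi.
  by rewrite innerBr innerBl !Ps innerBl !Ps !Pi !aE !Pi; ring.
have aN L b : `|a L b| <= `|L| * `|b|.
  apply: norm_inner_le; first by rewrite mulr_ge0.
  rewrite aE aP; apply: le_trans (inner_le' _ _) _.
  rewrite [leRHS](_ : _ = `|b| * (`|L| * `|a L b|)); last by ring.
  by rewrite ler_wpM2l// blin_norm_le.
have bl L : bounded_linear (a L).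
  split; last by exists `|L| => b; apply: aN.
  move=> c u v; rewrite /a scaler_sumr -big_split /=; apply: eq_bigr => i _.
  by rewrite innerDr innerZr scalerDl scalerA.
have bl2 : bounded_linear (fun L => mkblin (bl L)).
  split; last by exists 1 => L; rewrite mul1r; apply: norm_blin_le => // b; apply: aN.
  move=> c u v; apply: blinP => x; rewrite blinDE blinZE !mkblinE.
  rewrite /a scaler_sumr -big_split /=; apply: eq_bigr => i _.
  change (inner (c *: u (e i) + v (e i)) x *: e i =
    c *: (inner (u (e i)) x *: e i) + inner (v (e i)) x *: e i).
  by rewrite innerDl innerZl scalerDl scalerA.
exists (mkblin bl2); split=> //.
apply: norm_blin_le => // L; rewrite mul1r.
by apply: norm_blin_le => // b; apply: aN.
Qed.

End Projections.

(** * Partitions of unity of bounded multiplicity *)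

Section Packing.
Context {R : realType}.

(** Pigeonhole principle on a grid: in the coordinates of the range of [P], two points of one cell
    of side [1 / m] have projections at distance at most [sqrt n / m], which is less than [rho]. The
    bound is uniform in the space [E]. *)
Lemma packing (n : nat) (rho : R) : 0 < rho -> exists N : nat,
  forall (E : hilbertType R) (P : blin E E) (q : E) (s : seq E),
    rank_proj n P -> uniq s ->
    (forall x, x \in s -> `|P (x - q)| <= 1) ->
    (forall x y, x \in s -> y \in s -> x != y -> rho <= `|P (x - y)|) ->
    (size s <= N)%N.
Proof.
move=> rho0.
pose m := (Num.trunc (n%:R / rho ^+ 2)).+1.
have m0 : (0 : R) < m%:R by rewrite ltr0n.
have mP : n%:R / m%:R ^+ 2 < rho ^+ 2.
  have /andP[_] : (m.-1)%:R <= n%:R / rho ^+ 2 < m%:R.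
    by apply: truncn_itv; rewrite divr_ge0// exprn_ge0// ltW.
  rewrite ltr_pdivrMr ?exprn_gt0// => H; rewrite ltr_pdivrMr ?exprn_gt0//.
  rewrite mulrC; apply: lt_le_trans H _; rewrite ler_wpM2r ?exprn_ge0 ?(ltW rho0)//.
  by rewrite expr2 ler_peMr ?ler0n// ler1n.
exists #|{ffun 'I_n -> 'I_(2 * m).+1}| => E P q s rP us s1 sep.
have PP := rank_proj_sym_idem rP; case: rP => e oe PE.
have coefsq z : `|P z| ^+ 2 = \sum_i inner (e i) z ^+ 2.
  case: (PP) => Ps Pi; rewrite -inner_norm -Ps Pi innerC.
  by rewrite PE innerC inner_suml; apply: eq_bigr => i _; rewrite innerZl expr2.
(* Coordinates in [[-1, 1]] are moved to [[0, 2 m]], so their integer parts take at most [2 m + 1]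
   values. *)
pose u (x : E) i := (inner (e i) (x - q) + 1) * m%:R : R.
have ub x i : x \in s -> 0 <= u x i <= (2 * m)%:R.
  move=> xs.
  have : `|inner (e i) (x - q)| <= 1.
    apply: le_trans (s1 _ xs).
    rewrite -(@ler_pXn2r _ 2) ?nnegrE// coefsq real_normK ?num_real//.
    by rewrite (bigD1 i)//= lerDl sumr_ge0// => j _; rewrite sqr_ge0.
  rewrite ler_norml => /andP[a b]; rewrite /u natrM.
  apply/andP; split; first by rewrite mulr_ge0 ?(ltW m0)//; lra.
  by rewrite ler_wpM2r ?(ltW m0)//; lra.
pose cell x : {ffun 'I_n -> 'I_(2 * m).+1} := [ffun i => inord (Num.trunc (u x i))].
have cellE x y i : x \in s -> y \in s -> cell x = cell y ->
    Num.trunc (u x i) = Num.trunc (u y i).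
  move=> xs ys /(congr1 (fun f : {ffun 'I_n -> 'I_(2 * m).+1} => nat_of_ord (f i))); rewrite !ffunE /= !inordK//.
    have /andP[a b] := ub _ i ys; rewrite ltnS -(ler_nat R).
    by apply: le_trans b; rewrite truncn_le.
  have /andP[a b] := ub _ i xs; rewrite ltnS -(ler_nat R).
  by apply: le_trans b; rewrite truncn_le.
have inj : {in s &, injective cell}.
  move=> x y xs ys cxy; apply/eqP/negPn/negP => xy.
  have := sep _ _ xs ys xy; rewrite leNgt => /negP; apply.
  rewrite -(@ltr_pXn2r _ 2) ?nnegrE ?(ltW rho0)//; apply: le_lt_trans mP.
  rewrite coefsq; apply: (@le_trans _ _ (\sum_(i < n) m%:R ^- 2)); last first.
    by rewrite sumr_const card_ord -[leLHS]mulr_natl.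
  apply: ler_sum => i _.
  have E1 : inner (e i) (x - y) * m%:R = u x i - u y i.
    by rewrite /u -mulrBl; congr (_ * _); rewrite !innerBr; ring.
  have := cellE _ _ i xs ys cxy.
  have /andP[ux0 _] := ub _ i xs; have /andP[uy0 _] := ub _ i ys.
  have /andP[a1 a2] := truncn_itv ux0; have /andP[b1 b2] := truncn_itv uy0.
  move=> tE; rewrite tE in a1 a2.
  rewrite -[leRHS]mul1r ler_pdivlMr ?exprn_gt0// -exprMn E1.
  have : `|u x i - u y i| <= 1.
    by rewrite ler_norml; move: a2 b2; rewrite -!natr1; lra.
  by move=> u1; rewrite -real_normK ?num_real//; apply: exprn_ile1.
have -> : size s = size (map cell s) by rewrite size_map.
have /card_uniqP <- : uniq (map cell s) by rewrite map_inj_in_uniq.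
exact: max_card.
Qed.

Lemma bounded_card_finite (T : choiceType) (A : set T) (N : nat) :
  (forall s : seq T, uniq s -> (forall x, x \in s -> A x) -> (size s <= N)%N) ->
  exists2 s : seq T, uniq s /\ (size s <= N)%N & forall x, A x <-> x \in s.
Proof.
move=> H.
pose p k := `[< exists s : seq T, [/\ uniq s, (forall x, x \in s -> A x) & size s = k] >].
have p0 : exists k, p k by exists 0%N; apply/asboolP; exists [::].
have pN k : p k -> (k <= N)%N by move=> /asboolP[s [us sA <-]]; apply: H.
case: (ex_maxnP p0 pN) => k /asboolP[s [us sA sk]] kmax.
exists s; first by split=> //; apply: H.
move=> x; split=> [Ax|]; last exact: sA.
apply/negPn/negP => xs; have /kmax : p k.+1.
  apply/asboolP; exists (x :: s); split; [by rewrite /= xs|move=> y|by rewrite /= sk].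
  by rewrite in_cons => /orP[/eqP->//|/sA].
by rewrite ltnn.
Qed.

End Packing.

Section Bump.
Context {R : realType}.

(* The derivatives of [exp (-1/t)] are linear combinations of these. *)
Definition bump (m : nat) (t : R) : R :=
  if 0 < t then t^-1 ^+ m * expR (- t^-1) else 0.

Lemma bump_ge0 m t : 0 <= bump m t.
Proof.
rewrite /bump; case: ifPn => // t0.
by rewrite mulr_ge0 ?expR_ge0// exprn_ge0// invr_ge0 ltW.
Qed.

(** With [u = t^-1] and [m > 0], [expR u] is the [m]-th power of [expR (u / m)], which is at least
    [u / m]. *)
Lemma bump_le m t : bump m t <= m%:R ^+ m.
Proof.
rewrite /bump; case: ifPn => t0; last by rewrite exprn_ge0.
have u0 : 0 < t^-1 by rewrite invr_gt0.
rewrite expRN ler_pdivrMr ?expR_gt0//.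
case: m => [|m]; first by rewrite !expr0 mul1r -expR0 ler_expR ltW.
have m0 : (0 : R) < m.+1%:R by rewrite ltr0n.
have {2}-> : t^-1 = m.+1%:R * (t^-1 / m.+1%:R) by rewrite mulrCA mulfV ?mulr1// gt_eqF.
rewrite expRM_natl -exprMn.
apply: lerXn2r; rewrite ?nnegrE; [exact: ltW|exact: mulr_ge0 (ltW m0) (expR_ge0 _)|].
rewrite mulrC -ler_pdivrMr//; apply: le_trans (expR_ge1Dx _).
by rewrite lerDr.
Qed.

(** A factor [t ^+ 2] with a bounded cofactor gives the zero derivative at the origin. *)
Lemma bump_decr m t : bump m t = t ^+ 2 * bump m.+2 t.
Proof.
rewrite /bump; case: ifPn => t0; last by rewrite mulr0.
have -> : t^-1 ^+ m.+2 = t^-1 ^+ 2 * t^-1 ^+ m by rewrite -exprD.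
have T : (t : R) ^+ 2 * (t : R)^-1 ^+ 2 = 1 by rewrite -exprMn mulfV ?gt_eqF// expr1n.
by rewrite [t ^+ 2 * _]mulrA [t ^+ 2 * _]mulrA T mul1r.
Qed.

Lemma bump0_mono s t : 0 < s -> s <= t -> bump 0 s <= bump 0 t.
Proof.
move=> s0 st; have t0 := lt_le_trans s0 st.
rewrite /bump s0 t0 !expr0 !mul1r ler_expR lerN2.
by rewrite lef_pV2 ?posrE.
Qed.

Lemma bump0_gt0 s : 0 < s -> 0 < bump 0 s.
Proof. by move=> s0; rewrite /bump s0 expr0 mul1r expR_gt0. Qed.

Lemma bump0_le0 t : t <= 0 -> bump 0 t = 0.
Proof. by rewrite /bump leNgt => /negbTE ->. Qed.

Definition dbump m (t : R) : R := bump m.+2 t - m%:R * bump m.+1 t.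

Lemma isd_bump m (t : R) : isd (bump m : R^o -> R^o) (t : R^o) (scaleb (dbump m t : R^o)).
Proof.
have [t0|t0|t0] := ltrgt0P t.
- suff H : is_derive t (1 : R) (fun y : R => y^-1 ^+ m * expR (- y^-1)) (dbump m t).
    apply: (@isd_near _ _ _ (fun y : R^o => y^-1 ^+ m * expR (- y^-1) : R^o) _ _ _ t) => // [y|].
      rewrite /bump; case: ifPn => // y0; rewrite ltr_norml => /andP[y1 _].
      by move: y0; rewrite (_ : 0 < y)//; lra.
    case: H => H1 H2; apply: isd_diffE; first exact/derivable1_diffP.
    by rewrite deriv1E// derive1E H2.
  have tn0 : t != 0 by rewrite gt_eqF.
  have dV : is_derive t (1 : R) (fun y : R => y^-1) (- t ^- 2).
    have := @is_deriveV R id t 1 1 tn0 (is_derive_id _ _).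
    by rewrite /= scaler1; apply.
  have dE : is_derive t (1 : R) (expR \o (fun y => - y^-1)) (expR (- t^-1) * (t ^- 2)).
    apply: is_derive1_comp; rewrite -[X in is_derive _ _ _ X]opprK; exact: is_deriveN.
  have H := is_deriveM (is_deriveX m dV) dE.
  rewrite (_ : (fun y : R => _) = (fun y : R => y^-1) ^+ m * (expR \o (fun y => - y^-1))); last first.
    by apply/funext => y; rewrite !fctE.
  apply: (is_derive_eq H).
  rewrite /dbump /bump t0 /=.
  rewrite !fctE; case: m {H} => [|m]; rewrite ?expr0.
    by rewrite mul0r scale0r scaler0 addr0 mul0r subr0 /GRing.scale /= mul1r mulrC exprVn.
  rewrite /GRing.scale /= -exprVn !exprS; ring.
- apply: (@isd_near _ _ _ (fun=> 0) _ _ _ (- t)); first by rewrite oppr_gt0.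
    move=> y; rewrite ltr_norml => /andP[_ y1]; rewrite /bump ifN// -leNgt.
    by lra.
  rewrite (_ : dbump m t = 0); last by rewrite /dbump /bump ltNge ltW//= mulr0 subr0.
  rewrite (_ : scaleb _ = 0); first exact: isd_cst.
  by apply: blinP => a; rewrite /= scaler0.
- rewrite t0; apply/epsdP => e e0.
  pose K := m.+2%:R ^+ m.+2 : R.
  have K0 : 0 < K by rewrite exprn_gt0// ltr0n.
  exists (e / K); first by rewrite divr_gt0.
  move=> h hd; rewrite add0r /= (_ : dbump m 0 = 0) ?scaler0 ?subr0; last first.
    by rewrite /dbump /bump ltxx mulr0 subr0.
  rewrite {2}/bump ltxx subr0 bump_decr normrM normrX expr2 -mulrA mulrCA mulrC.
  rewrite ler_wpM2r//; apply: (@le_trans _ _ (`|h| * K)).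
    by rewrite ler_wpM2l// ger0_norm ?bump_ge0// bump_le.
  by rewrite -ler_pdivlMr// ltW.
Qed.

Lemma cb_bump k m : exists c, 0 <= c /\ cb k c setT (bump m : R^o -> R^o).
Proof.
have nb j t : `|bump j t| <= j%:R ^+ j by rewrite ger0_norm ?bump_ge0 ?bump_le.
elim: k m => [|k IH] m.
  by exists (m%:R ^+ m); split; [rewrite exprn_ge0|split].
have [c1 [c10 H1]] := IH m.+1; have [c2 [c20 H2]] := IH m.+2.
exists (Num.max (m%:R ^+ m) (c2 + m%:R * c1)); split.
  by rewrite le_max exprn_ge0.
apply: (cbSI (f' := fun t => scalebb R^o (dbump m t))) => //; first exact: openT.
- by move=> x _; rewrite le_max nb.
- by move=> x _; apply: isd_bump.
apply: (@cb_mono _ _ _ _ (1 * (c2 + m%:R * c1))); first by rewrite mul1r le_max lexx orbT.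
apply: cb_blinl; [exact: openT|by rewrite addr_ge0// mulr_ge0|exact: norm_scalebb|].
apply: cbB => //; [exact: openT|by rewrite mulr_ge0|].
have := @cbZ _ k R^o R^o c1 m%:R setT _ openT c10 H1.
by rewrite ger0_norm.
Qed.

Section Weight.
Context {E : hilbertType R}.

Lemma innerbb_subproof : bounded_linear (@innerb R E).
Proof.
split=> [a u v|].
  by apply: blinP => x /=; rewrite innerDl innerZl.
exists 1 => x; rewrite mul1r; apply: norm_blin_le => // y; exact: inner_le.
Qed.
Definition innerbb : blin E (blin E R^o) := mkblin innerbb_subproof.

Lemma norm_innerbb : `|innerbb| <= 1.
Proof.
apply: norm_blin_le => // x; rewrite mul1r; apply: norm_blin_le => // y.
exact: inner_le.
Qed.

(** The square of the distance is written with [inner], so that it is a bilinear expression in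
    [z - q] and smooth also at [q]. The support is the ball of radius [s]. *)
Definition weight (s : R) (q z : E) : R^o := bump 0 (s ^+ 2 - inner (z - q) (z - q)).

Lemma isd_subr (V : normedModType R) (q x : V) : isd (fun z => z - q) x (idb V).
Proof. by rewrite -(subr0 (idb V)); apply: isdB (isd_id x) (isd_cst q x). Qed.

Lemma cb_subr k (U : set E) (q : E) c : open U -> 1 <= c ->
  (forall z, U z -> `|z - q| <= c) -> cb k c U (fun z => z - q).
Proof.
move=> oU c1 Uc; apply: (@cb_affine _ k E E c U _ (idb E)) => //.
  by move=> x _; apply: isd_subr.
exact: le_trans (norm_idb _) c1.
Qed.

End Weight.

Lemma cb_weight k (s : R) : exists c, 0 <= c /\
  forall (E : hilbertType R) (q : E) (U : set E), open U -> (forall z, U z -> `|z - q| <= 2) ->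
    cb k c U (weight s q).
Proof.
have [c [c0 H]] := cb_bump k 0.
exists (compK 4 k * c); split.
  by rewrite mulr_ge0// (le_trans ler01)// compK_ge1.
move=> E q U oU Uq; apply: (cb_comp (D := setT)) => //.
case: k {H} => // k.
apply: (dcbI (f' := fun z => (-2) *: innerbb (z - q))) => // [z Uz|].
  have -> : (-2) *: innerbb (z - q) = 0 - dbil innerbb (z - q) (z - q) (idb E) (idb E).
    apply: blinP => v; rewrite sub0r blinNE /dbil blinDE blinZE !compbbE !compbE.
    by rewrite /= (innerC v) /GRing.scale /=; ring.
  apply: isdB; first exact: isd_cst.
  exact: (@isd_bilin R E E E R^o innerbb (fun z => z - q) (fun z => z - q) z _ _ (isd_subr q z) (isd_subr q z)).
(* The differential of the argument of [bump] is [-2 <z - q, .>], of norm at most 4 since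
   [|z - q| <= 2]. *)
rewrite (_ : 4 = `|-2 : R| * (1 * 2)); last by rewrite normrN ger0_norm// mul1r; ring.
apply: cbZ => //.
apply: cb_blinl => //; first exact: norm_innerbb.
by apply: cb_subr => //; lra.
Qed.

End Bump.

(** * Square roots of operators close to the identity *)

Section SquareRoot.
Context {R : realType}.

(** Every derivative of a composition contains a derivative of the inner function, so it is of order
    [e] although [g] is merely bounded. Only the values need a separate bound [a]. *)
Lemma cb_comp_small k (b c : R) : 0 <= b -> 0 <= c -> exists K : R, 0 <= K /\
  forall (U V W : normedModType R) (A : set U) (D : set V) (g : V -> W)
    (f : U -> V) (a e : R), open A -> 0 <= e <= b -> 0 <= a ->
    (forall x, A x -> D (f x)) -> cb k c D g -> cb k e A f ->
    (forall x, A x -> `|g (f x)| <= a) ->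
    cb k (a + K * e) A (fun x => g (f x)).
Proof.
move=> b0 c0; exists (2 ^+ k.-1 * (compK b k.-1 * c)).
have K1 := compK_ge1 b k.-1; have K0 : 0 <= compK b k.-1 * c.
  by rewrite mulr_ge0// (le_trans ler01).
split; first by rewrite mulr_ge0// exprn_ge0.
move=> U V W A D g f a e oA /andP[e0 eb] a0 AD gc fe ga.
have ae x : A x -> `|g (f x)| <= a + 2 ^+ k.-1 * (compK b k.-1 * c) * e.
  move=> Ax; apply: le_trans (ga _ Ax) _; rewrite lerDl.
  by rewrite mulr_ge0// mulr_ge0// exprn_ge0.
case: k gc fe ae K0 {K1} => [|k] gc fe ae K0; first by split.
apply: (cbSI (f' := fun x => compbb U V W (fdiff g (f x)) (fdiff f x))) => //.
  by move=> x Ax; apply: isd_comp (cb_isd fe Ax) (cb_isd gc (AD _ Ax)).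
apply: (@cb_mono _ _ _ _ (1 * (2 ^+ k * ((compK b k * c) * e)))).
  by rewrite mul1r mulrA lerDr.
apply: cb_bil => //; [exact: norm_compbb| |by case: fe => _ []].
apply: (cb_comp (D := D)) => //; first by case: gc => _ [].
by case: k {gc ae K0} fe => // k /cb_dcb [df fe]; split=> //; apply/cb_pred/(cb_mono eb).
Qed.

Variable (E : completeNormedModType R).
Local Notation A := (blin E E).

(** If [u = sqs y] and [y = x + u], then [y + y ^ 2 / 2 = x]; for [x = e / 2] this is
    [(1 + y) ^ 2 = 1 + e]. *)
Definition sqs (y : A) : A := - (2^-1 *: compbb E E E y y).

Lemma sqs_lip (x y : blin E E) : `|x| < 2^-1 -> `|y| < 2^-1 ->
  `|sqs x - sqs y| <= 2^-1 * `|x - y|.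
Proof.
move=> x2 y2.
have -> : sqs x - sqs y = - (2^-1 *: (compbb E E E x (x - y) + compbb E E E (x - y) y)).
  by rewrite /sqs blinB [compbb E E E (x - y)]blinB blinBE; modeq R (blin E E).
rewrite normrN normrZ ger0_norm// ler_wpM2l//.
apply: le_trans (ler_normD _ _) _.
apply: (@le_trans _ _ (2^-1 * `|x - y| + `|x - y| * 2^-1)); last by lra.
by apply: lerD; apply: le_trans (norm_compb _ _) _; [apply: ler_wpM2r|apply: ler_wpM2l] => //; apply: ltW.
Qed.

Lemma isd_sqs (y : A) : isd sqs y (- (2^-1 *: dbil (compbb E E E) y y (idb A) (idb A))).
Proof.
apply: isdN; apply: isdZ.
exact: (@isd_bilin R A A A A (compbb E E E) id id y _ _ (isd_id y) (isd_id y)).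
Qed.

Lemma norm_dsqs (y : A) : `|y| < 2^-1 -> `|fdiff sqs y| <= 2^-1.
Proof.
move=> y2; have [_ ->] := isd_sqs y.
apply: norm_blin_le => // v; rewrite blinNE blinZE /dbil blinDE !compbbE !compbE.
rewrite normrN normrZ ger0_norm// ler_wpM2l//.
apply: le_trans (ler_normD _ _) _.
apply: (@le_trans _ _ (2^-1 * `|v| + `|v| * 2^-1)); last by lra.
by apply: lerD; apply: le_trans (norm_compb _ _) _; [apply: ler_wpM2r|apply: ler_wpM2l] => //; apply: ltW.
Qed.

Lemma open_normlt (V : normedModType R) (r : R) : open [set x : V | `|x| < r].
Proof.
rewrite (_ : [set x : V | `|x| < r] = ball 0 r); first exact: ball_open.
by rewrite -ball_normE; apply/seteqP; split=> x /=; rewrite sub0r normrN.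
Qed.

Definition sqK k : R := `|2^-1| * (1 * (2 ^+ k * (1 * 1))).

Lemma sqK_ge0 k : 0 <= sqK k.
Proof. by rewrite !mulr_ge0// exprn_ge0. Qed.

Lemma cb_sqs k : cb k (sqK k) [set y : A | `|y| < 2^-1] sqs.
Proof.
have oD : open [set y : A | `|y| < 2^-1] by apply: open_normlt.
apply: cbN => //; first exact: sqK_ge0.
apply: cbZ => //.
have idP : cb k 1 [set y : A | `|y| < 2^-1] id.
  apply: (@cb_affine _ k A A 1 _ id (idb A)) => // [x /= /ltW x2|x _|].
  - by apply: le_trans x2 _; lra.
  - exact: isd_id.
  - exact: norm_idb.
exact: (@cb_bil _ k A A A A (compbb E E E) 1 1 1 _ id id oD ler01 ler01 (@norm_compbb _ _ _ _) idP idP).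
Qed.

Definition sqt (x : A) : A := xget 0 [set u | `|u| <= 8^-1 /\ u = sqs (x + u)].

Lemma half01 : 0 <= (2^-1 : R) < 1.
Proof. by apply/andP; split; [|lra]. Qed.

Lemma sqtP (x : A) : `|x| < 4^-1 -> `|sqt x| <= 8^-1 /\ sqt x = sqs (x + sqt x).
Proof.
move=> x4; have D u : `|u| <= 8^-1 -> [set y : A | `|y| < 2^-1] (x + u).
  by move=> u8; apply: le_lt_trans (ler_normD _ _) _; move: x4 u8; lra.
(* On the ball of radius [1 / 2] the half square is at most [1 / 8], and [1 / 4 + 1 / 8 < 1 / 2]
   keeps the iteration inside. *)
have H y : [set y : A | `|y| < 2^-1] y -> `|sqs y| <= 8^-1.
  move=> /= y2; rewrite normrN normrZ ger0_norm//.
  have y0 := normr_ge0 y; apply: (@le_trans _ _ (2^-1 * (`|y| * `|y|))).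
    by rewrite ler_wpM2l//; apply: norm_compb.
  by nra.
have r8 : (0 : R) <= 8^-1 by [].
have [u u1 u2] := perturb_fixpoint half01 sqs_lip r8 D H.
exact: (@xgetPex _ 0 [set u | `|u| <= 8^-1 /\ u = sqs (x + u)] (ex_intro _ u (conj u1 u2))).
Qed.

Lemma sqt_dom (x : A) : `|x| < 4^-1 -> `|x + sqt x| < 2^-1.
Proof.
move=> x4; have [u8 _] := sqtP x4.
by apply: le_lt_trans (ler_normD _ _) _; move: x4 u8; lra.
Qed.

Definition sqtK k : R := invK 2^-1 (sqK k) k * sqK k.

Lemma sqtK_ge0 k : 0 <= sqtK k.
Proof. by rewrite mulr_ge0 ?sqK_ge0// (le_trans ler01)// invK_ge1. Qed.

Lemma cb_sqt k : cb k (sqtK k) [set y : A | `|y| < 4^-1] sqt.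
Proof.
have tE x : [set y : A | `|y| < 4^-1] x -> sqt x = sqs (x + sqt x) by move=> /sqtP[].
have sd x : [set y : A | `|y| < 2^-1] x -> differentiable sqs x.
  by move=> _; case: (isd_sqs x).
have cc : 0 <= sqK k <= sqK k by rewrite sqK_ge0 lexx.
exact: (@cb_perturb R (blin E E) sqs sqt _ _ 2^-1 half01 (@open_normlt _ _)
  sqs_lip sqt_dom tE sd norm_dsqs k _ _ cc (cb_sqs k)).
Qed.

(* [1 + sqy e] is the square root of [1 + e]. *)
Definition sqy (e : A) : A := 2^-1 *: e + sqt (2^-1 *: e).

Lemma sqyP (e : A) : `|e| < 2^-1 ->
  sqy e + sqy e + compb (sqy e) (sqy e) = e /\ `|sqy e| <= `|e|.
Proof.
move=> e2; have h4 : `|2^-1 *: e| < 4^-1 by rewrite normrZ ger0_norm//; lra.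
have [u8 uE] := sqtP h4; have y2 := sqt_dom h4.
have yE : sqy e = 2^-1 *: e - 2^-1 *: compb (sqy e) (sqy e).
  by rewrite {1}/sqy uE.
have eE : sqy e + sqy e + compb (sqy e) (sqy e) = e.
  move: (compb (sqy e) (sqy e)) yE => z ->; modeq R (blin E E).
split=> //.
have : `|sqy e + sqy e| <= `|e| + `|sqy e| * `|sqy e|.
  rewrite -[sqy e + sqy e](addrK (compb (sqy e) (sqy e))) eE.
  apply: le_trans (ler_normB _ _) _; rewrite lerD2l; exact: norm_compb.
rewrite -mulr2n normrMn -mulr_natl => H.
have y0 := normr_ge0 (sqy e).
have : `|sqy e| < 2^-1 by exact: y2.
by nra.
Qed.

(** The commutator [c] of [y = sqy e] with [S] satisfies [2 c = - (y c + c y)]. As [|y| < 1 / 2],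
    this yields [2 |c| <= |c|]. *)
Lemma sqy_comm (e S : A) : `|e| < 2^-1 -> compb e S = compb S e ->
  compb (sqy e) S = compb S (sqy e).
Proof.
move=> e2 eS; have [yE ye] := sqyP e2.
have y1 : `|sqy e| < 2^-1 by apply: le_lt_trans ye e2.
move: (sqy e) yE ye y1 => y yE ye y1.
pose c := compb y S - compb S y.
have cE : c + c = - (compb y c + compb c y).
  apply: blinP => v; have : (compb e S - compb S e) v = 0 by rewrite eS subrr.
  rewrite blinBE !compbE -yE !blinDE !compbE !blinD => H.
  have cv w : c w = y (S w) - S (y w) by [].
  transitivity (c v + c v) => //; transitivity (- (y (c v) + c (y v))) => //.
  rewrite !cv !blinB; apply/subr0_eq; rewrite -[RHS]H; by modeq R E.
have : 2 * `|c| <= `|c|.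
  rewrite mulr_natl -normrMn mulr2n cE normrN.
  apply: le_trans (ler_normD _ _) _.
  apply: (@le_trans _ _ (2^-1 * `|c| + `|c| * 2^-1)); last by lra.
  by apply: lerD; apply: le_trans (norm_compb _ _) _; [apply: ler_wpM2r|apply: ler_wpM2l] => //; apply: ltW.
move=> H; apply/subr0_eq/normr0_eq0/eqP; rewrite -/c eq_le normr_ge0 andbT; lra.
Qed.

End SquareRoot.

(** * Averaging the flats *)

Section Flats.
Context {R : realType} {E : hilbertType R}.

(* [X] is [d]-close to the [n]-flats [x + range (P x)] at scale [1]. *)
Definition flats n (d : R) (X : set E) (P : E -> blin E E) :=
  [/\ forall x, X x -> rank_proj n (P x),
      forall x z, X x -> X z -> `|z - x| < 1 -> `|(z - x) - P x (z - x)| <= d &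
      forall x v, X x -> P x v = v -> `|v| < 1 ->
        exists z, [/\ X z, `|z - x| < 1 & `|z - (x + v)| <= d]].

Definition maximal_separated (s : R) (X X0 : set E) :=
  [/\ X0 `<=` X, forall x y, X0 x -> X0 y -> x <> y -> s <= `|x - y| &
      forall x, X x -> exists2 q, X0 q & `|x - q| < s].

Lemma ex_maximal_separated s (X : set E) : 0 < s ->
  exists X0, maximal_separated s X X0.
Proof.
move=> s0.
pose Q (A : set E) := A `<=` X /\ forall x y, A x -> A y -> x <> y -> s <= `|x - y|.
have ZQ (F : set (set E)) : F `<=` Q -> total_on F subset -> Q (\bigcup_(B in F) B).
  move=> FQ Ft; split.
    by move=> x [B FB Bx]; have [BX _] := FQ _ FB; apply: BX.
  move=> x y [B FB Bx] [C FC Cy] xy.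
  have [_ Bs] := FQ _ FB; have [_ Cs] := FQ _ FC.
  by have [BC|CB] := Ft _ _ FB FC; [apply: Cs => //; apply: BC|apply: Bs => //; apply: CB].
have [A [[AX Asep] Amax]] := Zorn_bigcup ZQ.
exists A; split=> // x Xx.
have [//|far] := pselect (exists2 q, A q & `|x - q| < s).
have farx q : A q -> s <= `|x - q|.
  by move=> Aq; rewrite leNgt; apply/negP => H; apply: far; exists q.
have Ax : ~ A x by move=> /farx; rewrite subrr normr0 leNgt s0.
exfalso; apply: (Amax (A `|` [set x])); last first.
  split.
    by move=> y [/AX//|->].
  move=> y z [Ay|->] [Az|->] yz //.
  - exact: Asep.
  - by rewrite distrC; apply: farx.
  - exact: farx.
split; first by left.
by move=> /(_ x (or_intror erefl)).
Qed.

Variables (n : nat) (d : R) (X : set E) (P : E -> blin E E).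
Hypothesis XP : flats n d X P.

Lemma flats_sym_idem x : X x -> sym_idem (P x).
Proof. by case: XP => H _ _ /H /rank_proj_sym_idem. Qed.

Lemma flats_ge0 x : X x -> 0 <= d.
Proof.
move=> Xx; case: XP => _ H _; have := H x x Xx Xx; rewrite subrr normr0 => /(_ ltr01).
exact: le_trans.
Qed.

(** A point [z] of [X] near [x + v] mediates between the two flats: [x + v] is within [d] of [z],
    and [z] within [d] of the flat at [y]. *)
Lemma flats_dist2 x y v : X x -> X y -> P x v = v -> `|v| < 1 ->
  `|x + v - y| < 1 - d -> `|(x + v - y) - P y (x + v - y)| <= 2 * d.
Proof.
move=> Xx Xy Pv v1 xvy; case: (XP) => _ H1 H2.
have [z [Xz _ zd]] := H2 x v Xx Pv v1.
have zy1 : `|z - y| < 1.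
  rewrite -(subrKA (x + v)) addrC; apply: le_lt_trans (ler_normD _ _) _; lra.
have h1 := H1 y z Xy Xz zy1.
have -> : (x + v - y) - P y (x + v - y) =
   ((z - y) - P y (z - y)) - ((z - (x + v)) - P y (z - (x + v))).
  by rewrite !(blinB (P y)) !(blinD (P y)); modeq R E.
apply: le_trans (ler_normB _ _) _.
have := sym_idem_leC (flats_sym_idem Xy) (z - (x + v)); lra.
Qed.

Hypothesis d100 : d <= 100^-1.

Lemma flats_tilt x y v : X x -> X y -> `|x - y| < 9 / 10 -> P x v = v -> `|v| <= 1 ->
  `|v - P y v| <= 5 * d.
Proof.
move=> Xx Xy xy Pv v1; have d0 := flats_ge0 Xx.
have xP := flats_sym_idem Xx; have [_ Pi] := xP.
(* The test points [x + w + s v] are centred about halfway between [x] and [y]. Even for [|x - y|]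
   close to [9 / 10] and [|s| = 4 / 10] they lie in both unit balls; the difference of the two
   extreme ones isolates [8 / 10] of [v]. *)
pose w := 2^-1 *: P x (y - x).
have Pw : P x w = w by rewrite /w blinZ Pi.
have yx : `|y - x| < 9 / 10 by rewrite distrC.
have w45 : `|w| <= 45 / 100.
  rewrite normrZ ger0_norm//; have := sym_idem_le xP (y - x); lra.
have xwy : `|x + w - y| <= 45 / 100 + d.
  have -> : x + w - y = - ((y - x) - P x (y - x)) - w.
    by rewrite /w; modeq R E.
  apply: le_trans (ler_normB _ _) _; rewrite normrN.
  case: (XP) => _ H1 _; have := H1 x y Xx Xy; lra.
clearbody w.
have key (s : R) : `|s| <= 4 / 10 -> `|(x + (w + s *: v) - y) - P y (x + (w + s *: v) - y)| <= 2 * d.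
  move=> s4; have sv : `|s *: v| <= 4 / 10.
    rewrite normrZ; apply: le_trans s4; rewrite ler_piMr//.
  apply: flats_dist2 => //.
  - by rewrite blinD blinZ Pw Pv.
  - by apply: le_lt_trans (ler_normD _ _) _; lra.
  - rewrite (_ : x + (w + s *: v) - y = (x + w - y) + s *: v); last by modeq R E.
    by apply: le_lt_trans (ler_normD _ _) _; have := d100; lra.
have a4 : `|4 / 10 : R| <= 4 / 10 by rewrite ger0_norm.
have b4 : `|- (4 / 10) : R| <= 4 / 10 by rewrite normrN ger0_norm.
have k1 := key _ a4; have k2 := key _ b4.
have : `|(8 / 10) *: (v - P y v)| <= 4 * d.
  have -> : (8 / 10) *: (v - P y v) =
     ((x + (w + (4 / 10) *: v) - y) - P y (x + (w + (4 / 10) *: v) - y))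
     - ((x + (w + - (4 / 10) *: v) - y) - P y (x + (w + - (4 / 10) *: v) - y)).
    by rewrite !(blinB (P y)) !(blinD (P y)) !(blinZ (P y)); modeq R E.
  apply: le_trans (ler_normB _ _) _; lra.
by rewrite normrZ ger0_norm//; lra.
Qed.

(** [P x - P y] equals [(1 - P y) P x - P y (1 - P x)]. The tilt bounds the first term by [5 d], and
    also the second, which is the adjoint of [(1 - P x) P y]. *)
Lemma flats_close x y : X x -> X y -> `|x - y| < 9 / 10 -> `|P x - P y| <= 10 * d.
Proof.
move=> Xx Xy xy; have d0 := flats_ge0 Xx.
have yx : `|y - x| < 9 / 10 by rewrite distrC.
have xP := flats_sym_idem Xx; have yP := flats_sym_idem Xy.
have tilt p q v : X p -> X q -> `|p - q| < 9 / 10 -> `|P p v - P q (P p v)| <= 5 * d * `|v|.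
  move=> Xp Xq pq; have pP := flats_sym_idem Xp; have [_ Pi] := pP.
  have [->|v0] := eqVneq (P p v) 0.
    by rewrite blin0 subr0 normr0 !mulr_ge0.
  have nv : 0 < `|P p v| by rewrite normr_gt0.
  have := @flats_tilt p q (`|P p v|^-1 *: P p v) Xp Xq pq.
  rewrite blinZ Pi normrZ normfV normr_id mulVf ?gt_eqF// => /(_ erefl (lexx _)).
  rewrite blinZ -scalerBr normrZ normfV normr_id ler_pdivrMl// mulrC => H.
  by apply: le_trans H _; rewrite ler_wpM2l ?mulr_ge0// sym_idem_le.
apply: norm_blin_le => [|v]; first by rewrite mulr_ge0.
have -> : (P x - P y) v = (P x v - P y (P x v)) - P y (v - P x v).
  by rewrite blinBE blinB; modeq R E.
apply: le_trans (ler_normB _ _) _.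
suff : `|P y (v - P x v)| <= 5 * d * `|v| by have := tilt x y v Xx Xy xy; lra.
apply: norm_inner_le; first by rewrite !mulr_ge0.
set u := P y (v - P x v).
have -> : inner u u = inner v (P y u - P x (P y u)).
  case: yP => ys yi; case: xP => xs xi.
  by rewrite {1}/u ys innerBl xs innerBr.
apply: le_trans (inner_le' _ _) _; rewrite mulrC.
have := tilt y x u Xy Xx yx => H.
by rewrite mulrAC; apply: ler_wpM2r.
Qed.

End Flats.

Section Setup.
Context {R : realType}.

(** The radius [9 / 10] exceeds [85 / 100 + 1 / 25]: it captures all weights that can be nonzero
    within [85 / 100] of [q]. *)
Definition locfin (E : hilbertType R) N (X X0 : set E) := forall q, X q ->
  exists J : seq E, [/\ uniq J, (size J <= N)%N &
    forall i, i \in J <-> X0 i /\ `|i - q| < 9 / 10].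

Definition setup (E : hilbertType R) N n (d : R) (X : set E) (P : E -> blin E E)
    (X0 : set E) :=
  [/\ flats n d X P, maximal_separated 100^-1 X X0, locfin N X X0
    & d <= 100^-1 / 100].

(** Points of [X] near [q] are within [d] of one flat, so projecting to it costs at most [2 d] of
    their separation [1 / 100] and leaves more than [1 / 200], to which [packing] applies. *)
Lemma ex_locfin n : exists N : nat, forall (E : hilbertType R) (d : R) (X : set E)
    (P : E -> blin E E) (X0 : set E),
  flats n d X P -> maximal_separated 100^-1 X X0 -> d <= 100^-1 / 100 -> locfin N X X0.
Proof.
have [|N NP] := @packing R n (200^-1); first by [].
exists N => E d X P X0 XP [X0X sep _] d4 q Xq.
have qP := flats_sym_idem XP Xq; case: (XP) => rP H1 _.
have H (s : seq E) : uniq s -> (forall x, x \in s -> X0 x /\ `|x - q| < 9 / 10) ->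
    (size s <= N)%N.
  move=> us sA; apply: (NP E (P q) q) => //; first exact: rP.
    move=> x /sA[_ xq]; apply: le_trans (sym_idem_le qP _) _; lra.
  move=> x y /sA[Xx xq] /sA[Xy yq] /eqP xy.
  have h1 := H1 q x Xq (X0X _ Xx) ltac:(lra).
  have h2 := H1 q y Xq (X0X _ Xy) ltac:(lra).
  have E1 : x - y = P q (x - y) + (((x - q) - P q (x - q)) - ((y - q) - P q (y - q))).
    by rewrite !(blinB (P q)); modeq R E.
  have := sep _ _ Xx Xy xy; rewrite {1}E1 => h3.
  have h4 := ler_normD (P q (x - y)) (((x - q) - P q (x - q)) - ((y - q) - P q (y - q))).
  have h5 := ler_normB ((x - q) - P q (x - q)) ((y - q) - P q (y - q)).
  lra.
have [J [uJ sJ] JP] := bounded_card_finite H.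
by exists J; split=> // i; rewrite JP.
Qed.

Lemma open_lt_norm (V W : normedModType R) (f : V -> W) (r : R) :
  (forall x, differentiable f x) -> open [set x | `|f x| < r].
Proof.
move=> df; have -> : [set x | `|f x| < r] = f @^-1` [set y | `|y| < r] by [].
apply: open_comp; last exact: open_normlt.
by move=> x _; apply: differentiable_continuous.
Qed.

(** The height over the flat is limited besides the distance from [q], because away from the flat
    all the weights may vanish. *)
Definition reg (E : hilbertType R) (Q : blin E E) (q : E) (a b : R) : set E :=
  [set z | `|z - q| < a /\ `|(z - q) - Q (z - q)| < b].

Lemma isd_affine (V W : normedModType R) (L : blin V W) (q x : V) : isd (fun z => L (z - q)) x L.
Proof.
have := isd_blinl L (isd_subr q x); rewrite (_ : compb L (idb V) = L)//.
exact: blinP.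
Qed.

Lemma open_reg (E : hilbertType R) (Q : blin E E) (q : E) (a b : R) : open (reg Q q a b).
Proof.
have -> : reg Q q a b = [set z | `|z - q| < a] `&` [set z | `|(idb E - Q) (z - q)| < b] by [].
apply: openI; apply: open_lt_norm => x.
  by case: (isd_subr q x).
by case: (isd_affine (idb E - Q) q x).
Qed.

Section Averages.
Variables (E : hilbertType R) (N n : nat) (d : R) (X : set E) (P : E -> blin E E)
  (X0 : set E).
Hypothesis S : setup N n d X P X0.

Definition wt (i z : E) : R^o := weight 25^-1 i z.

(** Finiteness of the set of relevant indices is guaranteed only near [X]; where it fails, the
    default is the empty list. *)
Definition active (z : E) : seq E :=
  xget [::] [set s | uniq s /\ forall i, i \in s <-> X0 i /\ wt i z != 0].

Definition wsum (Z : normedModType R) (f : E -> Z) (z : E) : Z :=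
  \sum_(i <- active z) wt i z *: f i.

Definition wtot (z : E) : R^o := wsum (fun=> 1 : R^o) z.

Definition avg (Z : normedModType R) (f : E -> Z) (z : E) : Z :=
  (wtot z)^-1 *: wsum f z.

Lemma wsum_seq (Z : normedModType R) (f : E -> Z) (J : seq E) z : uniq J ->
  (forall i, i \in J -> X0 i) -> (forall i, X0 i -> wt i z != 0 -> i \in J) ->
  wsum f z = \sum_(i <- J) wt i z *: f i.
Proof.
move=> uJ JX XJ.
have [ua aP] : uniq (active z) /\ forall i, i \in active z <-> X0 i /\ wt i z != 0.
  apply: (@xgetPex _ [::] [set s | uniq s /\ forall i, i \in s <-> X0 i /\ wt i z != 0]).
  exists [seq i <- J | wt i z != 0]; split; first exact: filter_uniq.
  move=> i; rewrite mem_filter; split=> [/andP[-> /JX]//|[Xi wi]].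
  by rewrite wi XJ.
rewrite [RHS](bigID (fun i => wt i z != 0))/= [X in _ + X]big1 ?addr0; last first.
  by move=> i; rewrite negbK => /eqP ->; rewrite scale0r.
rewrite -big_filter; apply: perm_big; apply: uniq_perm => //; first exact: filter_uniq.
move=> i; rewrite mem_filter; apply/idP/idP => [/aP[Xi wi]|/andP[wi /JX Xi]].
  by rewrite wi XJ.
exact/aP.
Qed.

Lemma wt_ge0 i z : 0 <= wt i z.
Proof. exact: bump_ge0. Qed.

Lemma wt_neq0 i z : wt i z != 0 -> `|z - i| < 25^-1.
Proof.
apply: contraR; rewrite -leNgt => H; apply/eqP/bump0_le0.
rewrite subr_le0 inner_norm; apply: lerXn2r; rewrite ?nnegrE//.
Qed.

(** The argument is [(1 / 25) ^ 2 - (3 / 100) ^ 2]. Here [3 / 100] is [2 / 100], the distance to [X]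
    from [reg_near], plus the covering radius [1 / 100] of [X0]. *)
Definition wmin : R := bump 0 (7 / 100 / 100).

Lemma wmin_gt0 : 0 < wmin.
Proof. by apply: bump0_gt0; lra. Qed.

Lemma wt_ge_min i z : `|z - i| <= 3 / 100 -> wmin <= wt i z.
Proof.
move=> H; apply: bump0_mono; first by lra.
rewrite inner_norm.
have : `|z - i| ^+ 2 <= (3 / 100) ^+ 2 by apply: lerXn2r; rewrite ?nnegrE.
lra.
Qed.

Lemma setup_d0 q : X q -> 0 <= d.
Proof. by move=> Xq; case: S => XP _ _ _; exact: (flats_ge0 XP Xq). Qed.

Lemma reg_near q z : X q -> reg (P q) q (95 / 100) 100^-1 z ->
  exists2 x, X x & `|z - x| < 2 / 100.
Proof.
move=> Xq [zq Qz]; case: S => XP _ _ d4; case: (XP) => _ _ H2.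
have qP := flats_sym_idem XP Xq; have [_ Pi] := qP.
have vz := sym_idem_le qP (z - q).
have [x [Xx _ xd]] := H2 q (P q (z - q)) Xq (Pi _) ltac:(lra).
exists x => //.
have -> : z - x = ((z - q) - P q (z - q)) - (x - (q + P q (z - q))) by modeq R E.
apply: le_lt_trans (ler_normB _ _) _; lra.
Qed.

Lemma reg_wtot q z (J : seq E) : X q -> reg (P q) q (85 / 100) 100^-1 z ->
  uniq J -> (forall i, i \in J <-> X0 i /\ `|i - q| < 9 / 10) ->
  [/\ forall (Z : normedModType R) (f : E -> Z), wsum f z = \sum_(i <- J) wt i z *: f i,
      wmin <= wtot z & wtot z <= (size J)%:R].
Proof.
move=> Xq zD uJ JP; case: (S) => XP [X0X _ cov] _ d4; case: (zD) => zq Qz.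
have sumE (Z : normedModType R) (f : E -> Z) : wsum f z = \sum_(i <- J) wt i z *: f i.
  apply: wsum_seq => // [i /JP[]//|i Xi /wt_neq0 zi].
  apply/JP; split=> //.
  rewrite -(subrKA z) addrC; apply: le_lt_trans (ler_normD _ _) _.
  rewrite (distrC i z); lra.
have WE : wtot z = \sum_(i <- J) wt i z.
  by rewrite /wtot sumE; apply: eq_bigr => i _; rewrite /GRing.scale /= mulr1.
split=> //.
  have zD' : reg (P q) q (95 / 100) 100^-1 z by split=> //; lra.
  have [x Xx zx] := reg_near Xq zD'.
  have [i Xi xi] := cov x Xx.
  have zi : `|z - i| <= 3 / 100.
    by rewrite -(subrKA x); apply: le_trans (ler_normD _ _) _; lra.
  have iJ : i \in J.
    apply/JP; split=> //; rewrite -(subrKA z) addrC.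
    by apply: le_lt_trans (ler_normD _ _) _; rewrite (distrC i z); lra.
  rewrite WE (bigD1_seq i)//=; apply: le_trans (wt_ge_min zi) _.
  by rewrite lerDl sumr_ge0// => j _; apply: wt_ge0.
rewrite WE; apply: (@le_trans _ _ (\sum_(i <- J) (1 : R))).
  by apply: ler_sum => i _; apply: le_trans (bump_le _ _) _; rewrite expr0.
by rewrite big_const_seq count_predT iter_addr_0.
Qed.

End Averages.
End Setup.

Section AverageBounds.
Context {R : realType}.

(** The reciprocal [u] of the total weight [W] satisfies [u = (1 - W / M) u + 1 / M]. Since
    [wmin <= W <= M], this is a contraction with factor [th], and [cb_linfix] bounds all derivatives
    of [u]. *)
Lemma cb_wtot N k : exists K : R, 0 <= K /\
  forall (E : hilbertType R) n d X P X0 (q : E), @setup R E N n d X P X0 -> X q ->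
  (forall i, X0 i -> `|i - q| < 9 / 10 -> cb k K (reg (P q) q (85 / 100) 100^-1) (wt i)) /\
  cb k K (reg (P q) q (85 / 100) 100^-1) (fun z => (wtot X0 z)^-1 : R^o).
Proof.
have [c [c0 Hc]] := @cb_weight R k 25^-1.
pose M : R := N.+1%:R.
have M0 : 0 < M by rewrite ltr0n.
have M1 : 1 <= M by rewrite ler1n.
have wm0 := @wmin_gt0 R.
have wm1 : @wmin R <= 1 by apply: le_trans (bump_le _ _) _; rewrite expr0.
pose th : R := 1 - @wmin R / M.
have th1 : th < 1 by rewrite ltrBlDr ltrDl divr_gt0.
have th0 : 0 <= th by rewrite subr_ge0 ler_pdivrMr// mul1r; lra.
pose a : R := 1 * (1 + `|M^-1| * (N%:R * c)).
have a0 : 0 <= a by rewrite /a mul1r addr_ge0// !mulr_ge0.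
pose K2 := linK th a k * M^-1.
have K20 : 0 <= K2 by rewrite /K2 mulr_ge0 ?invr_ge0 ?(ltW M0)// ltW// linK_gt0.
exists (c + K2); split; first exact: addr_ge0.
move=> E n d X P X0 q S Xq; set D := reg _ _ _ _.
have oD : open D by apply: open_reg.
have wtc i : X0 i -> `|i - q| < 9 / 10 -> cb k c D (wt i).
  move=> Xi iq; apply: Hc => // z [zq _].
  by rewrite -(subrKA q); apply: le_trans (ler_normD _ _) _; rewrite (distrC q); lra.
split=> [i Xi iq|]; first by apply: cb_mono (wtc i Xi iq); rewrite lerDl.
apply: (@cb_mono _ _ _ _ K2); first by rewrite lerDr.
have [J [uJ sJ JP]] : exists J : seq E, [/\ uniq J, (size J <= N)%N &
    forall i, i \in J <-> X0 i /\ `|i - q| < 9 / 10] by case: S => _ _ H _; exact: H.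
have WD z (Dz : D z) := reg_wtot S Xq Dz uJ JP.
have cW : cb k (N%:R * c) D (wtot X0 : E -> R^o).
  apply: (@cb_mono _ _ _ _ ((size J)%:R * c)); first by rewrite ler_wpM2r// ler_nat.
  apply: (@cb_eq _ _ _ _ _ _ (fun z => \sum_(i <- J) (wt i z : R^o))) => // [z Dz|].
    have [sE _ _] := WD z Dz; rewrite /wtot sE; apply: eq_bigr => i _.
    by rewrite /GRing.scale /= mulr1.
  apply: cb_sum => // i; rewrite JP => -[Xi iq]; exact: wtc.
pose A (z : E) := scalebb R^o (1 - M^-1 *: wtot X0 z : R^o).
apply: (@cb_linfix R E k R^o th a M^-1 D A (fun=> M^-1)) => //.
- by rewrite th0.
- by rewrite invr_ge0 ltW.
- move=> z Dz; have [_ w1 w2] := WD z Dz.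
  apply: le_trans (blin_norm_le _ _) _.
  apply: (@le_trans _ _ (1 * `|1 - M^-1 *: wtot X0 z : R^o|)).
    by apply: ler_wpM2r => //; apply: norm_scalebb.
  have wM : wtot X0 z <= M by apply: le_trans w2 _; rewrite ler_nat ltnW.
  rewrite mul1r ger0_norm /GRing.scale /=; last first.
    by rewrite subr_ge0 mulrC ler_pdivrMr// mul1r.
  by rewrite /th lerD2l lerN2 mulrC ler_wpM2l// invr_ge0 ltW.
- apply: cb_blinl => //; [by rewrite addr_ge0// !mulr_ge0|exact: norm_scalebb|].
  apply: cbB => //; first by rewrite !mulr_ge0.
    by apply: (@cb_cst _ k E R^o) => //; rewrite normr1.
  by apply: cbZ => //; rewrite mulr_ge0.
- by apply: cb_cst => //; rewrite ger0_norm// invr_ge0 ltW.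
- move=> z Dz; have [_ w1 _] := WD z Dz.
  have W0 : wtot X0 z != 0 by rewrite gt_eqF// (lt_le_trans wm0).
  rewrite /A /= /GRing.scale /= mulrBr mulr1 mulrCA mulVf// mulr1.
  by rewrite subrK.
Qed.

(** The weights [om] sum to 1, so that subtracting [g] from the average amounts to averaging
    [f i - g]. This is how derivatives of the weights, which are not small, come with a factor
    [e]. *)
Lemma cb_avg N k : exists K : R, 0 <= K /\
  forall (E : hilbertType R) n d X P X0 (q : E) (Z : normedModType R)
    (f : E -> E -> Z) (g : E -> Z) (e : R),
  @setup R E N n d X P X0 -> X q -> 0 <= e ->
  (forall i, X0 i -> `|i - q| < 9 / 10 ->
     cb k e (reg (P q) q (85 / 100) 100^-1) (fun z => f i z - g z)) ->
  cb k (K * e) (reg (P q) q (85 / 100) 100^-1) (fun z => avg X0 (f^~ z) z - g z).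
Proof.
have [c [c0 Hc]] := cb_wtot N k.
pose K1 : R := 1 * (2 ^+ k * (c * c)).
have K10 : 0 <= K1 by rewrite /K1 mul1r !mulr_ge0// exprn_ge0.
exists (N%:R * (1 * (2 ^+ k * K1))); split.
  by rewrite !mulr_ge0// ?exprn_ge0.
move=> E n d X P X0 q Z f g e S Xq e0 H; set D := reg _ _ _ _.
have oD : open D by apply: open_reg.
have [wc uc] := Hc E n d X P X0 q S Xq.
have [J [uJ sJ JP]] : exists J : seq E, [/\ uniq J, (size J <= N)%N &
    forall i, i \in J <-> X0 i /\ `|i - q| < 9 / 10] by case: S => _ _ L _; exact: L.
pose om i z : R^o := (wtot X0 z)^-1 * wt i z.
have omc i : X0 i -> `|i - q| < 9 / 10 -> cb k K1 D (om i).
  move=> Xi iq.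
  have := @cb_bil R k E R^o R^o R^o (scalebb R^o) 1 c c D (wt i) _ oD c0 c0
    (norm_scalebb _) (wc i Xi iq) uc.
  exact.
apply: (@cb_mono _ _ _ _ ((size J)%:R * (1 * (2 ^+ k * (e * K1))))).
  have -> : N%:R * (1 * (2 ^+ k * K1)) * e = N%:R * (1 * (2 ^+ k * (e * K1))) by ring.
  by apply: ler_wpM2r; [rewrite !mulr_ge0// exprn_ge0|rewrite ler_nat].
apply: (@cb_eq _ _ _ _ _ _ (fun z => \sum_(i <- J) scalebb Z (f i z - g z) (om i z))) => //.
  move=> z Dz; have [sE w1 _] := reg_wtot S Xq Dz uJ JP.
  have W0 : wtot X0 z != 0 by rewrite gt_eqF// (lt_le_trans (@wmin_gt0 R)).
  have gE : g z = (wtot X0 z)^-1 *: \sum_(i <- J) wt i z *: g z.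
    rewrite -scaler_suml scalerA (_ : \sum_(i <- J) wt i z = wtot X0 z) ?mulVf ?scale1r//.
    by rewrite /wtot sE; apply: eq_bigr => i _; rewrite /GRing.scale /= mulr1.
  rewrite [in RHS]gE /avg sE -scalerBr -sumrB scaler_sumr; apply: eq_bigr => i _.
  by rewrite -scalerBr scalerA.
apply: cb_sum => // [|i]; first by rewrite !mulr_ge0// exprn_ge0.
rewrite JP => -[Xi iq].
apply: cb_bil => //; [exact: norm_scalebb|exact: H|exact: omc].
Qed.

Lemma cb_avg_proj N k : exists K : R, 0 <= K /\
  forall (E : hilbertType R) n d X P X0 (q : E),
  @setup R E N n d X P X0 -> X q ->
  cb k (K * d) (reg (P q) q (85 / 100) 100^-1) (fun z => avg X0 P z - P q).
Proof.
have [K [K0 HK]] := cb_avg N k; exists (K * 10); split; first by rewrite mulr_ge0.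
move=> E n d X P X0 q S Xq; have d0 := setup_d0 S Xq.
rewrite -mulrA; apply: (HK E n d X P X0 q _ (fun i _ => P i) (fun=> P q)) => //.
  by rewrite mulr_ge0.
move=> i Xi iq; apply: cb_cst; first exact: open_reg.
case: S => XP [X0X _ _] _ d4.
by apply: (flats_close XP) => //; [lra|exact: X0X].
Qed.

Lemma cb_avg_normal N k : exists K : R, 0 <= K /\
  forall (E : hilbertType R) n d X P X0 (q : E),
  @setup R E N n d X P X0 -> X q ->
  cb k (K * d) (reg (P q) q (85 / 100) 100^-1)
    (fun z => avg X0 (fun i => (z - i) - P i (z - i)) z - ((z - q) - P q (z - q))).
Proof.
have [K [K0 HK]] := cb_avg N k; exists (K * 11); split; first by rewrite mulr_ge0.
move=> E n d X P X0 q S Xq; have d0 := setup_d0 S Xq.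
rewrite -mulrA; apply: (HK E n d X P X0 q _ (fun i z => (z - i) - P i (z - i))
   (fun z => (z - q) - P q (z - q))) => //.
  by rewrite mulr_ge0.
move=> i Xi iq; case: S => XP [X0X _ _] _ d4.
have Pc : `|P i - P q| <= 10 * d by apply: (flats_close XP) => //; [lra|exact: X0X].
have Pc' : `|P q - P i| <= 10 * d by rewrite distrC.
(* The deviation is affine in [z]. At [z] it is at most [10 d |z - q| + d], whence the factor 11. *)
apply: (@cb_affine _ _ _ _ _ _ _ (P q - P i)); first exact: open_reg.
- move=> z [zq _].
  have -> : (z - i) - P i (z - i) - ((z - q) - P q (z - q)) =
     (P q - P i) (z - q) + ((q - i) - P i (q - i)).
    by rewrite blinBE !(blinB (P i)) !(blinB (P q)); modeq R E.
  case: (XP) => _ H1 _; have := H1 i q (X0X _ Xi) Xq.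
  rewrite distrC => /(_ ltac:(lra)) h1.
  apply: le_trans (ler_normD _ _) _.
  have := blin_le Pc' (lexx `|z - q|); nra.
- move=> z _; have := isdB (isdB (isd_subr i z) (isd_affine (P i) i z))
    (isdB (isd_subr q z) (isd_affine (P q) q z)).
  rewrite (_ : idb E - P i - (idb E - P q) = P q - P i)//.
  by modeq R (blin E E).
- by apply: le_trans Pc' _; rewrite ler_wpM2r// ler_nat.
Qed.

End AverageBounds.

(** * The equation of the submanifold *)

Section LocalEquation.
Context {R : realType} {E : hilbertType R}.
Variables (P : E -> blin E E) (X0 : set E).

Definition avg_proj (z : E) : blin E E := avg X0 P z.

Definition avg_normal (z : E) : E := avg X0 (fun i => (z - i) - P i (z - i)) z.

Definition idem_defect (z : E) : blin E E :=
  4 *: (compb (avg_proj z) (avg_proj z) - avg_proj z).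

(* With [S = 2 T - 1], [T] the averaged projector, this is [|S| - S], where
   [|S|] is the square root of [S ^ 2 = 1 + idem_defect]. Its kernel is the
   spectral subspace of [S] for positive eigenvalues. *)
Definition normal_op (z : E) : blin E E :=
  2 *: (idb E - avg_proj z) + sqy (idem_defect z).

Definition defect (z : E) : E := normal_op z (avg_normal z).

Section AtPoint.
Variables (q : E).
Hypothesis PP : sym_idem (P q).

Definition err_op (z : E) : blin E E := normal_op z - 2 *: (idb E - P q).

Definition err_normal (z : E) : E := avg_normal z - ((z - q) - P q (z - q)).

(** The small part of the projected equation: with [L = 1 - P q], applying [L] to [defect z] gives
    [2 L (z - q)] and terms containing [err_op] or [err_normal]; those terms are collected here,
    divided by [-2]. *)
Definition sfun (z : E) : E :=
  - (2^-1 *: (idb E - P q) (2 *: err_normal z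
     + err_op z ((idb E - P q) (z - q)) + err_op z (err_normal z))).

Lemma projC_idem v : (idb E - P q) ((idb E - P q) v) = (idb E - P q) v.
Proof. by case: PP => _ Pi; rewrite !blinBE /= blinB Pi subrr subr0. Qed.

Lemma proj_projC v : P q ((idb E - P q) v) = 0.
Proof. by case: PP => _ Pi; rewrite !blinBE /= blinB Pi subrr. Qed.

Lemma proj_sfun z : P q (sfun z) = 0.
Proof. by rewrite /sfun blinN blinZ proj_projC scaler0 oppr0. Qed.

Lemma idem_defect_small z : `|avg_proj z - P q| <= 100^-1 ->
  `|idem_defect z| <= 16 * `|avg_proj z - P q|.
Proof.
set s := avg_proj z - P q => Ts.
have TE : avg_proj z = P q + s by rewrite addrC subrK.
clearbody s.
have -> : idem_defect z = 4 *: (compb (P q) s + compb s (P q) + compb s s - s).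
  rewrite /idem_defect TE; congr (_ *: _).
  apply: blinP => v; case: PP => _ Pi.
  rewrite !blinBE !blinDE !compbE !blinDE. rewrite !(blinD (P q)) Pi !(blinD s).
  by modeq R E.
have P1 := sym_idem_norm PP; have s0 := normr_ge0 s.
have h1 : `|compb (P q) s| <= 1 * `|s|.
  by apply: le_trans (norm_compb _ _) _; rewrite ler_wpM2r.
have h2 : `|compb s (P q)| <= `|s| * 1.
  by apply: le_trans (norm_compb _ _) _; rewrite ler_wpM2l.
have h3 : `|compb s s| <= `|s| * 1.
  apply: le_trans (norm_compb _ _) _; rewrite ler_wpM2l//.
  by apply: le_trans Ts _; lra.
rewrite normrZ ger0_norm//.
have := ler_normB (compb (P q) s + compb s (P q) + compb s s) s.
have := ler_normD (compb (P q) s + compb s (P q)) (compb s s).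
have := ler_normD (compb (P q) s) (compb s (P q)).
lra.
Qed.

Lemma defect_expand z :
  (idb E - P q) (defect z) = 2 *: ((z - q) - P q (z - q) - sfun z).
Proof.
have -> : defect z = (2 *: (idb E - P q) + err_op z)
    (((z - q) - P q (z - q)) + err_normal z).
  by rewrite /err_op /err_normal addrC subrK addrC subrK.
set L := idb E - P q; set m := err_normal z.
have LL v : L (L v) = L v by apply: projC_idem.
have -> : (z - q) - P q (z - q) = L (z - q) by [].
have -> : (2 *: L + err_op z) (L (z - q) + m) =
    2 *: L (z - q) + (2 *: L m + err_op z (L (z - q)) + err_op z m).
  rewrite blinDE blinZE (blinD L) LL (blinD (err_op z)) scalerDr; modeq R E.
rewrite /sfun -/L -/m opprK; clearbody L m.
rewrite blinD blinZ LL scalerDr scalerA mulfV// scale1r.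
by congr (_ + _); rewrite !(blinD L) !(blinZ L) LL.
Qed.

(* [(|S| + S) (|S| - S) = 0] and [|S| + S] is close to [2 P q]. *)
Lemma defect_zero z : `|avg_proj z - P q| <= 100^-1 ->
  (defect z = 0 <-> (z - q) - P q (z - q) = sfun z).
Proof.
move=> Ts; have := defect_expand z; set L := idb E - P q => dE.
split=> [d0|sE].
  move: dE; rewrite d0 blin0 => /esym/eqP; rewrite scaler_eq0 pnatr_eq0/=.
  by rewrite subr_eq0 => /eqP.
have {}dE : L (defect z) = 0 by rewrite dE sE subrr scaler0.
pose u := defect z.
have uP : P q u = u by apply: esym; apply: subr0_eq; exact: dE.
have es := idem_defect_small Ts.
have e2 : `|idem_defect z| < 2^-1 by apply: le_lt_trans es _; lra.
have [yE ye] := sqyP e2.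
pose T := avg_proj z; pose y := sqy (idem_defect z).
have yT : compb y T = compb T y.
  apply: sqy_comm e2 _; rewrite /idem_defect -/T; move: (T) => T'.
  apply: blinP => v; rewrite !compbE !blinZE blinZ !blinBE blinB.
  by rewrite !compbE.
(* As [|S| = 1 + y] and [S = 2 T - 1], the operator [2 T + y] is [|S| + S]. The product vanishes
   because [y] commutes with [T] and solves the equation of the square root. *)
have key : 2 *: T u + y u = 0.
  have yE' : y + y + compb y y = 4 *: (compb T T - T) by exact: yE.
  have -> : u = 2 *: (avg_normal z - T (avg_normal z)) + y (avg_normal z) by [].
  move: (T) (y) (avg_normal z) yT yE' => T' y' v yT' yE'.
  have yTv w : y' (T' w) = T' (y' w) by have := congr1 (fun f : blin E E => f w) yT'.
  have yyv : y' (y' v) = 4 *: (T' (T' v) - T' v) - y' v - y' v.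
    have H : y' v + y' v + y' (y' v) = 4 *: (T' (T' v) - T' v).
      by have := congr1 (fun f : blin E E => f v) yE'.
    by rewrite -H; modeq R E.
  rewrite !(blinD T') !(blinD y') !(blinZ T') !(blinZ y').
  rewrite !(blinB T') !(blinB y') !yTv yyv.
  by modeq R E.
(* On the range of [P q] the operator [2 T + y] is 2 plus an operator of norm at most [18 / 100], so
   it has no kernel there. *)
have u2 : 2 *: u = - (2 *: (T - P q) u + y u).
  have -> : 2 *: (T - P q) u = 2 *: T u - 2 *: u by rewrite blinBE uP scalerBr.
  by apply/subr0_eq; rewrite -[RHS]key; modeq R E.
have : `|2 *: u| <= 2 * (100^-1 * `|u|) + (16 * 100^-1) * `|u|.
  rewrite u2 normrN; apply: le_trans (ler_normD _ _) _; apply: lerD.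
    by rewrite normrZ ger0_norm// ler_wpM2l//; apply: blin_le.
  by apply: blin_le => //; apply: le_trans ye _; apply: le_trans es _; lra.
rewrite normrZ ger0_norm// => H; apply/normr0_eq0/eqP; rewrite -/u.
by rewrite eq_le normr_ge0 andbT; have := normr_ge0 u; lra.
Qed.

End AtPoint.
End LocalEquation.

Section LocalBounds.
Context {R : realType}.

Lemma setup_d1 (E : hilbertType R) N n d X P X0 (q : E) :
  @setup R E N n d X P X0 -> X q -> 0 <= d <= 1.
Proof.
move=> S Xq; rewrite (setup_d0 S Xq) /=; case: S => _ _ _ d4; lra.
Qed.

Lemma cb_idem_defect N k : exists K : R, 0 <= K /\
  forall (E : hilbertType R) n d X P X0 (q : E),
  @setup R E N n d X P X0 -> X q ->
  cb k (K * d) (reg (P q) q (85 / 100) 100^-1) (idem_defect P X0).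
Proof.
have [K [K0 HK]] := @cb_avg_proj R N k.
have k2 : 0 <= 2 ^+ k :> R by rewrite exprn_ge0.
exists (4 * (K + K + 2 ^+ k * (K * K) + K)); split.
  by rewrite mulr_ge0// !addr_ge0// !mulr_ge0.
move=> E n d X P X0 q S Xq; have /andP[d0 d1] := setup_d1 S Xq.
have sc := HK E n d X P X0 q S Xq.
have PP : sym_idem (P q) by case: S => XP _ _ _; apply: flats_sym_idem XP _ Xq.
have oD := open_reg (P q) q (85 / 100) 100^-1.
move: (reg _ _ _ _) oD sc => D oD.
set s := (fun z : E => avg X0 P z - P q) => sc.
have Kd : 0 <= K * d by rewrite mulr_ge0.
apply: (@cb_eq _ _ _ _ _ _ (fun z => 4 *: (compbb E E E (P q) (s z)
   + flipb (compbb E E E) (P q) (s z) + compbb E E E (s z) (s z) - s z))) => // [z Dz|].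
  have TE : avg_proj P X0 z = P q + s z by rewrite /s addrC subrK.
  rewrite /idem_defect TE; congr (_ *: _).
  apply: blinP => v; case: PP => _ Pi; move: (s z) => t.
  have -> : (compbb E E E (P q) t + flipb (compbb E E E) (P q) t + compbb E E E t t - t) v
    = P q (t v) + t (P q v) + t (t v) - t v by [].
  rewrite !blinBE !compbE !blinDE !(blinD (P q)) Pi !(blinD t).
  by modeq R E.
rewrite -mulrA -[X in X * _](@ger0_norm _ 4)//.
apply: cbZ => //; first by rewrite mulr_ge0// !addr_ge0// !mulr_ge0.
have -> : (K + K + 2 ^+ k * (K * K) + K) * d =
  1 * (K * d) + 1 * (K * d) + 2 ^+ k * (K * K) * d + K * d by ring.
apply: cbB => //; apply: cbD => //; first apply: cbD => //.
- apply: cb_blinl => //; apply: le_trans (blin_norm_le _ _) _.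
  rewrite -[leRHS]mul1r; apply: ler_pM => //; first exact: norm_compbb.
  exact: sym_idem_norm.
- apply: cb_blinl => //; apply: le_trans (norm_flipb1 _ _) _.
  rewrite -[leRHS]mul1r; apply: ler_pM => //; first exact: norm_compbb.
  exact: sym_idem_norm.
- apply: (@cb_mono _ _ _ _ (1 * (2 ^+ k * ((K * d) * (K * d))))); last first.
    by apply: cb_bil => //; apply: norm_compbb.
  rewrite mul1r -!mulrA ler_wpM2l// [leLHS](_ : _ = (K * (K * d)) * d); last by ring.
  by rewrite [leRHS](_ : _ = (K * (K * d)) * 1) ?ler_wpM2l ?mulr_ge0//; ring.
Qed.

Definition near_proj (E : hilbertType R) (P : E -> blin E E) (X0 : set E) (q : E) :=
  forall z, reg (P q) q (85 / 100) 100^-1 z -> `|avg_proj P X0 z - P q| <= 100^-1.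

Lemma cb_err_op N k : exists K : R, 0 <= K /\
  forall (E : hilbertType R) n d X P X0 (q : E),
  @setup R E N n d X P X0 -> X q -> near_proj P X0 q ->
  cb k (K * d) (reg (P q) q (85 / 100) 100^-1) (err_op P X0 q).
Proof.
have [Ka [Ka0 Ha]] := @cb_avg_proj R N k.
have [Ke [Ke0 He]] := cb_idem_defect N k.
have h0 : 0 <= (2^-1 : R) * Ke by rewrite mulr_ge0.
have [Kc [Kc0 Hc]] := @cb_comp_small R k _ _ h0 (sqtK_ge0 k).
exists (2 * Ka + (2^-1 * Ke + (2 * Ke + Kc * (2^-1 * Ke)))); split.
  by rewrite !addr_ge0 ?mulr_ge0.
move=> E n d X P X0 q S Xq np; have /andP[d0 d1] := setup_d1 S Xq.
have sc := Ha E n d X P X0 q S Xq; have ec := He E n d X P X0 q S Xq.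
have PP : sym_idem (P q) by case: S => XP _ _ _; apply: flats_sym_idem XP _ Xq.
have oD := open_reg (P q) q (85 / 100) 100^-1.
rewrite /near_proj in np; move: (reg _ _ _ _) np oD sc ec => D np oD sc ec.
have Kd : 0 <= Ka * d by rewrite mulr_ge0.
have Ked : 0 <= Ke * d by rewrite mulr_ge0.
have e2 z : D z -> `|idem_defect P X0 z| < 2^-1.
  move=> Dz; apply: le_lt_trans (idem_defect_small PP (np _ Dz)) _.
  have := np _ Dz; lra.
apply: (@cb_eq _ _ _ _ _ _ (fun z => (-2) *: (avg X0 P z - P q)
   + (2^-1 *: idem_defect P X0 z + sqt (2^-1 *: idem_defect P X0 z)))) => // [z Dz|].
  rewrite /err_op /normal_op -/(avg_proj P X0 z) /sqy.
  by move: (sqt _) => w; modeq R (blin E E).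
have -> : (2 * Ka + (2^-1 * Ke + (2 * Ke + Kc * (2^-1 * Ke)))) * d =
  `|-2| * (Ka * d) + (`|2^-1| * (Ke * d) + (2 * (Ke * d) + Kc * (2^-1 * (Ke * d)))).
  by rewrite normrN !ger0_norm//; ring.
have hc : cb k (2^-1 * (Ke * d)) D (fun z => 2^-1 *: idem_defect P X0 z).
  by have := cbZ 2^-1 oD Ked ec; rewrite ger0_norm.
apply: cbD => //; first exact: cbZ.
apply: cbD => //; first exact: cbZ.
(* The derivatives of [sqt] are bounded by a constant only. The factor [d] comes from the inner
   function and, for the values, from [sqyP]. *)
apply: (Hc _ _ _ D [set y : blin E E | `|y| < 4^-1]) => //.
- by rewrite !mulr_ge0//= mulrA ler_piMr.
- by rewrite mulr_ge0.
- move=> z Dz /=; rewrite normrZ ger0_norm//; have := e2 z Dz; lra.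
- exact: cb_sqt.
- move=> z Dz; have [_ ye] := sqyP (e2 z Dz).
  have -> : sqt (2^-1 *: idem_defect P X0 z) =
      sqy (idem_defect P X0 z) - 2^-1 *: idem_defect P X0 z by rewrite /sqy addrC addKr.
  apply: le_trans (ler_normB _ _) _; rewrite normrZ ger0_norm//.
  have := cb_norm ec Dz; lra.
Qed.

Lemma cb_sfun N k : exists K : R, 0 <= K /\
  forall (E : hilbertType R) n d X P X0 (q : E),
  @setup R E N n d X P X0 -> X q -> near_proj P X0 q ->
  cb k (K * d) (reg (P q) q (85 / 100) 100^-1) (sfun P X0 q).
Proof.
have [Ka [Ka0 Ha]] := @cb_avg_normal R N k.
have [Kb [Kb0 Hb]] := cb_err_op N k.
have k2 : 0 <= 2 ^+ k :> R by rewrite exprn_ge0.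
exists (2^-1 * (1 * (2 * Ka + 1 * (2 ^+ k * (Kb * 1)) + 1 * (2 ^+ k * (Kb * Ka))))); split.
  by rewrite !mul1r !mulr_ge0// !addr_ge0 ?mulr_ge0.
move=> E n d X P X0 q S Xq np; have /andP[d0 d1] := setup_d1 S Xq.
have mc := Ha E n d X P X0 q S Xq; have oc := Hb E n d X P X0 q S Xq np.
have PP : sym_idem (P q) by case: S => XP _ _ _; apply: flats_sym_idem XP _ Xq.
have oD := open_reg (P q) q (85 / 100) 100^-1.
have Lc : cb k 1 (reg (P q) q (85 / 100) 100^-1) (fun z => (idb E - P q) (z - q)).
  apply: (@cb_affine _ _ _ _ _ _ _ (idb E - P q) oD) => [z [zq _]|z _|].
  - by apply: le_trans (sym_idem_leC PP _) _; lra.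
  - exact: isd_affine.
  - exact: sym_idem_normC.
move: (reg _ _ _ _) np oD mc oc Lc => D np oD mc oc Lc.
have Kad : 0 <= Ka * d by rewrite mulr_ge0.
have Kbd : 0 <= Kb * d by rewrite mulr_ge0.
apply: (@cb_mono _ _ _ _ (`|2^-1| * (1 * (`|2| * (Ka * d) + 1 * (2 ^+ k * ((Kb * d) * 1))
   + 1 * (2 ^+ k * ((Kb * d) * (Ka * d))))))).
  rewrite !ger0_norm// -[leRHS]mulrA ler_wpM2l// -[leRHS]mulrA ler_wpM2l//.
  rewrite [leRHS](_ : _ = 2 * (Ka * d) + 1 * (2 ^+ k * (Kb * d * 1)) + 1 * (2 ^+ k * (Kb * Ka * d)));
    last by ring.
  rewrite lerD2l !mul1r ler_wpM2l// [leLHS](_ : _ = (Kb * Ka * d) * d); last by ring.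
  by rewrite ler_piMr// !mulr_ge0.
have nn : 0 <= `|2| * (Ka * d) + 1 * (2 ^+ k * ((Kb * d) * 1))
   + 1 * (2 ^+ k * ((Kb * d) * (Ka * d))) by rewrite !mul1r !addr_ge0// ?mulr_ge0.
apply: cbN => //; first by rewrite !mulr_ge0.
apply: cbZ => //; first by rewrite mulr_ge0.
apply: cb_blinl => //; first exact: sym_idem_normC.
apply: cbD => //; first apply: cbD => //.
- exact: cbZ.
- exact: (@cb_bil R k E (blin E E) E E (idb (blin E E)) 1 _ _ D _ _ oD Kbd ler01 (norm_idb _) oc Lc).
- exact: (@cb_bil R k E (blin E E) E E (idb (blin E E)) 1 _ _ D _ _ oD Kbd Kad (norm_idb _) oc mc).
Qed.

(** Unlike in [cb_avg], values are averaged with no loss of a constant; this is essential for an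
    explicit Hausdorff distance. *)
Lemma avg_convex (E : hilbertType R) N n d X P X0 (q : E) (Z : normedModType R)
    (f : E -> Z) (c : Z) b z :
  @setup R E N n d X P X0 -> X q -> reg (P q) q (85 / 100) 100^-1 z ->
  (forall i, X0 i -> `|z - i| < 25^-1 -> `|f i - c| <= b) -> `|avg X0 f z - c| <= b.
Proof.
move=> S Xq Dz H.
have [J [uJ sJ JP]] : exists J : seq E, [/\ uniq J, (size J <= N)%N &
    forall i, i \in J <-> X0 i /\ `|i - q| < 9 / 10] by case: S => _ _ L _; exact: L.
have [sE w1 _] := reg_wtot S Xq Dz uJ JP.
have W0 : 0 < wtot X0 z by apply: lt_le_trans w1; apply: wmin_gt0.
have WE : \sum_(i <- J) wt i z = wtot X0 z.
  by rewrite /wtot sE; apply: eq_bigr => i _; rewrite /GRing.scale /= mulr1.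
have gE : c = (wtot X0 z)^-1 *: \sum_(i <- J) wt i z *: c.
  by rewrite -scaler_suml scalerA WE mulVf ?scale1r// gt_eqF.
rewrite [X in _ - X]gE /avg sE -scalerBr -sumrB normrZ normfV gtr0_norm//.
rewrite ler_pdivrMl//; apply: le_trans (ler_norm_sum _ _ _) _.
rewrite -WE mulr_suml big_seq [leRHS]big_seq; apply: ler_sum => i /JP[Xi iq].
rewrite -scalerBr normrZ ger0_norm ?wt_ge0//.
have [->|wi] := eqVneq (wt i z) 0; first by rewrite !mul0r.
by rewrite ler_wpM2l ?wt_ge0// H// wt_neq0.
Qed.

Lemma avg_lin (E : hilbertType R) (X0 : set E) (Z Z' : normedModType R) (L : blin Z Z') (f : E -> Z) z :
  L (avg X0 f z) = avg X0 (fun i => L (f i)) z.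
Proof.
rewrite /avg blinZ /wsum blin_sum; congr (_ *: _).
by apply: eq_bigr => i _; rewrite blinZ.
Qed.

(** The normal displacement from the flat at [i], seen from [q], differs from that of [z] by the
    height over the flat at [q] of the foot point [i + P i (z - i)]. By [flats_dist2] this is at
    most [2 d], whatever the index. *)
Lemma err_normal_le (E : hilbertType R) N n d X P X0 (q z : E) :
  @setup R E N n d X P X0 -> X q -> reg (P q) q (81 / 100) 100^-1 z ->
  `|(idb E - P q) (err_normal P X0 q z)| <= 2 * d.
Proof.
move=> S Xq [zq Qz]; case: (S) => XP [X0X _ _] _ d4.
have qP := flats_sym_idem XP Xq; have d0 := setup_d0 S Xq.
have Dz : reg (P q) q (85 / 100) 100^-1 z by split=> //; lra.
rewrite /err_normal blinB avg_lin projC_idem//.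
apply: (avg_convex S Xq Dz) => i Xi zi; have Xi' := X0X _ Xi.
have iP := flats_sym_idem XP Xi'; have [_ Pi] := iP.
have -> : (idb E - P q) (z - i - P i (z - i)) - (idb E - P q) (z - q) =
    - (idb E - P q) (i + P i (z - i) - q).
  by rewrite -(blinB (idb E - P q)) -(blinN (idb E - P q)); congr (_ _); modeq R E.
rewrite normrN.
have vi := sym_idem_le iP (z - i).
apply: (flats_dist2 XP) => //; first lra.
have -> : i + P i (z - i) - q = (z - q) + (P i (z - i) - (z - i)) by modeq R E.
apply: le_lt_trans (ler_normD _ _) _.
have := ler_normB (P i (z - i)) (z - i); lra.
Qed.

End LocalBounds.

(** * Solving the equation by graphs over the flats *)

Section LocalGraphs.
Context {R : realType}.

(* In the ball of radius [4 / 5] about [q], [M] is the graph over the flat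
   [q + range Q] of the map [h]. *)
Definition local_graph (E : hilbertType R) (c : nat -> R) (d : R) (M : set E)
    (Q : blin E E) (q : E) (h : E -> E) :=
  [/\ forall z, `|z - q| < 4 / 5 -> (M z <-> (z - q) - Q (z - q) = h z),
      forall z, `|z - q| < 4 / 5 -> h z = h (q + Q (z - q)),
      forall z, `|z - q| < 4 / 5 -> Q (h z) = 0,
      forall z, `|z - q| < 4 / 5 -> `|h z| <= 3 * d &
      forall k, cb k (c k * d) [set z | `|z - q| < 4 / 5] h].

Lemma reg_convex (E : hilbertType R) (Q : blin E E) q a b x y (s : R) :
  reg Q q a b x -> reg Q q a b y -> 0 <= s <= 1 -> reg Q q a b (x + s *: (y - x)).
Proof.
move=> [x1 x2] [y1 y2] /andP[s0 s1].
have conv (u v : E) r : `|u| < r -> `|v| < r -> `|(1 - s) *: u + s *: v| < r.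
  move=> ur vr; apply: le_lt_trans (ler_normD _ _) _.
  rewrite !normrZ !ger0_norm ?subr_ge0//.
  have [->|sn] := eqVneq s 0; first by rewrite subr0 mul1r mul0r addr0.
  have sp : 0 < s by rewrite lt_neqAle eq_sym sn.
  apply: (@lt_le_trans _ _ ((1 - s) * `|u| + s * r)); first by rewrite ltrD2l ltr_pM2l.
  by have : (1 - s) * `|u| <= (1 - s) * r; [rewrite ler_wpM2l ?subr_ge0// ltW|lra].
split.
  rewrite (_ : x + s *: (y - x) - q = (1 - s) *: (x - q) + s *: (y - q)); last by modeq R E.
  exact: conv.
rewrite (_ : x + s *: (y - x) - q - Q (x + s *: (y - x) - q) =
   (1 - s) *: (x - q - Q (x - q)) + s *: (y - q - Q (y - q))); last first.
  by rewrite !(blinB Q) !(blinD Q) !(blinZ Q) !(blinB Q); modeq R E.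
exact: conv.
Qed.

Lemma ex_local_graphs n : exists (sigma : R) (c : nat -> R),
  [/\ 0 < sigma, forall k, 0 <= c k &
  forall (E : hilbertType R) d X (P : E -> blin E E), flats n d X P -> d <= sigma ->
    exists M : set E, [/\ forall z, M z -> exists2 x, X x & `|z - x| < 100^-1 / 4 &
      forall q, X q -> exists h, local_graph c d M (P q) q h]].
Proof.
have [N HN] := @ex_locfin R n.
have [Kp [Kp0 Hp]] := @cb_avg_proj R N 0.
have [Km [Km0 Hm]] := @cb_avg_normal R N 0.
have [Ko [Ko0 Ho]] := @cb_err_op R N 0.
have /choice[Ks HKs] := @cb_sfun R N.
(* [Kp] controls the averaged projector, the bounds of order 0 and 1 make [sfun] a contraction of a
   small ball, and the product controls the quadratic terms in the height. No higher order occurs,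
   so [sg] serves for all [k]. *)
pose S0 := 1 + Kp + Ks 0%N + Ks 1%N + Ko * (Ks 0%N + Km).
have Ks0 k : 0 <= Ks k by have [] := HKs k.
have S01 : 1 <= S0 by rewrite /S0 -!addrA lerDl !addr_ge0// mulr_ge0// addr_ge0.
have S00 : 0 < S0 by apply: lt_le_trans S01.
pose sg := 100^-1 / 100 / S0.
have sg0 : 0 < sg by rewrite divr_gt0//; lra.
have sgS K : K <= S0 -> K * sg <= 100^-1 / 100.
  by move=> KS; rewrite /sg mulrA ler_pdivrMr// mulrC ler_wpM2l//; lra.
exists sg, (fun k => compK 1 k * (invK 2^-1 (Ks k) k * Ks k)); split=> // [k|].
  rewrite !mulr_ge0//; first by rewrite (le_trans ler01)// compK_ge1.
  by rewrite (le_trans ler01)// invK_ge1.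
move=> E d X P XP dsg.
have sg4 : sg <= 100^-1 / 100 by rewrite -[leLHS]mul1r sgS.
have d4 : d <= 100^-1 / 100 by apply: le_trans sg4.
have t0 : (0 : R) < 100^-1 by [].
have [X0 X0X] := ex_maximal_separated X t0.
have S : setup N n d X P X0 by split=> //; apply: HN XP X0X d4.
(* Where no weight is active the averages are 0 and [defect] vanishes trivially, so the zero set has
   to be restricted to a neighbourhood of [X]. *)
exists [set z | (exists2 x, X x & `|z - x| < 100^-1 / 4) /\ defect P X0 z = 0].
split=> [z []//|q Xq].
have PP := flats_sym_idem XP Xq; have [_ Pi] := PP; have d0 := setup_d0 S Xq.
have d1 : d <= 1 by lra.
have dK K : 0 <= K -> K <= S0 -> K * d <= 100^-1 / 100.
  move=> K0 KS; apply: le_trans (sgS K KS); exact: ler_wpM2l.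
set D := reg (P q) q (85 / 100) 100^-1.
have oD : open D by apply: open_reg.
have np : near_proj P X0 q.
  move=> z Dz; apply: le_trans (cb_norm (Hp E n d X P X0 q S Xq) Dz) _.
  have : Kp * d <= 100^-1 / 100.
    by apply: dK => //; rewrite /S0; have := Ks0 0%N; have := Ks0 1%N;
      have := mulr_ge0 Ko0 (addr_ge0 (Ks0 0%N) Km0); lra.
  by lra.
have sc k : cb k (Ks k * d) D (sfun P X0 q).
  by have [_ H] := HKs k; apply: H S Xq np.
have SKo := mulr_ge0 Ko0 (addr_ge0 (Ks0 0%N) Km0).
have K0d : Ks 0%N * d <= 100^-1 / 100.
  by apply: dK => //; rewrite /S0; have := Ks0 1%N; lra.
have K1d : Ks 1%N * d <= 100^-1 / 100.
  by apply: dK => //; rewrite /S0; have := Ks0 0%N; lra.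
have Kod : Ko * (Ks 0%N + Km) * d <= 100^-1 / 100.
  by apply: dK => //; rewrite /S0; have := Ks0 0%N; have := Ks0 1%N; lra.
have sr z : D z -> `|sfun P X0 q z| <= 100^-1 / 100.
  by move=> Dz; apply: le_trans (cb_norm (sc 0%N) Dz) K0d.
have sd z : D z -> differentiable (sfun P X0 q) z by move=> Dz; case: (cb_isd (sc 1%N) Dz).
have sdq z : D z -> `|fdiff (sfun P X0 q) z| <= 2^-1.
  move=> Dz; have [_ H] := cb_dcb (sc 1%N).
  have H1 := cb_norm H Dz; apply: le_trans H1 _; move: K1d; clear; lra.
have sq x y : D x -> D y -> `|sfun P X0 q x - sfun P X0 q y| <= 2^-1 * `|x - y|.
  move=> Dx Dy; have c0 : 0 <= 2^-1 * `|x - y| by rewrite mulr_ge0.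
  exact: (mean_value c0 (fun s s01 => reg_convex Dy Dx s01) sd
    (fun z Dz => blin_le (sdq z Dz) (lexx _))).
set D' := reg (P q) q (81 / 100) (100^-1 / 2).
have oD' : open D' by apply: open_reg.
have r0 : 0 <= (100^-1 / 100 : R) by clear; lra.
have DD x u : D' x -> `|u| <= 100^-1 / 100 -> D (x + u).
  move=> [x1 x2] ur; split.
    rewrite (_ : x + u - q = (x - q) + u); last by modeq R E.
    by apply: le_lt_trans (ler_normD _ _) _; move: x1 ur; clear; lra.
  rewrite (_ : x + u - q - P q (x + u - q) = (x - q - P q (x - q)) + (u - P q u)); last first.
    by rewrite !(blinB (P q)) !(blinD (P q)); modeq R E.
  apply: le_lt_trans (ler_normD _ _) _; move: (sym_idem_leC PP u) x2 ur; clear; lra.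
pose t x := xget 0 [set u | `|u| <= 100^-1 / 100 /\ u = sfun P X0 q (x + u)].
have tP x : D' x -> `|t x| <= 100^-1 / 100 /\ t x = sfun P X0 q (x + t x).
  move=> Dx; have [u u1 u2] := perturb_fixpoint (@half01 R) sq r0 (fun u => DD x u Dx) sr.
  exact: (@xgetPex _ 0 [set u | `|u| <= 100^-1 / 100 /\ u = sfun P X0 q (x + u)]
    (ex_intro _ u (conj u1 u2))).
have tD x : D' x -> D (x + t x) by move=> Dx; apply: DD => //; case: (tP x Dx).
have tE x : D' x -> t x = sfun P X0 q (x + t x) by move=> Dx; case: (tP x Dx).
pose a z := q + P q (z - q).
have aD z : `|z - q| < 4 / 5 -> D' (a z).
  move=> zq; have aq : a z - q = P q (z - q) by rewrite /a; modeq R E.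
  split; first by rewrite aq; move: (sym_idem_le PP (z - q)) zq; clear; lra.
  by rewrite aq Pi subrr normr0; clear; lra.
have az z w : `|z - q| < 4 / 5 -> P q w = 0 -> P q (a z + w - q) = P q (z - q).
  move=> zq Pw; rewrite (_ : a z + w - q = P q (z - q) + w); last by rewrite /a; modeq R E.
  by rewrite blinD Pi Pw addr0.
exists (t \o a).
have hP z : `|z - q| < 4 / 5 -> P q (t (a z)) = 0.
  by move=> /aD Da; rewrite (tE _ Da) proj_sfun.
have tc k : cb k (invK 2^-1 (Ks k) k * (Ks k * d)) D' t.
  apply: (@cb_perturb R E (sfun P X0 q) t D D' 2^-1 (@half01 R) oD' sq tD tE sd sdq k) => //.
  by rewrite mulr_ge0//= ler_piMr.
split=> [z zq|z zq|z zq|z zq|k].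
- have Da := aD z zq; have zE : a z + ((z - q) - P q (z - q)) = z by rewrite /a; modeq R E.
  split=> [[[x Xx zx] dz]|hz].
    have Dz : D z.
      split; first by move: zq; clear; lra.
      case: (XP) => _ H1 _.
      have xq : `|x - q| < 1.
        rewrite (_ : x - q = (z - q) - (z - x)); last by modeq R E.
        by apply: le_lt_trans (ler_normB _ _) _; move: zq zx; clear; lra.
      have h1 := H1 q x Xq Xx xq.
      rewrite (_ : z - q - P q (z - q) = (x - q - P q (x - q)) + ((z - x) - P q (z - x))); last first.
        by rewrite !(blinB (P q)); modeq R E.
      apply: le_lt_trans (ler_normD _ _) _; move: (sym_idem_leC PP (z - x)) h1 zx d4; clear; lra.
    have /(defect_zero PP (np z Dz)) zs := dz.
    apply: (perturb_fixpoint_unique (@half01 R) sq (x := a z)).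
    + by rewrite zE.
    + exact: tD.
    + by rewrite zE.
    + exact: tE.
  have zt : a z + t (a z) = z by rewrite -[RHS]zE hz.
  have Dz : D z by rewrite -zt; apply: tD.
  split; last first.
    by apply/(defect_zero PP (np z Dz)); rewrite hz /= (tE _ Da) zt.
  case: (XP) => _ _ H2.
  have vz := sym_idem_le PP (z - q).
  have [x [Xx _ xd]] := H2 q (P q (z - q)) Xq (Pi _) ltac:(move: vz zq; clear; lra).
  exists x => //; rewrite (_ : z - x = t (a z) - (x - (q + P q (z - q)))); last first.
    by rewrite -{1}zt /a; modeq R E.
  apply: le_lt_trans (ler_normB _ _) _; have [tr _] := tP _ Da.
  by move: tr xd d4; clear; lra.
- rewrite /= /a; congr (t _); congr (_ + _).
  by rewrite (_ : q + P q (z - q) - q = P q (z - q)) ?Pi//; modeq R E.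
- exact: hP.
- have Da := aD z zq; have [tr tz] := tP _ Da; set w := t (a z) in tr tz *.
  have Pw : P q w = 0 by apply: hP.
  suff : `|w| <= 3 * d by [].
  pose y := a z + w.
  have Ly : (idb E - P q) (y - q) = w.
    have -> : (idb E - P q) (y - q) = (a z + w - q) - P q (a z + w - q) by [].
    by rewrite az// /a; modeq R E.
  have Dy : D y by apply: DD.
  have Ry : reg (P q) q (81 / 100) 100^-1 y.
    split.
      rewrite (_ : y - q = P q (z - q) + w); last by rewrite /y /a; modeq R E.
      apply: le_lt_trans (ler_normD _ _) _; move: (sym_idem_le PP (z - q)) tr zq; clear; lra.
    by case: Dy.
  have w0 : `|w| <= Ks 0%N * d by rewrite tz; apply: cb_norm (sc 0%N) Dy.
  have m0 := cb_norm (Hm E n d X P X0 q S Xq) Dy.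
  have o0 := cb_norm (Ho E n d X P X0 q S Xq np) Dy.
  have l0 := err_normal_le S Xq Ry.
  (* The term with [L m] contributes at most [2 d]. The others are products of two quantities of
     order [d], and the choice of [sg] makes them fit into the remaining [d]. *)
  suff : `|sfun P X0 q y| <= 3 * d by rewrite -tz.
  rewrite /sfun normrN normrZ ger0_norm// Ly.
  set L := idb E - P q in l0 *; set m := err_normal P X0 q y in l0 *.
  have {}m0 : `|m| <= Km * d by exact: m0.
  set o := err_op P X0 q y in o0 *.
  rewrite -addrA (blinD L) (blinZ L).
  have q1 : `|L (o w + o m)| <= 1 * ((Ko * d) * (Ks 0%N * d) + (Ko * d) * (Km * d)).
    apply: blin_le; first exact: sym_idem_normC.
    by apply: le_trans (ler_normD _ _) _; apply: lerD; apply: blin_le.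
  have q2 : `|2 *: L m| <= 2 * (2 * d) by rewrite normrZ ger0_norm// ler_wpM2l.
  have q3 := ler_normD (2 *: L m) (L (o w + o m)).
  have q4 : Ko * (Ks 0%N + Km) * d * d <= 100^-1 / 100 * d by rewrite ler_wpM2r.
  by move: q1 q2 q3 q4 d0; clear; lra.
- rewrite -mulrA; apply: (cb_comp (D := D')) => //.
  + exact: open_lt_norm (fun x => proj1 (isd_subr q x)).
  + rewrite !mulr_ge0//; first by rewrite (le_trans ler01)// invK_ge1.
  + by rewrite -[X in cb _ X]mulrA; apply: tc.
  case: k => // k; apply: (dcbI (f' := fun=> P q)).
  + exact: open_lt_norm (fun x => proj1 (isd_subr q x)).
  + move=> x _; rewrite -(add0r (P q)); apply: isdD; first exact: isd_cst.
    exact: isd_affine.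
  + apply: cb_cst; last exact: sym_idem_norm.
    exact: open_lt_norm (fun x => proj1 (isd_subr q x)).
Qed.

End LocalGraphs.

(** * The metric projection *)

Section LocalProjection.
Context {R : realType}.

Lemma ball_convex (E : normedModType R) (q x y : E) (a s : R) :
  `|x - q| < a -> `|y - q| < a -> 0 <= s <= 1 -> `|x + s *: (y - x) - q| < a.
Proof.
move=> xa ya /andP[s0 s1].
rewrite (_ : x + s *: (y - x) - q = (1 - s) *: (x - q) + s *: (y - q)); last by modeq R E.
apply: le_lt_trans (ler_normD _ _) _; rewrite !normrZ !ger0_norm ?subr_ge0//.
have [->|sn] := eqVneq s 0; first by rewrite subr0 mul1r mul0r addr0.
have sp : 0 < s by rewrite lt_neqAle eq_sym sn.
apply: (@lt_le_trans _ _ ((1 - s) * `|x - q| + s * a)); first by rewrite ltrD2l ltr_pM2l.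
by have : (1 - s) * `|x - q| <= (1 - s) * a; [rewrite ler_wpM2l ?subr_ge0// ltW|lra].
Qed.

Lemma lipschitz_ball (E : hilbertType R) (q x y : E) (a C : R) (f : E -> E) : 0 <= C ->
  (forall z, `|z - q| < a -> differentiable f z) ->
  (forall z, `|z - q| < a -> `|fdiff f z| <= C) ->
  `|x - q| < a -> `|y - q| < a -> `|f x - f y| <= C * `|x - y|.
Proof.
move=> C0 df fC xa ya; have c0 : 0 <= C * `|x - y| by rewrite mulr_ge0.
exact: (mean_value (U := [set z | `|z - q| < a]) c0
  (fun s s01 => ball_convex ya xa s01) df (fun z Dz => blin_le (fC z Dz) (lexx _))).
Qed.

(** The mean value inequality is used twice. It requires values in a Hilbert space, so the
    operator-valued [fdiff f] is evaluated at a fixed vector [v] first. *)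
Lemma taylor2 (E : hilbertType R) (q x y : E) (a C : R) (f : E -> E) :
  cb 2 C [set z | `|z - q| < a] f -> `|x - q| < a -> `|y - q| < a ->
  `|f y - f x - fdiff f x (y - x)| <= C * `|y - x| ^+ 2.
Proof.
move=> fC xa ya; set U := [set z | _] in fC.
have C0 : 0 <= C by exact: (@cb_ge0 _ _ _ _ _ U _ x xa fC).
have df z : U z -> differentiable f z by move=> Uz; case: (cb_isd fC Uz).
have [_ f1] := cb_dcb fC; have [df1 f2] := cb_dcb f1.
pose g z := f z - fdiff f x z.
have gd z : U z -> isd g z (fdiff f z - fdiff f x).
  by move=> Uz; apply: isdB; [apply/diff_isd/df|apply: isd_blin].
have -> : f y - f x - fdiff f x (y - x) = g y - g x.
  by rewrite /g blinB; modeq R E.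
have C1 : 0 <= C * `|y - x| ^+ 2 by rewrite mulr_ge0// exprn_ge0.
have key z v : U z -> `|z - x| <= `|y - x| -> `|(fdiff f z - fdiff f x) v| <= C * `|y - x| * `|v|.
  move=> Uz zy.
  pose l (w : E) := fdiff f w v.
  have ld w : U w -> isd l w (flipb1 (fdiff (fdiff f) w) v).
    move=> Uw; have -> : flipb1 (fdiff (fdiff f) w) v =
       dbil (idb (blin E E)) (fdiff f w) v (fdiff (fdiff f) w) 0.
      by apply: blinP => u; rewrite /dbil blinDE !compbbE !compbE blin0E blin0 add0r.
    exact: (@isd_bilin R E (blin E E) E E (idb (blin E E)) (fdiff f) (fun=> v) w _ _
      (diff_isd (df1 w Uw)) (isd_cst v w)).
  have b0 : 0 <= C * `|y - x| * `|v| by rewrite !mulr_ge0.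
  apply: (mean_value (f := l) (U := U) b0) => [s s01|w Uw|w Uw].
  - exact: ball_convex.
  - by case: (ld w Uw).
  - have [_ ->] := ld w Uw.
    rewrite [flipb1 _ _ _]/(fdiff (fdiff f) w (z - x) v).
    by apply: blin_le => //; apply: blin_le => //; exact: cb_norm f2 Uw.
have key2 z : U z -> `|z - x| <= `|y - x| -> `|fdiff g z (y - x)| <= C * `|y - x| ^+ 2.
  move=> Uz zy; have [_ ->] := gd z Uz; rewrite expr2 mulrA; exact: key.
pose U' := U `&` [set z | `|z - x| <= `|y - x|].
apply: (mean_value (f := g) (U := U') C1) => [s s01|z [Uz _]|z [Uz zy]].
- split; first exact: ball_convex.
  rewrite /= (_ : x + s *: (y - x) - x = s *: (y - x)); last by modeq R E.
  rewrite normrZ ger0_norm; last by case/andP: s01.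
  by rewrite ler_piMl//; case/andP: s01.
- by case: (gd z Uz).
- exact: key2.
Qed.

(** Normal coordinates: the vectors [b - ad D b], with [b] normal to the flat and [D] the
    differential of [h], are normal to the graph. Hence [x = q + a + h + (b - ad D b)] expresses [x]
    by a foot point over [a] and a normal vector at it. This map from [xi = q + a + b] to [x] is a
    small perturbation of the identity; its inverse yields the foot point [p x]. *)
Lemma ex_local_proj (c : nat -> R) : (forall k, 0 <= c k) ->
  exists (sigma : R) (K : nat -> R), [/\ 0 < sigma, forall k, 0 <= K k &
  forall (E : hilbertType R) n d (M : set E) (Q : blin E E) (q : E) (h : E -> E),
    rank_proj n Q -> 0 <= d <= sigma -> local_graph c d M Q q h ->
    exists p : E -> E,
      (forall k, cb k (K k * d) [set x | `|x - q| < 3 / 8] (fun x => p x - (q + Q (x - q)))) /\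
      (forall x, `|x - q| < 3 / 8 -> M (p x) /\
         forall y, M y -> `|x - y| <= `|x - p x| -> y = p x)].
Proof.
move=> c0; pose Ks k := c k + 2 ^+ k * c k.+1.
have Ks0 k : 0 <= Ks k by rewrite addr_ge0// mulr_ge0// exprn_ge0.
pose S0 := 1 + Ks 0%N + Ks 1%N + c 0%N + c 1%N + c 2%N.
have S01 : 1 <= S0.
  by rewrite /S0; have := Ks0 0%N; have := Ks0 1%N; have := c0 0%N; have := c0 1%N;
    have := c0 2%N; lra.
have S00 : 0 < S0 by apply: lt_le_trans S01.
pose sg := 100^-1 / 100 / S0.
have sg0 : 0 < sg by rewrite divr_gt0//; lra.
pose Kt k := invK 2^-1 (Ks k) k * Ks k.
have Kt0 k : 0 <= Kt k by rewrite mulr_ge0// (le_trans ler01)// invK_ge1.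
pose Kh k := compK (1 + Kt k) k * c k.
have Kh0 k : 0 <= Kh k by rewrite mulr_ge0// (le_trans ler01)// compK_ge1.
exists sg, (fun k => Kt k + Kh k); split=> // [k|]; first by rewrite addr_ge0.
move=> E n d M Q q h rQ /andP[d0 dsg] [gM hP Qh h3 hc].
have dK K : 0 <= K -> K <= S0 -> K * d <= 100^-1 / 100.
  move=> K0 KS; apply: (@le_trans _ _ (K * sg)); first by rewrite ler_wpM2l.
  by rewrite /sg mulrA ler_pdivrMr// mulrC ler_wpM2l//; lra.
have d4 : d <= 100^-1 / 100 by rewrite -[leLHS]mul1r dK.
have d1 : d <= 1 by lra.
have Ks0d : Ks 0%N * d <= 100^-1 / 100.
  by apply: dK => //; rewrite /S0; have := Ks0 1%N; have := c0 0%N; have := c0 1%N; have := c0 2%N; lra.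
have Ks1d : Ks 1%N * d <= 100^-1 / 100.
  by apply: dK => //; rewrite /S0; have := Ks0 0%N; have := c0 0%N; have := c0 1%N; have := c0 2%N; lra.
have c1d : c 1%N * d <= 100^-1 / 100.
  by apply: dK => //; rewrite /S0; have := Ks0 0%N; have := Ks0 1%N; have := c0 0%N; have := c0 2%N; lra.
have c2d : c 2%N * d <= 100^-1 / 100.
  by apply: dK => //; rewrite /S0; have := Ks0 0%N; have := Ks0 1%N; have := c0 0%N; have := c0 1%N; lra.
have QQ := rank_proj_sym_idem rQ; have [_ Qi] := QQ.
have [ad [ad1 adP]] := ex_adjoint rQ.
pose L := idb E - Q.
(* [xi - s xi] is the point with normal coordinates [Q (xi - q)] and [L (xi - q)]. *)
pose s x := - (h x - idb (blin E E) (ad (fdiff h x)) (L (x - q))).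
set U := [set z | `|z - q| < 4 / 5] in hc.
have oball a : open [set z : E | `|z - q| < a].
  by apply: open_lt_norm => x; case: (isd_subr q x).
have oU : open U by apply: oball.
have hd k : cb k (c k.+1 * d) U (fdiff h) by have [] := cb_dcb (hc k.+1).
have sc k : cb k (Ks k * d) U s.
  have ckd : 0 <= c k.+1 * d by rewrite mulr_ge0.
  have -> : Ks k * d = c k * d + 1 * (2 ^+ k * ((1 * (c k.+1 * d)) * 1)) by rewrite /Ks; ring.
  have nn : 0 <= 1 * (2 ^+ k * ((1 * (c k.+1 * d)) * 1)).
    by rewrite !mulr1 !mul1r mulr_ge0// exprn_ge0.
  apply: cbN => //; first by rewrite addr_ge0// mulr_ge0.
  apply: cbB => //.
  have Lc : cb k 1 U (fun z => L (z - q)).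
    apply: (@cb_affine _ _ _ _ _ _ _ L oU) => [z zq|z _|].
    - by apply: le_trans (sym_idem_leC QQ _) _; move: zq; rewrite /U /=; lra.
    - exact: isd_affine.
    - exact: sym_idem_normC.
  have adc : cb k (1 * (c k.+1 * d)) U (fun z => ad (fdiff h z)).
    by apply: cb_blinl => //; apply: hd.
  have ckd1 : 0 <= 1 * (c k.+1 * d) by rewrite mul1r.
  exact: (@cb_bil R k E (blin E E) E E (idb (blin E E)) 1 _ _ U _ _ oU ckd1 ler01 (norm_idb _) adc Lc).
have sd z : U z -> differentiable s z by move=> Uz; case: (cb_isd (sc 1%N) Uz).
have sdq z : U z -> `|fdiff s z| <= 2^-1.
  move=> Uz; have [_ H] := cb_dcb (sc 1%N); have H1 := cb_norm H Uz.
  by apply: le_trans H1 _; lra.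
have h0 : 0 <= 2^-1 :> R by [].
have sq x y : U x -> U y -> `|s x - s y| <= 2^-1 * `|x - y|.
  by move=> Ux Uy; apply: (lipschitz_ball h0 sd sdq).
have sr z : U z -> `|s z| <= 100^-1 / 100.
  by move=> Uz; apply: le_trans (cb_norm (sc 0%N) Uz) Ks0d.
have r0 : 0 <= (100^-1 / 100 : R) by lra.
pose U' := [set z | `|z - q| < 3 / 8].
have DD x u : U' x -> `|u| <= 100^-1 / 100 -> U (x + u).
  rewrite /U' /U /= => xq ur.
  rewrite (_ : x + u - q = (x - q) + u); last by modeq R E.
  by apply: le_lt_trans (ler_normD _ _) _; lra.
pose t x := xget 0 [set u | `|u| <= 100^-1 / 100 /\ u = s (x + u)].
have tP x : U' x -> `|t x| <= 100^-1 / 100 /\ t x = s (x + t x).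
  move=> Ux; have [u u1 u2] := perturb_fixpoint (@half01 R) sq r0 (fun u => DD x u Ux) sr.
  exact: (@xgetPex _ 0 [set u | `|u| <= 100^-1 / 100 /\ u = s (x + u)]
    (ex_intro _ u (conj u1 u2))).
have tD x : U' x -> U (x + t x) by move=> Ux; apply: DD => //; case: (tP x Ux).
have tE x : U' x -> t x = s (x + t x) by move=> Ux; case: (tP x Ux).
have oU' : open U' by apply: oball.
have tc k : cb k (Kt k * d) U' t.
  rewrite /Kt -mulrA.
  apply: (@cb_perturb R E s t U U' 2^-1 (@half01 R) oU' sq tD tE sd sdq k) => //.
  by rewrite mulr_ge0//= ler_piMr.
pose p x := q + Q (x - q) + (Q (t x) + h (x + t x)).
exists p; split=> [k|x xq].
  apply: (@cb_eq _ _ _ _ _ _ (fun x => Q (t x) + h (x + t x))) => // [x _|].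
    by rewrite /p [RHS]addrC addKr.
  rewrite mulrDl; apply: cbD => //.
    rewrite -(mul1r (Kt k * d)); apply: cb_blinl => //; first by rewrite mulr_ge0.
    exact: sym_idem_norm.
  rewrite /Kh -mulrA; apply: (cb_comp (D := U)) => //; first by rewrite mulr_ge0.
  case: k => // k; have [df H] := dcb_addid oU' (tc k.+1); split=> //.
  by apply: cb_mono H; rewrite lerD2l ler_piMr.
have xq' : `|x - q| < 3 / 8 by [].
have Uxi := tD x xq; set xi := x + t x in Uxi *.
pose a := Q (xi - q); pose b := L (xi - q); pose D := fdiff h xi.
have tx : t x = - (h xi - ad D b) by rewrite {1}tE.
have t4 : `|t x| <= 100^-1 / 100 by case: (tP x xq).
have pE : p x = q + a + h xi.
  by rewrite /p /a /xi (_ : x + t x - q = (x - q) + t x) ?(blinD Q); modeq R E.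
have xpE : x - p x = b - ad D b.
  have -> : x - p x = xi - t x - p x by rewrite /xi; modeq R E.
  rewrite tx pE /b /L /a.
  have -> : (idb E - Q) (xi - q) = (xi - q) - Q (xi - q) by [].
  by modeq R E.
have D1 : `|D| <= c 1%N * d by have [_ H] := cb_dcb (hc 1%N); exact: cb_norm H Uxi.
have xiq : `|xi - q| <= `|x - q| + 100^-1 / 100.
  rewrite /xi (_ : x + t x - q = (x - q) + t x); last by modeq R E.
  by apply: le_trans (ler_normD _ _) _; lra.
have aq : `|a| <= `|xi - q| by apply: sym_idem_le.
have bq : `|b| <= `|xi - q| by apply: sym_idem_leC.
have adb : `|ad D b| <= (1 * (100^-1 / 100)) * `|b|.
  by apply: blin_le => //; apply: blin_le => //; apply: le_trans D1 _.
have hxi : `|h xi| <= 3 * d by apply: h3.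
have hxia : h xi = h (q + a) by rewrite hP.
have Qa : Q a = a by rewrite /a Qi.
have Uqa : `|q + a - q| < 4 / 5.
  rewrite (_ : q + a - q = a); last by modeq R E.
  by move: aq xiq xq'; clear; lra.
have Up : `|p x - q| < 4 / 5.
  rewrite pE (_ : q + a + h xi - q = a + h xi); last by modeq R E.
  by apply: le_lt_trans (ler_normD _ _) _; move: aq xiq xq' hxi d4; clear; lra.
have Qp : Q (p x - q) = a.
  rewrite pE (_ : q + a + h xi - q = a + h xi); last by modeq R E.
  by rewrite (blinD Q) Qh// Qa addr0.
have Mp : M (p x).
  apply/(gM _ Up); rewrite (hP _ Up) Qp -hxia pE.
  by modeq R E.
split=> // y My yp.
(* A competitor [y] is then within [3 / 8 + 376 / 1000 < 4 / 5] of [q], so it lies on the same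
   graph. *)
have xp : `|x - p x| <= 376 / 1000.
  by rewrite xpE; apply: le_trans (ler_normB _ _) _; move: adb bq xiq xq'; clear; lra.
have Uy : `|y - q| < 4 / 5.
  rewrite (_ : y - q = (x - q) - (x - y)); last by modeq R E.
  by apply: le_lt_trans (ler_normB _ _) _; move: xq' xp yp; clear; lra.
have := (gM _ Uy).1 My; rewrite (hP _ Uy); set a' := Q (y - q) => yE.
have Qa' : Q a' = a' by rewrite /a' Qi.
have a'q : `|a'| <= `|y - q| by apply: sym_idem_le.
have Uqa' : `|q + a' - q| < 4 / 5.
  rewrite (_ : q + a' - q = a'); last by modeq R E.
  by move: a'q Uy; clear; lra.
(* As [h] depends only on the projection to the flat, its differential at [xi] can be traded for
   that at [q + a], the base point of the Taylor expansion. *)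
have DE : D = compb (fdiff h (q + a)) Q.
  have [//|_] := isd_eq_on oU Uxi (fun z zU => esym (hP z zU)) (L := compb (fdiff h (q + a)) Q).
    have := isdD (isd_cst q xi) (isd_affine Q q xi); rewrite add0r => H.
    by apply: (isd_comp H); apply: (cb_isd (hc 1%N)).
  exact.
pose e := h (q + a') - h (q + a) - D (a' - a).
have e_le : `|e| <= c 2%N * d * `|a' - a| ^+ 2.
  rewrite /e; have -> : D (a' - a) = fdiff h (q + a) ((q + a') - (q + a)).
    rewrite DE compbE (blinB Q) Qa Qa'; congr (_ _); by modeq R E.
  apply: le_trans (taylor2 (hc 2%N) Uqa Uqa') _.
  by rewrite (_ : q + a' - (q + a) = a' - a)//; modeq R E.
have Qb : Q b = 0.
  have -> : b = (xi - q) - Q (xi - q) by [].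
  by rewrite (blinB Q) Qi subrr.
have bQ v : inner b (Q v) = 0 by case: QQ => Qs _; rewrite -Qs Qb inner0l.
have yp2 : y - p x = (a' - a) + (h (q + a') - h (q + a)).
  have -> : y - p x = (y - q - a' + a') - (p x - q) by modeq R E.
  rewrite yE -hxia pE; by modeq R E.
have Qyp : Q (y - p x) = a' - a.
  have -> : y - p x = (y - q) - (p x - q) by modeq R E.
  by rewrite blinB Qp.
(* [x - p x] is orthogonal to the tangent directions of the graph at [p x], which leaves only the
   second order remainder [e]. Its product with [b] is at most [|y - p x| ^ 2 / 10000], too little
   for [y] to be as near to [x] as [p x] unless [y = p x]. *)
have ip : inner (x - p x) (y - p x) = inner b e.
  have ba : inner b (a' - a) = 0.
    by have <- : Q (a' - a) = a' - a; [rewrite (blinB Q) Qa Qa'|exact: bQ].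
  rewrite xpE innerBl adP Qyp yp2 innerDr ba add0r -innerBr.
  by [].
have ipe : inner b e <= 1 * ((100^-1 / 100) * `|y - p x| ^+ 2).
  apply: le_trans (inner_le' _ _) _; apply: ler_pM => //.
    by move: bq xiq xq'; clear; lra.
  apply: le_trans e_le _; apply: ler_pM => //; rewrite ?mulr_ge0 ?exprn_ge0//.
  by rewrite -Qyp; apply: lerXn2r; rewrite ?nnegrE// sym_idem_le.
have : `|x - y| ^+ 2 = `|x - p x| ^+ 2 - 2 * inner (x - p x) (y - p x) + `|y - p x| ^+ 2.
  by rewrite -normBsq (_ : x - p x - (y - p x) = x - y)//; modeq R E.
rewrite ip => E2.
have : `|x - y| ^+ 2 <= `|x - p x| ^+ 2 by apply: lerXn2r; rewrite ?nnegrE.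
rewrite E2 => E3.
have : `|y - p x| ^+ 2 <= 0.
  by move: (exprn_ge0 2 (normr_ge0 (y - p x))) E3 ipe; clear; lra.
rewrite exprn_even_le0//= normr_eq0 subr_eq0 => /eqP //.
Qed.

End LocalProjection.

(** * From local graphs to a closed submanifold with projection *)

Section Core.
Context {R : realType}.

Lemma open_sub_lt (V W : normedModType R) (A : set V) (f : V -> W) (r : R) :
  open A -> (forall z, A z -> differentiable f z) -> open [set z | A z /\ `|f z| < r].
Proof.
move=> oA df; rewrite openE => z [Az fz].
have [d1 d10 d1P] := open_ball oA Az.
have [d2 d20 d2P] := isd_cont (diff_isd (df z Az)) (ltac:(by rewrite subr_gt0) : 0 < r - `|f z|).
apply/nbhs_normP; exists (Num.min d1 d2); first by rewrite /= lt_min d10.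
move=> y; rewrite /= distrC lt_min => /andP[y1 y2]; split; first exact: d1P.
have := d2P _ y2; rewrite (_ : z + (y - z) = y); last by modeq R V.
move=> H; rewrite (_ : f y = f z + (f y - f z)); last by modeq R W.
by apply: le_lt_trans (ler_normD _ _) _; lra.
Qed.

Lemma rank_proj_subspace (E : hilbertType R) n (Q : blin E E) :
  rank_proj n Q -> lin_subspace n [set v | Q v = v].
Proof.
move=> rQ; have [_ Qi] := rank_proj_sym_idem rQ; case: rQ => e oe QE.
exists e.
  move=> c c0 i; have := inner_sume c i oe; rewrite c0 inner0l => <- //.
apply/seteqP; split=> [v /= Qv|_ [c _ <-]] /=.
  by exists (fun i => inner (e i) v) => //; rewrite -QE.
by rewrite QE; apply: eq_bigr => i _; rewrite innerC inner_sume.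
Qed.

(** The chart is the shear [z |-> z - q - h z]. Its inverse adds [h] again, because [h] ignores
    displacements normal to the flat and takes normal values. *)
Lemma local_graph_submanifold (E : hilbertType R) n c d (M : set E) (Q : blin E E)
    (q : E) (h : E -> E) (x : E) :
  rank_proj n Q -> 0 <= d <= 100^-1 -> (forall k, 0 <= c k) ->
  local_graph c d M Q q h -> `|x - q| < 100^-1 -> M x ->
  exists (U W V : set E) (phi psi : E -> E),
    [/\ [/\ open U, open W & U x],
        smooth_on U phi, smooth_on W psi,
        (forall y, U y -> W (phi y) /\ psi (phi y) = y) /\
        (forall z, W z -> U (psi z) /\ phi (psi z) = z) &
        lin_subspace n V /\ phi @` (M `&` U) = V `&` W].
Proof.
move=> rQ /andP[d0 d1] c0 [gM hP Qh h3 hc] xq Mx.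
have QQ := rank_proj_sym_idem rQ; have [_ Qi] := QQ.
have oball (a : R) : open [set z : E | `|z - q| < a].
  by apply: open_lt_norm => z; case: (isd_subr q z).
pose phi z := (z - q) - h z.
pose psi w := q + (w + h (q + w)).
set A := [set z : E | `|z - q| < 3 / 5].
have A45 z : A z -> `|z - q| < 4 / 5 by rewrite /A /=; lra.
pose U := [set z | A z /\ `|phi z| < 2^-1].
pose W := [set w : E | `|w| < 2^-1].
have phic k : cb k (1 + c k * d) A phi.
  apply: cbB; [exact: oball|by rewrite mulr_ge0| |].
    by apply: cb_subr => //; [exact: oball|rewrite /A /= => z; lra].
  by apply: cb_sub (hc k) => z /A45.
have phid z : A z -> differentiable phi z by move=> Az; case: (cb_isd (phic 1%N) Az).
have hpsi w : W w -> h (psi w) = h (q + w).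
  rewrite /W /= => w2.
  have qw : `|q + w - q| < 4 / 5 by rewrite (_ : q + w - q = w); [lra|modeq R E].
  have hqw := h3 _ qw.
  have pw : `|psi w - q| < 4 / 5.
    rewrite (_ : psi w - q = w + h (q + w)); last by rewrite /psi; modeq R E.
    by apply: le_lt_trans (ler_normD _ _) _; lra.
  rewrite (hP _ pw) (hP _ qw); congr (h (q + _)).
  rewrite (_ : psi w - q = (q + w - q) + h (q + w)); last by rewrite /psi; modeq R E.
  by rewrite (blinD Q) Qh// addr0.
have psiU w : W w -> U (psi w).
  move=> Ww; have w2 : `|w| < 2^-1 by [].
  have qw : `|q + w - q| < 4 / 5 by rewrite (_ : q + w - q = w); [lra|modeq R E].
  have hqw := h3 _ qw; split.
    rewrite /A /= (_ : psi w - q = w + h (q + w)); last by rewrite /psi; modeq R E.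
    by apply: le_lt_trans (ler_normD _ _) _; lra.
  rewrite /phi hpsi// (_ : psi w - q - h (q + w) = w)//; by rewrite /psi; modeq R E.
exists U, W, [set v | Q v = v], phi, psi; split.
- split; [by apply: open_sub_lt => //; apply: oball|exact: open_normlt|].
  split; first by rewrite /A /=; lra.
  have hx : `|h x| <= 3 * d by apply: h3; lra.
  by apply: le_lt_trans (ler_normB _ _) _; lra.
- apply: smooth_onP => k; exists (1 + c k * d).
  by apply: cb_sub (phic k) => z [].
- apply: smooth_onP => k.
  have oW : open W by apply: open_normlt.
  exists (`|q| + (1 + compK 1 k * (c k * d))).
  apply: cbD => //; first exact: cb_cst.
  apply: cbD => //.
    apply: (@cb_affine _ k E E 1 W _ (idb E)) => // [w|w _|].
    - rewrite /W /=; lra.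
    - exact: isd_id.
    - exact: norm_idb.
  apply: (cb_comp (D := [set z | `|z - q| < 4 / 5])) => //; first by rewrite mulr_ge0.
    move=> w; rewrite /W /= => w2.
    have -> : q + w - q = w by modeq R E.
    by apply: lt_trans w2 _; lra.
  case: k => // k; apply: (dcbI (f' := fun=> idb E)) => // [w _|].
    by rewrite -(add0r (idb E)); apply: isdD (isd_cst q w) (isd_id w).
  by apply: cb_cst => //; apply: norm_idb.
- split=> [z [Az phiz]|w Ww].
    split=> //; have z45 := A45 z Az; have hz := h3 _ z45.
    rewrite /psi (_ : q + phi z = z - h z); last by rewrite /phi; modeq R E.
    have zh : `|z - h z - q| < 4 / 5.
      rewrite (_ : z - h z - q = (z - q) - h z); last by modeq R E.
      apply: le_lt_trans (ler_normB _ _) _; move: Az; rewrite /A /=; lra.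
    have -> : h (z - h z) = h z.
      rewrite (hP _ zh) [RHS](hP _ z45); congr (h (q + _)).
      rewrite (_ : z - h z - q = (z - q) - h z); last by modeq R E.
      by rewrite (blinB Q) Qh// subr0.
    by rewrite /phi; modeq R E.
  split; first exact: psiU.
  by rewrite /phi hpsi// /psi; modeq R E.
- split; first exact: rank_proj_subspace.
  apply/seteqP; split=> [_ [z [Mz [Az phiz]] <-]|v [/= Qv Wv]].
    split=> //=; have z45 := A45 z Az.
    have := (gM _ z45).1 Mz; rewrite /phi => <-.
    by rewrite (_ : z - q - (z - q - Q (z - q)) = Q (z - q)) ?Qi//; modeq R E.
  have v2 : `|v| < 2^-1 by [].
  have qv : `|q + v - q| < 4 / 5 by rewrite (_ : q + v - q = v); [lra|modeq R E].
  exists (psi v); last by rewrite /phi hpsi// /psi; modeq R E.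
  split; last exact: psiU.
  have [Ap _] := psiU v Wv; apply/(gM _ (A45 _ Ap)); rewrite hpsi//.
  rewrite (_ : psi v - q = v + h (q + v)); last by rewrite /psi; modeq R E.
  by rewrite (blinD Q) Qh// Qv; modeq R E.
Qed.

(** All the graph balls have the same radius and [M] lies near [X]; a limit point of [M] is
    therefore inside some graph ball, where [M] is the zero set of a continuous function. *)
Lemma local_graph_closed (E : hilbertType R) c d (X M : set E) (P : E -> blin E E) :
  (forall z, M z -> exists2 x, X x & `|z - x| < 100^-1 / 4) ->
  (forall q, X q -> exists h, local_graph c d M (P q) q h) -> closed M.
Proof.
move=> MX gr x clx.
have near (e : R) : 0 < e -> exists2 y, M y & `|y - x| < e.
  move=> e0; have [y [My xy]] : M `&` ball x e !=set0 by apply: clx; apply: nbhsx_ballx.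
  by exists y => //; move: xy; rewrite -ball_normE /= distrC.
have [y My yx] := near 100^-1 ltac:(by []).
have [q Xq yq] := MX y My; have [h [gM _ _ _ hc]] := gr q Xq.
have xq : `|x - q| < 4 / 5.
  rewrite (_ : x - q = (y - q) - (y - x)); last by modeq R E.
  by apply: le_lt_trans (ler_normB _ _) _; lra.
apply/(gM _ xq)/subr0_eq/eqP; apply: contraT => fx.
pose f z := z - q - P q (z - q) - h z.
have df : differentiable f x.
  have := isdB (isdB (isd_subr q x) (isd_affine (P q) q x)) (cb_isd (hc 1%N) xq).
  by case.
have [d1 d10 d1P] := isd_cont (diff_isd df) (ltac:(by rewrite normr_gt0) : 0 < `|f x|).
pose e := Num.min d1 (4 / 5 - `|x - q|).
have e0 : 0 < e by rewrite lt_min d10 subr_gt0.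
have [z Mz] := near e e0; rewrite lt_min => /andP[z1 z2].
have zq : `|z - q| < 4 / 5.
  rewrite (_ : z - q = (z - x) + (x - q)); last by modeq R E.
  by apply: le_lt_trans (ler_normD _ _) _; lra.
have fz : f z = 0 by rewrite /f ((gM _ zq).1 Mz) subrr.
have := d1P _ z1; rewrite (_ : x + (z - x) = z); last by modeq R E.
by rewrite fz sub0r normrN ltxx.
Qed.

Lemma nprojE (E : normedModType R) (M : set E) x y : nearest_point M x y ->
  (forall z, nearest_point M x z -> z = y) -> nproj M x = y.
Proof.
by move=> H U; apply: U; apply: (@xgetPex _ 0 (nearest_point M x)); exists y.
Qed.

Definition projection_bounds (E : hilbertType R) (K : nat -> R) (d r : R) (M : set E)
    (Q : blin E E) (q : E) :=
  [/\ forall x, `|x - q| < r -> nearest_point M x (nproj M x) /\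
        forall y, nearest_point M x y -> y = nproj M x,
      forall x, `|x - q| < r -> differentiable (nproj M) x &
      forall k, cb k (K k * d) [set x | `|x - q| < r] (fun x => fdiff (nproj M) x - Q)].

Lemma ex_core n : exists (sigma : R) (K : nat -> R), [/\ 0 < sigma, forall k, 0 <= K k &
  forall (E : hilbertType R) d X (P : E -> blin E E), flats n d X P -> 0 <= d <= sigma ->
  exists M : set E,
    [/\ forall x, X x -> exists2 y, M y & `|x - y| <= 3 * d,
        forall y, M y -> exists2 x, X x & `|y - x| <= 4 * d,
        closed M, submanifold n M &
        forall q, X q -> projection_bounds K d (3 / 8) M (P q) q]].
Proof.
have [s1 [c [s10 c0 H1]]] := @ex_local_graphs R n.
have [s2 [K [s20 K0 H2]]] := ex_local_proj c0.
(* The index is shifted by one since [K] bounds the projection itself, whereas [projection_bounds]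
   is about its differential. *)
exists (Num.min (100^-1 / 100) (Num.min s1 s2)), (fun k => K k.+1); split=> //.
  by rewrite !lt_min s10 s20 !andbT; lra.
move=> E d X P XP /andP[d0]; rewrite !le_min => /andP[d4 /andP[d1 d2]].
have [M [MX gr]] := H1 E d X P XP d1.
exists M; split.
- move=> q Xq; have [h [gM hP Qh h3 hc]] := gr q Xq.
  have q0 : `|q - q| < 4 / 5 by rewrite subrr normr0; lra.
  have hq := h3 q q0.
  have qh : `|q + h q - q| < 4 / 5.
    by rewrite (_ : q + h q - q = h q); [lra|modeq R E].
  exists (q + h q); last by rewrite (_ : q - (q + h q) = - h q) ?normrN//; modeq R E.
  apply/(gM _ qh); rewrite (hP _ qh).
  have -> : q + h q - q = h q by modeq R E.
  by rewrite Qh// subr0 addr0.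
- move=> y My; have [q Xq yq] := MX y My; have [h [gM hP Qh h3 hc]] := gr q Xq.
  have yq' : `|y - q| < 4 / 5 by lra.
  have hy := (gM _ yq').1 My; have h3y := h3 _ yq'.
  case: (XP) => _ _ HX2; have QQ := flats_sym_idem XP Xq; have [_ Qi] := QQ.
  have Qy := sym_idem_le QQ (y - q).
  have [x [Xx _ xd]] := HX2 q (P q (y - q)) Xq (Qi _) ltac:(lra).
  exists x => //.
  rewrite (_ : y - x = (y - q - P q (y - q)) - (x - (q + P q (y - q)))); last by modeq R E.
  by apply: le_trans (ler_normB _ _) _; rewrite hy; lra.
- exact: local_graph_closed MX gr.
- move=> x Mx; have [q Xq xq] := MX x Mx; have [h gh] := gr q Xq.
  have rP : rank_proj n (P q) by case: XP => H _ _; apply: H.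
  apply: (local_graph_submanifold rP _ c0 gh) => //; last by lra.
  by rewrite d0; lra.
move=> q Xq; have [h gh] := gr q Xq.
have rP : rank_proj n (P q) by case: XP => H _ _; apply: H.
have d02 : 0 <= d <= s2 by rewrite d0.
have [p [pc pM]] := H2 E n d M (P q) q h rP d02 gh.
set U := [set x | `|x - q| < 3 / 8] in pc.
have oU : open U by apply: open_lt_norm => z; case: (isd_subr q z).
have near x : U x -> nearest_point M x (p x) /\ forall y, nearest_point M x y -> y = p x.
  move=> Ux; have [Mp pu] := pM x Ux; split.
    split=> // z Mz; rewrite leNgt; apply/negP => zp.
    by have := pu z Mz (ltW zp) => zE; move: zp; rewrite zE ltxx.
  by move=> y [My yn]; apply: pu => //; apply: yn.
have npE x : U x -> nproj M x = p x.
  by move=> Ux; have [a b] := near x Ux; apply: nprojE.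
pose g x := p x - (q + P q (x - q)).
have pd x : U x -> isd (nproj M) x (fdiff g x + P q).
  move=> Ux; apply: (isd_eq_on oU Ux (f := fun y => g y + (q + P q (y - q)))).
    by move=> y Uy; rewrite npE// /g subrK.
  apply: isdD; first exact: cb_isd (pc 1%N) Ux.
  by have := isdD (isd_cst q x) (isd_affine (P q) q x); rewrite add0r.
split=> [x Ux|x Ux|k].
- by rewrite npE//; apply: near.
- by case: (pd x Ux).
have [_ H] := cb_dcb (pc k.+1).
by apply: cb_eq oU _ H => x Ux; have [_ ->] := pd x Ux; rewrite addrK.
Qed.

End Core.

(** * Scaling from 1 to r *)

Section Scaling.
Context {R : realType}.
Variables (r : R) (r0 : 0 < r).

Local Lemma rn0 : r != 0. Proof. by rewrite gt_eqF. Qed.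

Lemma scaleVK (E : lmodType R) (x : E) : r *: (r^-1 *: x) = x.
Proof. by rewrite scalerA mulfV ?scale1r// rn0. Qed.

Lemma scaleKV (E : lmodType R) (x : E) : r^-1 *: (r *: x) = x.
Proof. by rewrite scalerA mulVf ?scale1r// rn0. Qed.

Lemma norm_scaleV (E : normedModType R) (x : E) : `|r^-1 *: x| = `|x| / r.
Proof. by rewrite normrZ ger0_norm 1?mulrC// invr_ge0 ltW. Qed.

Lemma isd_scaled (V W : normedModType R) (a : R) (f : V -> W) (x : V) L :
  isd f (r^-1 *: x) L -> isd (fun y => a *: f (r^-1 *: y)) x ((a * r^-1) *: L).
Proof.
move=> fL; have := isdZ a (isd_comp (isdZ r^-1 (isd_id x)) fL).
rewrite (_ : a *: compb L (r^-1 *: idb V) = (a * r^-1) *: L)//.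
apply: blinP => v; rewrite !blinZE -[compb L _ v]/(L (r^-1 *: v)).
by rewrite blinZ scalerA.
Qed.

Lemma open_scaled (V : normedModType R) (U : set V) :
  open U -> open [set x | U (r^-1 *: x)].
Proof.
move=> oU; apply: open_comp oU => x _.
by apply: differentiable_continuous; case: (isdZ r^-1 (isd_id x)).
Qed.

(** The formula for order [k] is proved on the whole open set before passing to the next order,
    since it has to be differentiated. *)
Lemma fdiffn_scaled (V W : normedModType R) (a : R) (f : V -> W) (U : set V) : open U ->
  smooth_on U f -> forall k x, U (r^-1 *: x) ->
  fdiffn k (fun y => a *: f (r^-1 *: y)) x = (a * r^-1 ^+ k) *: fdiffn k f (r^-1 *: x) /\
  differentiable (fdiffn k (fun y => a *: f (r^-1 *: y))) x.
Proof.
move=> oU sf; have oU' := open_scaled oU.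
have step k : (forall x, U (r^-1 *: x) ->
    fdiffn k (fun y => a *: f (r^-1 *: y)) x = (a * r^-1 ^+ k) *: fdiffn k f (r^-1 *: x)) ->
  forall x, U (r^-1 *: x) ->
    isd (fdiffn k (fun y => a *: f (r^-1 *: y))) x
      ((a * r^-1 ^+ k.+1) *: (fdiffn k.+1 f (r^-1 *: x) : blin _ _)).
  move=> IH x Ux; rewrite exprSr mulrA.
  apply: (isd_eq_on oU' Ux (f := fun y => (a * r^-1 ^+ k) *: fdiffn k f (r^-1 *: y))).
    by move=> y Uy; rewrite IH.
  by apply: isd_scaled; apply: diff_isd; apply: sf.
have eqn k x : U (r^-1 *: x) ->
    fdiffn k (fun y => a *: f (r^-1 *: y)) x = (a * r^-1 ^+ k) *: fdiffn k f (r^-1 *: x).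
  elim: k x => [|k IH] x Ux; first by rewrite expr0 mulr1.
  by have [_] := step k IH x Ux.
move=> k x Ux; split; first exact: eqn.
by have [] := step k (eqn k) x Ux.
Qed.

Lemma smooth_on_scaled (V W : normedModType R) (a : R) (f : V -> W) (U : set V) : open U ->
  smooth_on U f -> smooth_on [set x | U (r^-1 *: x)] (fun y => a *: f (r^-1 *: y)).
Proof. by move=> oU sf k x Ux; have [_] := fdiffn_scaled a oU sf k Ux. Qed.

Lemma smooth_onZ (V W : normedModType R) (a : R) (f : V -> W) (U : set V) : open U ->
  smooth_on U f -> smooth_on U (fun y => a *: f y).
Proof.
move=> oU sf.
have step k : (forall x, U x -> fdiffn k (fun y => a *: f y) x = a *: fdiffn k f x) ->
  forall x, U x -> isd (fdiffn k (fun y => a *: f y)) x (a *: (fdiffn k.+1 f x : blin _ _)).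
  move=> IH x Ux; apply: (isd_eq_on oU Ux (f := fun y => a *: fdiffn k f y)).
    by move=> y Uy; rewrite IH.
  by apply: isdZ; apply: diff_isd; apply: sf.
have eqn k x : U x -> fdiffn k (fun y => a *: f y) x = a *: fdiffn k f x.
  elim: k x => [|k IH] x Ux //.
  by have [_] := step k IH x Ux.
by move=> k x Ux; have [] := step k (eqn k) x Ux.
Qed.

Lemma submanifold_scaled (E : normedModType R) n (M : set E) :
  submanifold n M -> submanifold n [set x | M (r^-1 *: x)].
Proof.
move=> sM x /= /sM[U [W [V [phi [psi [[oU oW Ux] sphi spsi [UW WU] [lV imV]]]]]]].
exists [set x | U (r^-1 *: x)], W, V, (fun y => phi (r^-1 *: y)), (fun w => r *: psi w).
split.
- by split=> //; apply: open_scaled.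
- suff <- : (fun y => 1 *: phi (r^-1 *: y)) = (fun y => phi (r^-1 *: y)).
    exact: smooth_on_scaled.
  by apply/funext => y; rewrite scale1r.
- exact: smooth_onZ.
- split=> [y Uy|w Ww]; have := UW (r^-1 *: _); have := WU.
    by move=> _ /(_ y Uy) [? ->]; rewrite scaleVK.
  by move=> /(_ w Ww) [? ?] _; rewrite /= scaleKV.
split=> //; rewrite -imV; apply/seteqP; split=> [_ [y [My Uy] <-]|_ [y [My Uy] <-]].
  by exists (r^-1 *: y).
by exists (r *: y); rewrite /= ?scaleKV.
Qed.

Lemma nearest_point_scaled (E : normedModType R) (M : set E) x y :
  nearest_point [set x | M (r^-1 *: x)] x y <-> nearest_point M (r^-1 *: x) (r^-1 *: y).
Proof.
have dist u v : `|r^-1 *: u - r^-1 *: v| = `|u - v| / r by rewrite -scalerBr norm_scaleV.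
split=> -[My yn]; split=> // z Mz.
  have := yn (r *: z); rewrite /= scaleKV => /(_ Mz) H.
  by rewrite -(scaleKV z) !dist ler_pM2r ?invr_gt0.
by have := yn _ Mz; rewrite !dist ler_pM2r ?invr_gt0.
Qed.

(** A form of smoothness, with a bound for each order, to which the composition estimate applies
    directly; it implies [smooth_on]. *)
Definition smooth_cb (V W : normedModType R) (U : set V) (f : V -> W) :=
  forall k, exists c, cb k c U f.

Lemma smooth_cb_comp (U V W : normedModType R) (A : set U) (D : set V) (g : V -> W) (f : U -> V)
    (L : blin U V) :
  open A -> (forall x, A x -> D (f x)) -> smooth_cb D g -> (forall x, A x -> isd f x L) ->
  smooth_cb A (fun x => g (f x)).
Proof.
move=> oA AD sg fL k; have [c gc] := sg k.
exists (compK `|L| k * `|c|).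
apply: (cb_comp (D := D)) => //.
  exact: cb_mono (ler_norm c) gc.
by case: k gc => // k _; apply: (dcbI (f' := fun=> L)) => //; apply: cb_cst.
Qed.

Lemma smooth_cbZ (V W : normedModType R) (U : set V) a (f : V -> W) : open U ->
  smooth_cb U f -> smooth_cb U (fun x => a *: f x).
Proof.
move=> oU sf k; have [c fc] := sf k; exists (`|a| * `|c|).
by apply: cbZ => //; apply: cb_mono (ler_norm c) fc.
Qed.

Lemma smooth_cb_eq (V W : normedModType R) (U : set V) (f g : V -> W) : open U ->
  (forall x, U x -> f x = g x) -> smooth_cb U f -> smooth_cb U g.
Proof. by move=> oU fg sf k; have [c fc] := sf k; exists c; apply: cb_eq oU fg fc. Qed.

Lemma fdiffn_eq_on (V W : normedModType R) (U : set V) (f g : V -> W) : open U ->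
  (forall x, U x -> f x = g x) -> smooth_on U f ->
  forall k x, U x -> fdiffn k f x = fdiffn k g x.
Proof.
move=> oU fg sf; elim=> [|k IH] x Ux; first exact: fg.
exact (esym (proj2 (isd_eq_on oU Ux IH (diff_isd (sf k x Ux))))).
Qed.

(* The bounds carry the powers of [r] that result from scaling [M] from [1] to [r]. *)
Record projection_data (E : hilbertType R) (K : nat -> R) (d : R) (M : set E)
    (Q : blin E E) (U : set E) : Prop := ProjectionData {
  pd_open : open U;
  pd_near : forall x, U x -> nearest_point M x (nproj M x);
  pd_uniq : forall x y, U x -> nearest_point M x y -> y = nproj M x;
  pd_smooth : smooth_cb U (nproj M);
  pd_fst : forall x, U x -> `|fdiff (nproj M) x - Q| <= K 0%N * (d / r);
  pd_bound : forall k x, U x ->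
    `|fdiffn k.+2 (nproj M) x| <= K k.+1 * (d / r ^+ k.+2) }.

Lemma projection_data_scaled (E : hilbertType R) (K : nat -> R) (d : R) (M : set E)
    (Q : blin E E) (q : E) (a : R) : 0 < a ->
  projection_bounds K (d / r) a M Q (r^-1 *: q) ->
  projection_data K d [set x | M (r^-1 *: x)] Q [set x | `|x - q| < a * r].
Proof.
move=> a0 [near df cbd]; set U1 := [set x | _] in cbd *.
set Mr := [set x | M (r^-1 *: x)].
have oU1 : open U1 by apply: open_lt_norm => z; case: (isd_subr (r^-1 *: q) z).
set U := [set x | `|x - q| < a * r].
have oU : open U by apply: open_lt_norm => z; case: (isd_subr q z).
have U1U x : U x -> U1 (r^-1 *: x).
  by rewrite /U /U1 /= -scalerBr norm_scaleV ltr_pdivrMr.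
have nE x : U x -> nproj Mr x = r *: nproj M (r^-1 *: x).
  move=> /U1U /near[nx ux]; apply: nprojE.
    by apply/nearest_point_scaled; rewrite scaleKV.
  by move=> z /nearest_point_scaled /ux <-; rewrite scaleVK.
have q1 : U1 (r^-1 *: q) by rewrite /U1 /= subrr normr0.
have sm1 : smooth_cb U1 (nproj M).
  have [y0n _] := near _ q1; set y0 := nproj M (r^-1 *: q) in y0n.
  (* [projection_bounds] says nothing about the size of the values. They are bounded by comparing
     with the nearest point [y0] of the centre. *)
  have b0 x : U1 x -> `|nproj M x| <= `|r^-1 *: q| + a + (a + `|r^-1 *: q - y0|).
    move=> Ux; have [[_ nx] _] := near x Ux; have := nx y0 (proj1 y0n) => xy.
    have x1 : `|x - r^-1 *: q| <= a by apply: ltW.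
    have -> : nproj M x = (r^-1 *: q + (x - r^-1 *: q)) - (x - nproj M x) by modeq R E.
    apply: le_trans (ler_normB _ _) _; apply: lerD.
      by apply: le_trans (ler_normD _ _) _; rewrite lerD2l.
    apply: le_trans xy _.
    rewrite (_ : x - y0 = (x - r^-1 *: q) + (r^-1 *: q - y0)); last by modeq R E.
    by apply: le_trans (ler_normD _ _) _; rewrite lerD2r.
  move=> [|k]; first by eexists; split; [exact: b0|].
  exists (`|r^-1 *: q| + a + (a + `|r^-1 *: q - y0|) + (`|K k * (d / r)| + `|Q|)).
  apply: (cbSI (f' := fun x => (fdiff (nproj M) x - Q) + Q)) => // [x Ux|x Ux|].
  - by apply: le_trans (b0 x Ux) _; rewrite lerDl addr_ge0.
  - by rewrite subrK; apply/diff_isd/df.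
  apply: (@cb_mono _ _ _ _ (`|K k * (d / r)| + `|Q|)).
    by rewrite lerDr !addr_ge0// ltW.
  apply: cbD => //; last exact: cb_cst.
  exact: cb_mono (ler_norm _) (cbd k).
have so1 : smooth_on U1 (nproj M) by apply: smooth_onP.
have fE k x : U x -> fdiffn k (nproj Mr) x = (r * r^-1 ^+ k) *: fdiffn k (nproj M) (r^-1 *: x).
  move=> Ux; have sc := smooth_on_scaled r oU1 so1.
  have sc' : smooth_on U (fun y => r *: nproj M (r^-1 *: y)).
    by move=> j y Uy; apply: sc; apply: U1U.
  rewrite -(fdiffn_eq_on oU (fun y Uy => esym (nE y Uy)) sc' k Ux).
  by have [-> _] := fdiffn_scaled r oU1 so1 k (U1U x Ux).
split=> //.
- move=> x Ux; rewrite nE//; apply/nearest_point_scaled; rewrite scaleKV.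
  by have [] := near _ (U1U x Ux).
- move=> x y Ux /nearest_point_scaled ny; rewrite nE//.
  by have [_ ux] := near _ (U1U x Ux); rewrite -(ux _ ny) scaleVK.
- apply: (smooth_cb_eq oU (fun y Uy => esym (nE y Uy))).
  apply: smooth_cbZ => //.
  apply: (smooth_cb_comp oU U1U sm1) => x _.
  exact: isdZ (isd_id x).
- move=> x Ux; have -> : fdiff (nproj Mr) x = fdiff (nproj M) (r^-1 *: x).
    have := fE 1%N x Ux; rewrite expr1 mulfV ?rn0// scale1r; exact.
  exact: cb_norm (cbd 0%N) (U1U x Ux).
- move=> k x Ux; rewrite fE// normrZ ger0_norm; last first.
    by rewrite mulr_ge0 ?exprn_ge0 ?invr_ge0 ?ltW.
  (* Differentiating once more removes the constant [Q]; [fdiffnSr] is applied twice to pass from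
     inner to outer differentiation. *)
  have H : `|fdiffn k.+2 (nproj M) (r^-1 *: x)| <= K k.+1 * (d / r).
    have [_ H] := cb_dcb (cbd k.+1).
    have H2 : cb k (K k.+1 * (d / r)) U1 (fdiff (fdiff (nproj M))).
      apply: cb_eq oU1 _ H => y Uy.
      have dd : differentiable (fdiff (nproj M)) y by apply: (so1 1%N y Uy).
      by have [_] := isdB (diff_isd dd) (isd_cst Q y); rewrite subr0.
    have := cb_fdiffn H2 (U1U x Ux).
    pose Pn (s : {Z : normedModType R & E -> Z}) := `|projT2 s (r^-1 *: x)| <= K k.+1 * (d / r).
    have := congr1 Pn (fdiffnSr (fdiff (nproj M)) k); rewrite /Pn /= => ->.
    pose F (s : {Z : normedModType R & E -> Z}) :=
      existT (fun Z : normedModType R => E -> Z) (blin E (projT1 s) : normedModType R) (fdiff (projT2 s)).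
    by have := congr1 Pn (congr1 F (fdiffnSr (nproj M) k)); rewrite /Pn /F /= => ->.
  apply: le_trans (ler_wpM2l _ H) _; first by rewrite mulr_ge0 ?exprn_ge0 ?invr_ge0 ?ltW.
  rewrite le_eqVlt; apply/orP; left; apply/eqP.
  rewrite exprVn !exprS; field; rewrite expf_neq0 ?rn0//.
Qed.

End Scaling.

(** * Tangent spaces, second fundamental form and angles *)

Section MetricProjection.
Context {R : realType} {E : hilbertType R}.
Variables (M Om : set E).
Let Pm := nproj M.
Hypothesis Om_smooth : forall x, Om x -> exists U : set E,
  [/\ open U, U x, U `<=` Om & smooth_cb U Pm].
Hypothesis Om_near : forall x, Om x -> nearest_point M x (Pm x).
Hypothesis M_Om : M `<=` Om.

Lemma open_Om : open Om.
Proof.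
rewrite openE => x /Om_smooth[U [oU Ux UO _]].
by apply: filterS UO _; apply: open_nbhs_nbhs.
Qed.

Lemma nproj_id y : M y -> Pm y = y.
Proof.
move=> My; have [_ /(_ y My)] := Om_near (M_Om My).
by rewrite subrr normr0 normr_le0 subr_eq0 => /eqP.
Qed.

Lemma isd_nproj x : Om x -> isd Pm x (fdiff Pm x).
Proof. by move=> /Om_smooth[U [oU Ux _ /(_ 1%N)[c H]]]; apply: cb_isd H Ux. Qed.

Lemma isd_nproj2 x : Om x -> isd (fdiff Pm) x (fdiff (fdiff Pm) x).
Proof.
move=> /Om_smooth[U [oU Ux _ /(_ 2)[c H]]].
by have [_ H1] := cb_dcb H; apply: cb_isd H1 Ux.
Qed.

Lemma isd_local_min (V : normedModType R) (f : V -> R^o) x (L : blin V R^o) (d : R) :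
  0 < d -> (forall y, `|y - x| < d -> f x <= f y) -> isd f x L -> L = 0.
Proof.
move=> d0 fmin fL; have fe : epsd f x L by apply/epsdP.
have key v : 0 <= L v.
  rewrite leNgt; apply/negP => Lv.
  have v0 : v != 0 by apply: contraTneq Lv => ->; rewrite blin0 ltxx.
  have nv : 0 < `|v| by rewrite normr_gt0.
  have e0 : 0 < - L v / 2 / `|v| by rewrite !divr_gt0// oppr_gt0.
  have [d1 d10 d1P] := fe _ e0.
  pose s := Num.min d d1 / 2 / `|v|.
  have m0 : 0 < Num.min d d1 by rewrite lt_min d0.
  have s0 : 0 < s by rewrite !divr_gt0.
  have sv : `|s *: v| = Num.min d d1 / 2.
    by rewrite normrZ gtr0_norm// /s divfK// gt_eqF.
  have sm : `|s *: v| < Num.min d d1 by rewrite sv; lra.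
  have [svd svd1] : `|s *: v| < d /\ `|s *: v| < d1.
    by move: sm; rewrite lt_min => /andP[].
  have h1 := d1P _ svd1; have := fmin (x + s *: v).
  rewrite (_ : x + s *: v - x = s *: v); last by modeq R V.
  move=> /(_ svd) h2; move: h1; rewrite blinZ normrZ gtr0_norm//.
  rewrite ler_norml => /andP[_ h3].
  have h4 : - L v / 2 / `|v| * (s * `|v|) = - L v / 2 * s by field; rewrite gt_eqF.
  move: h3; rewrite h4 /GRing.scale /= => h3.
  have : s * (- L v) <= - L v / 2 * s by lra.
  have : 0 < s * - L v by rewrite mulr_gt0// oppr_gt0.
  lra.
apply: blinP => v; apply/eqP; rewrite eq_le key andbT.
by have := key (- v); rewrite blinN oppr_ge0.
Qed.

(** For fixed [x], the squared distance from [x] to [Pm z] is minimal at [z = x], because [Pm z]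
    ranges in [M]; its differential vanishes there. *)
Lemma nproj_orth x u : Om x -> inner (x - Pm x) (fdiff Pm x u) = 0.
Proof.
move=> Ox; pose f (z : E) : R^o := inner (x - Pm z) (x - Pm z).
have [d d0 dO] := open_ball open_Om Ox.
have gd : isd (fun z => x - Pm z) x (0 - fdiff Pm x).
  by apply: isdB; [apply: isd_cst|apply: isd_nproj].
have fd := @isd_bilin R E E E R^o innerbb _ _ x _ _ gd gd.
have := isd_local_min d0 _ fd.
have fmin y : `|y - x| < d -> f x <= f y.
  move=> /dO Oy; rewrite /f !inner_norm.
  apply: lerXn2r; rewrite ?nnegrE//.
  by have [_] := Om_near Ox; apply; have [] := Om_near Oy.
move=> /(_ fmin) /(congr1 (fun L : blin E R^o => L u)).
have -> : dbil innerbb (x - Pm x) (x - Pm x) (0 - fdiff Pm x) (0 - fdiff Pm x) u =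
  inner (x - Pm x) (0 - fdiff Pm x u) + inner (0 - fdiff Pm x u) (x - Pm x) by [].
rewrite (innerC (0 - _)) sub0r innerNr blin0E; lra.
Qed.

Lemma dnproj_idem y u : M y -> fdiff Pm y (fdiff Pm y u) = fdiff Pm y u.
Proof.
move=> My; have Oy := M_Om My.
have h1 : isd (fun x => Pm (Pm x)) y (compb (fdiff Pm y) (fdiff Pm y)).
  by apply: isd_comp (isd_nproj Oy) _; rewrite nproj_id//; apply: isd_nproj.
have [_ E1] : isd Pm y (compb (fdiff Pm y) (fdiff Pm y)).
  apply: (isd_eq_on open_Om Oy _ h1) => x Ox; apply: nproj_id.
  by have [] := Om_near Ox.
by rewrite {3}E1.
Qed.

(** The relation of [nproj_orth] is differentiated at [y] in the direction [w]. The term with the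
    second differential of [Pm] is paired with [y - Pm y = 0] and drops out. *)
Lemma dnproj_orth y w u : M y -> inner (w - fdiff Pm y w) (fdiff Pm y u) = 0.
Proof.
move=> My; have Oy := M_Om My.
pose f (x : E) : R^o := inner (x - Pm x) (fdiff Pm x u).
have gd : isd (fun x => x - Pm x) y (idb E - fdiff Pm y).
  by apply: isdB (isd_id y) (isd_nproj Oy).
have hd : isd (fun x => fdiff Pm x u) y (flipb1 (fdiff (fdiff Pm) y) u).
  have -> : flipb1 (fdiff (fdiff Pm) y) u =
     dbil (idb (blin E E)) (fdiff Pm y) u (fdiff (fdiff Pm) y) 0.
    by apply: blinP => v; rewrite /dbil blinDE !compbbE !compbE blin0E blin0 add0r.
  exact: (@isd_bilin R E (blin E E) E E (idb (blin E E)) (fdiff Pm) (fun=> u) y _ _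
    (isd_nproj2 Oy) (isd_cst u y)).
have fd := @isd_bilin R E E E R^o innerbb _ _ y _ _ gd hd.
have f0 x : Om x -> (0 : R^o) = innerbb (x - Pm x) (fdiff Pm x u).
  by move=> Ox; apply/esym/nproj_orth.
have [_ E0] := isd_eq_on open_Om Oy f0 (isd_cst (0 : R^o) y).
have [_ E1] := fd; have := congr1 (fun L : blin E R^o => L w) (etrans (esym E0) E1).
rewrite nproj_id//.
have -> : dbil innerbb (y - y) (fdiff Pm y u) (idb E - fdiff Pm y)
   (flipb1 (fdiff (fdiff Pm) y) u) w =
   inner (y - y) (fdiff (fdiff Pm) y w u) + inner (w - fdiff Pm y w) (fdiff Pm y u) by [].
by rewrite subrr inner0l add0r.
Qed.

Lemma dnproj_sym_idem y : M y -> sym_idem (fdiff Pm y).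
Proof.
move=> My; split=> [u v|u]; last exact: dnproj_idem.
have h1 := dnproj_orth v u My; have h2 := dnproj_orth u v My.
move: h1 h2; rewrite !innerBl => /subr0_eq h1 /subr0_eq h2.
by rewrite h2 innerC h1 innerC.
Qed.

Lemma curve_tangent y (g : R -> E) (e : R) : 0 < e ->
  (forall t, ball (0 : R) e t -> M (g t)) -> differentiable (g : R^o -> E) 0 -> g 0 = y ->
  fdiff Pm y (derive1 g 0) = derive1 g 0 /\ derive1 g 0 = fdiff (g : R^o -> E) 0 1.
Proof.
move=> e0 Mg dg g0.
have My : M y by rewrite -g0; apply: Mg; apply: ballxx.
have gE : derive1 g 0 = fdiff (g : R^o -> E) 0 1.
  by rewrite fdiffE// derive1E'.
split=> //; rewrite gE.
have h1 : isd (fun t : R^o => Pm (g t)) 0 (compb (fdiff Pm y) (fdiff (g : R^o -> E) 0)).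
  apply: (@isd_comp _ R^o E E Pm g) (diff_isd dg) _.
  by rewrite g0; apply: isd_nproj; apply: M_Om.
have [_ E1] : isd (g : R^o -> E) 0 (compb (fdiff Pm y) (fdiff (g : R^o -> E) 0)).
  apply: (@isd_near _ R^o E _ _ _ _ e e0 _ h1) => t te; apply/nproj_id/Mg.
  by rewrite -ball_normE /= distrC.
by rewrite {2}E1.
Qed.

(** A vector fixed by the differential is the velocity of the curve [Pm (y + t v)]. Conversely, [Pm]
    fixes curves in [M], so its differential fixes their velocities. *)
Lemma tangent_dirE y : M y -> tangent_dir M y = [set v | fdiff Pm y v = v].
Proof.
move=> My; apply/seteqP; split=> [v [e [g [e0 sg Mg g0 <-]]]|v /= Pv].
  have dg : differentiable (g : R^o -> E) 0 by apply: (sg 0%N); apply: ballxx.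
  by have [] := curve_tangent e0 Mg dg g0.
have Oy := M_Om My; have [U [oU Uy UO sU]] := Om_smooth Oy.
have [d d0 dU] := open_ball oU Uy.
pose e := d / (`|v| + 1).
have v1 : 0 < `|v| + 1 by rewrite ltr_wpDl.
have e0 : 0 < e by rewrite divr_gt0.
pose l (t : R^o) : E := y + scaleb v t.
have lU t : ball (0 : R^o) e t -> U (l t).
  rewrite -ball_normE /= sub0r normrN => te; apply: dU.
  rewrite /l (_ : y + scaleb v t - y = t *: v); last by rewrite /=; modeq R E.
  rewrite normrZ; apply: (@le_lt_trans _ _ (`|t| * (`|v| + 1))).
    by rewrite ler_wpM2l// lerDl.
  by rewrite -ltr_pdivlMr.
have ld t : isd l t (scaleb v).
  by have := isdD (isd_cst y t) (isd_blin (scaleb v) t); rewrite add0r.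
have ob : open (ball (0 : R^o) e) by apply: ball_open.
have sPl : smooth_on (ball (0 : R^o) e) (fun t => Pm (l t)).
  apply: smooth_onP; apply: (smooth_cb_comp ob lU sU) => t _; exact: ld.
have l0 : l 0 = y by rewrite /l blin0 addr0.
exists e, (fun t => Pm (l t)); split=> //.
- by move=> t te; have [] := Om_near (UO _ (lU t te)).
- by rewrite l0 nproj_id.
have H : isd (fun t : R^o => Pm (l t)) 0 (compb (fdiff Pm y) (scaleb v)).
  by apply: (isd_comp (ld 0)); rewrite l0; apply: isd_nproj.
rewrite derive1E'; last by case: H.
by rewrite (isd_diff H) /= scale1r.
Qed.

Lemma orth_projector_tangent y : M y -> orth_projector (tangent_dir M y) = fdiff Pm y.
Proof.
by move=> My; apply: sym_idem_orth_projector; [apply: dnproj_sym_idem|apply: tangent_dirE].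
Qed.

(** A tangent field satisfies [fdiff Pm (Y) = Y] on [M]. Differentiating along a curve with velocity
    [u] shows that the normal component of the derivative of [Y] is the second differential of [Pm]
    at [(u, v)]. The argument covers every field, hence the one chosen by [xget], and the default 0
    is harmless. *)
Lemma second_fundamental_form_le x u v C : 0 <= C -> M x ->
  `|fdiff (fdiff Pm) x| <= C -> tangent_dir M x u ->
  `|second_fundamental_form M x u v| <= C * `|u| * `|v|.
Proof.
move=> C0 Mx PC [e [g [e0 sg Mg g0 gu]]]; rewrite /second_fundamental_form.
case: xgetP => [w -> [U [Y [[oU Ux] sY Yt Yx ->]]]|_]; last first.
  by rewrite normr0 !mulr_ge0.
have dg : differentiable (g : R^o -> E) 0 by apply: (sg 0%N); apply: ballxx.
have [_ gE] := curve_tangent e0 Mg dg g0.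
rewrite orth_projector_tangent//.
have Ox := M_Om Mx.
have dY : isd Y x (fdiff Y x) by apply: diff_isd; apply: (sY 0%N).
have h1 : isd (fun t : R^o => Y (g t)) 0 (compb (fdiff Y x) (fdiff (g : R^o -> E) 0)).
  by apply: (@isd_comp _ R^o E E Y g) (diff_isd dg) _; rewrite g0.
have h2 : isd (fun t : R^o => fdiff Pm (g t)) 0
    (compb (fdiff (fdiff Pm) x) (fdiff (g : R^o -> E) 0)).
  apply: (@isd_comp _ R^o E _ (fdiff Pm) g) (diff_isd dg) _.
  by rewrite g0; apply: isd_nproj2.
have h3 := @isd_bilin R R^o (blin E E) E E (idb (blin E E)) _ _ (0 : R^o) _ _ h2 h1.
have [d1 d10 d1U] := open_ball oU Ux.
have [d2 d20 d2g] := isd_cont (diff_isd dg) d10.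
have [_ h4] : isd (fun t : R^o => Y (g t)) 0 (dbil (idb (blin E E)) (fdiff Pm (g 0)) (Y (g 0))
    (compb (fdiff (fdiff Pm) x) (fdiff (g : R^o -> E) 0))
    (compb (fdiff Y x) (fdiff (g : R^o -> E) 0))).
  apply: (@isd_near _ R^o E _ _ _ _ (Num.min e d2) _ _ h3); first by rewrite lt_min e0.
  move=> t; rewrite subr0 lt_min => /andP[te td].
  have Mgt : M (g t) by apply: Mg; rewrite -ball_normE /= sub0r normrN.
  have Ugt : U (g t) by apply: d1U; have := d2g t td; rewrite add0r g0.
  have := Yt (g t) (conj Mgt Ugt); rewrite tangent_dirE//.
have [_ h5] := h1; have := congr1 (fun L : blin R^o E => L 1) (etrans (esym h5) h4).
have -> : compb (fdiff Y x) (fdiff (g : R^o -> E) 0) 1 = fdiff Y x u by rewrite compbE -gE gu.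
have -> : dbil (idb (blin E E)) (fdiff Pm (g 0)) (Y (g 0))
    (compb (fdiff (fdiff Pm) x) (fdiff (g : R^o -> E) 0))
    (compb (fdiff Y x) (fdiff (g : R^o -> E) 0)) 1 =
    fdiff Pm (g 0) (fdiff Y x (fdiff (g : R^o -> E) 0 1)) +
    fdiff (fdiff Pm) x (fdiff (g : R^o -> E) 0 1) (Y (g 0)) by [].
rewrite -gE gu g0 Yx => H.
have -> : fdiff Y x u - fdiff Pm x (fdiff Y x u) = fdiff (fdiff Pm) x u v.
  by rewrite {1}H addrC addKr.
by apply: blin_le => //; apply: blin_le.
Qed.

Lemma dnproj_dist x y C : 0 <= C ->
  (forall s : R, 0 <= s <= 1 -> Om (y + s *: (x - y)) /\
     `|fdiff (fdiff Pm) (y + s *: (x - y))| <= C) ->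
  `|fdiff Pm x - fdiff Pm y| <= C * `|x - y|.
Proof.
move=> C0 H; apply: norm_blin_le => [|v]; first by rewrite mulr_ge0.
pose U := [set z | Om z /\ `|fdiff (fdiff Pm) z| <= C].
have c0 : 0 <= C * `|x - y| * `|v| by rewrite !mulr_ge0.
have ld z : Om z -> isd (fun x => fdiff Pm x v) z (flipb1 (fdiff (fdiff Pm) z) v).
  move=> Oz; have -> : flipb1 (fdiff (fdiff Pm) z) v =
     dbil (idb (blin E E)) (fdiff Pm z) v (fdiff (fdiff Pm) z) 0.
    by apply: blinP => u; rewrite /dbil blinDE !compbbE !compbE blin0E blin0 add0r.
  exact: (@isd_bilin R E (blin E E) E E (idb (blin E E)) (fdiff Pm) (fun=> v) z _ _
    (isd_nproj2 Oz) (isd_cst v z)).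
have := @mean_value R E E U (fun z => fdiff Pm z v) _ y x c0.
rewrite blinBE; apply.
- by move=> s /H.
- by move=> z [Oz _]; case: (ld z Oz).
- move=> z [Oz zC]; have [_ ->] := ld z Oz.
  rewrite [flipb1 _ _ _]/(fdiff (fdiff Pm) z (x - y) v).
  by apply: blin_le => //; apply: blin_le.
Qed.

End MetricProjection.

(** * Angles between ranges of projectors *)

Section AngleBounds.
Context {R : realType}.

Lemma sin_ge_half (t : R) : 0 <= t <= pi -> 2^-1 <= cos t -> t / 2 <= sin t.
Proof.
move=> /andP[t0 tpi] ct.
have [->|tn] := eqVneq t 0; first by rewrite mul0r sin0.
have tp : 0 < t by rewrite lt_neqAle eq_sym tn.
have cs : {within `[0, t], continuous (@sin R)}.
  by apply: continuous_subspaceT => z; apply: continuous_sin.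
have [s] := MVT tp (fun z _ => is_derive_sin z) cs.
rewrite in_itv/= => /andP[s0 st]; rewrite sin0 !subr0 => ->.
rewrite mulrC ler_wpM2r//; apply: le_trans ct _.
have tI : t \in `[0, pi] by rewrite in_itv/= t0 tpi.
have sI : s \in `[0, pi] by rewrite in_itv/= (ltW s0)/= (le_trans (ltW st)).
by apply/ltW; rewrite (ltr_cos sI tI).
Qed.

(** The vector [S u] is a test vector for the inner infimum: its angle with [u] has cosine
    [|S u| / |u|] and sine [|u - S u| / |u| <= e]. The cosine is at least [1 / 2], which by
    [sin_ge_half] turns the bound on the sine into one on the angle. *)
Lemma angle_le (E : hilbertType R) (T S : blin E E) (e : R) :
  sym_idem T -> sym_idem S -> `|T - S| <= e -> e <= 2^-1 ->
  angle [set v | T v = v] [set v | S v = v] <= 2 * e.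
Proof.
move=> TT SS TSe e2; have e0 : 0 <= e by apply: le_trans TSe.
rewrite /angle; set A := [set inf _ | u in _].
have [->|/set0P A0] := eqVneq A set0; first by rewrite sup0 mulr_ge0.
apply: ge_sup => // _ [u [/= Tu u0] <-].
have {}u0 : u != 0 by apply/eqP.
have nu : 0 < `|u| by rewrite normr_gt0.
pose w := S u; have [Ss Si] := SS.
have uw : `|u - w| <= e * `|u|.
  by rewrite -{1}Tu /w -blinBE; apply: blin_le.
have wu : `|w| <= `|u| by apply: sym_idem_le.
have w2 : 2^-1 * `|u| <= `|w|.
  have : `|u| <= `|u - w| + `|w| by rewrite -{1}(subrK w u); apply: ler_normD.
  have : e * `|u| <= 2^-1 * `|u| by rewrite ler_wpM2r.
  lra.
have nw : 0 < `|w| by apply: lt_le_trans w2; rewrite mulr_gt0.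
have w0 : w != 0 by rewrite -normr_gt0.
pose c := `|w| / `|u|.
have c1 : c <= 1 by rewrite ler_pdivrMr// mul1r.
have c2 : 2^-1 <= c by rewrite ler_pdivlMr.
have cE : inner u w / (`|u| * `|w|) = c.
  have -> : inner u w = `|w| ^+ 2 by rewrite -inner_norm /w Ss Si.
  by rewrite /c; field; rewrite !gt_eqF.
have c11 : -1 <= c <= 1 by rewrite c1 andbT; lra.
have [/andP[a0 api] ca] := acos_def c11.
have ae : vangle u w <= 2 * e.
  rewrite /vangle cE; have := sin_ge_half _ _; move=> /(_ (acos c)).
  rewrite a0 api ca => /(_ isT c2) sa.
  have : sin (acos c) <= e.
    rewrite sin_acos// -(ger0_norm e0) -sqrtr_sqr ler_wsqrtr//.
    have py := sym_idem_pyth SS u; rewrite -/w in py.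
    have : `|u - w| ^+ 2 <= (e * `|u|) ^+ 2 by apply: lerXn2r; rewrite ?nnegrE// mulr_ge0.
    have -> : 1 - c ^+ 2 = `|u - w| ^+ 2 / `|u| ^+ 2.
      have -> : `|u - w| ^+ 2 = `|u| ^+ 2 - `|w| ^+ 2 by rewrite py; ring.
      by rewrite /c; field; rewrite gt_eqF.
    by rewrite exprMn ler_pdivrMr// exprn_gt0.
  by move: sa; lra.
apply: le_trans ae; apply: ge_inf.
  exists 0 => _ [v [/= _ v0] <-]; apply: acos_ge0.
  have {}v0 : v != 0 by apply/eqP.
  have nv : 0 < `|u| * `|v| by rewrite mulr_gt0 ?normr_gt0.
  have := inner_le u v; rewrite ler_norml => /andP[h1 h2].
  by rewrite ler_pdivlMr// ler_pdivrMr// mulN1r mul1r h1 h2.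
by exists w => //; split=> /=; [rewrite /w Si|apply/eqP].
Qed.

End AngleBounds.

(** * Translating the hypotheses and the conclusion *)

Section FinalStep.
Context {R : realType}.

Lemma tubeP (E : normedModType R) (A : set E) (e : R) z :
  tube e A z <-> exists2 a, A a & `|z - a| < e.
Proof.
split=> [/ereal_inf_lt[_ [a Aa <-]] /edist_lt_ball|[a Aa za]].
  by rewrite -ball_normE /=; exists a.
pose e' := (`|z - a| + e) / 2.
have e'1 : `|z - a| < e' by rewrite /e'; lra.
have e'2 : e' < e by rewrite /e'; lra.
have e'0 : 0 < e' by apply: le_lt_trans e'1.
apply: (@le_lt_trans _ _ e'%:E); last by rewrite lte_fin.
apply: (@le_trans _ _ (edist (z, a))); first by apply: ereal_inf_lbound; exists a.
by apply: edist_fin => //=; rewrite -ball_normE.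
Qed.

(** The infimum defining the distance need not be attained, and distances in a tube are strict;
    hence some [e > d]. *)
Lemma hausdorff_close (E : normedModType R) (A B : set E) (d e : R) : d < e ->
  (hausdorff_dist A B <= d%:E)%E ->
  (forall a, A a -> exists2 b, B b & `|a - b| < e) /\
  (forall b, B b -> exists2 a, A a & `|b - a| < e).
Proof.
move=> de H; have : (hausdorff_dist A B < e%:E)%E by apply: le_lt_trans H _; rewrite lte_fin.
move=> /ereal_inf_lt[_ [e' [e'0 AB BA] <-]]; rewrite lte_fin => e'e.
split=> [a /AB /tubeP[b Bb ab]|b /BA /tubeP[a Aa ab]].
  by exists b => //; apply: lt_trans ab _.
by exists a => //; apply: lt_trans ab _.
Qed.

Lemma affine_projector (E : hilbertType R) n (A : set E) (x : E) :
  affine_subspace n A -> A x ->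
  exists Q : blin E E, rank_proj n Q /\ A = [set z | Q (z - x) = z - x].
Proof.
move=> [x0 [V [lV ->]]] [v0 Vv0 <-]; have [Q [rQ VE]] := ex_rank_proj lV.
exists Q; split=> //; rewrite VE in Vv0 *; apply/seteqP; split=> [_ [v /= Qv <-]|z /= Qz].
  rewrite (_ : x0 + v - (x0 + v0) = v - v0); last by modeq R E.
  by rewrite blinB Qv Vv0.
exists (v0 + (z - (x0 + v0))); last by modeq R E.
by rewrite /= blinD Vv0 Qz.
Qed.

Lemma flats_scaled (E : hilbertType R) n (r d e : R) (X : set E) (A : E -> set E)
    (P : E -> blin E E) : 0 < r -> d < e ->
  close_to_flats_with n d r X A ->
  (forall x, X x -> rank_proj n (P x) /\ A x = [set z | P x (z - x) = z - x]) ->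
  flats n (e / r) [set x | X (r *: x)] (fun x => P (r *: x)).
Proof.
move=> r0 de cl HP.
have rn : r != 0 by rewrite gt_eqF.
have nV (u : E) : `|u| = `|r *: u| / r.
  by rewrite normrZ gtr0_norm// mulrAC mulfV// mul1r.
split=> [x /HP[]//|x z Xx Xz xz|x v Xx Pv v1].
  have [rP AE] := HP _ Xx; have PP := rank_proj_sym_idem rP.
  have [_ _ /(hausdorff_close de)[XA _]] := cl _ Xx.
  have bz : ball (r *: x) r (r *: z).
    by rewrite -ball_normE /= -scalerBr normrZ gtr0_norm// distrC -[ltRHS]mulr1 ltr_pM2l.
  have [b [Ab _] zb] := XA (r *: z) (conj Xz bz).
  rewrite AE /= in Ab.
  rewrite nV ler_pM2r ?invr_gt0//; apply: (@le_trans _ _ `|r *: z - b|); last exact: ltW.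
  rewrite (_ : r *: (z - x - P (r *: x) (z - x)) =
    (r *: z - b) - P (r *: x) (r *: z - b)); first exact: sym_idem_leC.
  have -> : r *: z - b = r *: (z - x) - (b - r *: x) by modeq R E.
  by rewrite !(blinB (P (r *: x))) !(blinZ (P (r *: x))) !(blinB (P (r *: x))) in Ab *;
    rewrite Ab; modeq R E.
have [rP AE] := HP _ Xx.
have [_ _ /(hausdorff_close de)[_ AX]] := cl _ Xx.
have Aa : (A (r *: x) `&` ball (r *: x) r) (r *: x + r *: v).
  split.
    rewrite AE /= (_ : r *: x + r *: v - r *: x = r *: v); last by modeq R E.
    by rewrite blinZ Pv.
  rewrite -ball_normE /= (_ : r *: x - (r *: x + r *: v) = - (r *: v)); last by modeq R E.
  by rewrite normrN normrZ gtr0_norm// -[ltRHS]mulr1 ltr_pM2l.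
have [z [Xz bz] zd] := AX _ Aa.
exists (r^-1 *: z); split.
- by rewrite /= scaleVK.
- rewrite nV scalerBr scaleVK// ltr_pdivrMr// mul1r.
  by move: bz; rewrite -ball_normE /= distrC.
- rewrite nV ler_pM2r ?invr_gt0// scalerBr scalerDr scaleVK// distrC.
  exact: ltW.
Qed.

Lemma affine_angle_le (E : hilbertType R) (A M : set E) (x y : E) (Q S : blin E E) (e : R) :
  A = [set z | Q (z - x) = z - x] -> tangent_dir M y = [set v | S v = v] ->
  sym_idem Q -> sym_idem S -> `|S - Q| <= e -> e <= 2^-1 ->
  affine_angle A (tangent_space M y) <= 2 * e.
Proof.
move=> AE TE QQ SS SQ e2; rewrite /affine_angle.
have -> : direction A = [set v | Q v = v].
  rewrite AE; apply/seteqP; split=> [_ [[a b] /= [Qa Qb] <-]|v /= Qv] /=.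
    rewrite (_ : a - b = (a - x) - (b - x)); last by modeq R E.
    by rewrite blinB Qa Qb.
  exists (x + v, x) => /=; last by modeq R E.
  by rewrite subrr blin0; split=> //; rewrite (_ : x + v - x = v)//; modeq R E.
have -> : direction (tangent_space M y) = [set v | S v = v].
  rewrite /tangent_space TE; apply/seteqP; split=> [_ [[a b] /= [[u /= Su <-] [v /= Sv <-]] <-]|v /= Sv] /=.
    rewrite (_ : y + u - (y + v) = u - v); last by modeq R E.
    by rewrite blinB Su Sv.
  exists (y + v, y + 0) => /=; last by modeq R E.
  by split; [exists v|exists 0 => //=; rewrite blin0].
by apply: angle_le => //; rewrite distrC.
Qed.

End FinalStep.

Theorem theorem2 (R : realType) (n : nat) :
  exists (sigma2 C11 C12 : R) (C13 : nat -> R),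
    [/\ 0 < sigma2, 0 < C11, 0 < C12 & forall k, 0 < C13 k] /\
    forall (E : hilbertType R) (X : set E) (r delta : R) (A : E -> set E),
      separable E ->
      0 < r -> 0 < delta < sigma2 * r ->
      close_to_flats_with n delta r X A ->
      exists M : set E,
        [/\ closed_submanifold n M,
            (hausdorff_dist X M <= (5 * delta)%:E)%E,
            (forall x u v, M x -> tangent_dir M x u -> tangent_dir M x v ->
               `|second_fundamental_form M x u v|
                 <= C11 * delta / r ^+ 2 * `|u| * `|v|),
            ((r / 3)%:E <= reach M)%E &
            [/\ smooth_on (tube (r / 3) M) (nproj M),
                (forall x k, tube (r / 3) M x -> (2 <= k)%N ->
                   `|fdiffn k (nproj M) x| < C13 k * delta / r ^+ k),
                (forall x, tube (r / 3) M x ->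
                   `|fdiff (nproj M) x
                       - orth_projector (tangent_dir M (nproj M x))|
                     < C13 1%N * delta / r) &
                (forall x, X x ->
                   affine_angle (A x) (tangent_space M (nproj M x))
                     < C12 * delta / r)]].
Proof.
have [sg [K [sg0 K0 core]]] := @ex_core R n.
(* The three bounds ensure, in this order, that [e / r <= sg], that [5 * delta] is small compared
   with [r], and that the tilt of tangent spaces is at most [1 / 2], as [angle_le] requires. *)
pose s := Num.min (sg / 2) (Num.min (200^-1 / 2) (4 * (K 0%N + 1))^-1).
have K00 := K0 0%N; have K10 := K0 1%N.
have s1 : s <= sg / 2 by rewrite ge_min lexx.
have s2 : s <= 200^-1 / 2 by rewrite !ge_min lexx orbT.
have s3 : s <= (4 * (K 0%N + 1))^-1 by rewrite !ge_min lexx !orbT.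
have s0 : 0 < s.
  have h1 : 0 < sg / 2 by lra.
  have h2 : (0 : R) < 200^-1 / 2 by lra.
  have h3 : 0 < (4 * (K 0%N + 1))^-1 by rewrite invr_gt0; lra.
  by rewrite /s !lt_min h1 h2 h3.
(* [K k.-1] serves for the differentials of order at least 2, [K 1] for the comparison with the
   orthogonal projector; the added 1 gives positivity and strict inequalities. *)
pose C13 k := 6 / 5 * (K k.-1 + K 1%N) + 1.
exists s, (6 / 5 * K 1%N + 1), (12 / 5 * K 0%N + 1), C13; split.
  split=> // [||k]; rewrite ltr_wpDl// ?mulr_ge0// ?addr_ge0//; lra.
move=> E X r delta A _ r0 /andP[d0 ds] cl.
have rn : r != 0 by rewrite gt_eqF.
(* Greater than [delta], as [hausdorff_close] demands, and such that [4 * e < 5 * delta]. *)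
pose e := 6 / 5 * delta.
have de : delta < e by rewrite /e; lra.
have dr : delta / r <= s by rewrite ler_pdivrMr// ltW.
have er : e / r = 6 / 5 * (delta / r) by rewrite /e mulrA.
have er0 : 0 < e / r by rewrite er; have := divr_gt0 d0 r0; lra.
have ers : 0 <= e / r <= sg by rewrite (ltW er0) er; lra.
have /choice[P HP] : forall x, exists Q : blin E E,
    X x -> rank_proj n Q /\ A x = [set z | Q (z - x) = z - x].
  move=> x; have [Xx|nX] := pselect (X x); last by exists 0.
  have [aA Ax _] := cl x Xx; have [Q HQ] := affine_projector aA Ax.
  by exists Q.
have fl := flats_scaled r0 de cl HP.
have [M' [XM MX cM sM pb]] := core E _ _ _ fl ers.
pose M := [set x | M' (r^-1 *: x)].
have nV (u v : E) : `|r^-1 *: u - r^-1 *: v| = `|u - v| / r.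
  by rewrite -scalerBr norm_scaleV.
have XrV x : X x -> [set x | X (r *: x)] (r^-1 *: x) by move=> Xx; rewrite /= scaleVK.
have XM4 x : X x -> exists2 y, M y & `|x - y| < 5 * delta.
  move=> /XrV /XM[y My xy]; exists (r *: y); first by rewrite /M /= scaleKV.
  move: xy; rewrite -{1}(scaleKV r0 y) nV ler_pdivrMr// => xy.
  apply: le_lt_trans xy _; rewrite -mulrA divfK// /e; lra.
have MX4 y : M y -> exists2 x, X x & `|y - x| < 5 * delta.
  move=> /MX[x Xx yx]; exists (r *: x) => //.
  move: yx; rewrite -{1}(scaleKV r0 x) nV ler_pdivrMr// => yx.
  apply: le_lt_trans yx _; rewrite -mulrA divfK// /e; lra.
(* [r / 24] is [(3 / 8 - 1 / 3) * r]: a point of the tube is within [3 / 8 * r] of [X]. *)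
have d200 : 5 * delta < r / 24.
  have : s * r <= 200^-1 / 2 * r by rewrite ler_pM2r.
  by move: ds; lra.
pose B q := [set x : E | `|x - q| < 3 / 8 * r].
have data q : X q -> projection_data r K e M (P q) (B q).
  move=> Xq; apply: projection_data_scaled => //.
  by have := pb _ (XrV q Xq); rewrite /= scaleVK.
pose Om := [set x | exists2 q, X q & B q x].
have tube_Om x : tube (r / 3) M x -> Om x.
  move=> /tubeP[y My xy]; have [q Xq yq] := MX4 y My; exists q => //.
  rewrite /B /= (_ : x - q = (x - y) + (y - q)); last by modeq R E.
  by apply: le_lt_trans (ler_normD _ _) _; lra.
have M_tube : M `<=` tube (r / 3) M.
  by move=> y My; apply/tubeP; exists y => //; rewrite subrr normr0 divr_gt0.
have M_Om : M `<=` Om by move=> y /M_tube /tube_Om.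
have Om_smooth x : Om x -> exists U : set E,
    [/\ open U, U x, U `<=` Om & smooth_cb U (nproj M)].
  move=> [q Xq Bx]; have D := data q Xq; exists (B q); split=> //.
  - exact: pd_open D.
  - by move=> y By; exists q.
  - exact: pd_smooth D.
have Om_near x : Om x -> nearest_point M x (nproj M x).
  by move=> [q Xq Bx]; apply: pd_near (data q Xq) _ Bx.
have Om_d2 x : Om x -> `|fdiff (fdiff (nproj M)) x| <= K 1%N * (e / r ^+ 2).
  by move=> [q Xq Bx]; have := pd_bound (data q Xq) 0 Bx.
have C0 : 0 <= K 1%N * (e / r ^+ 2) by rewrite mulr_ge0// divr_ge0 ?exprn_ge0 ?ltW// /e; lra.
have Mnp x : Om x -> M (nproj M x) by move=> /Om_near[].
have dr2 : 0 < delta / r ^+ 2 by rewrite divr_gt0// exprn_gt0.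
exists M; split.
- split; last exact: submanifold_scaled.
  apply: closed_comp cM => x _; apply: differentiable_continuous.
  by case: (isdZ r^-1 (isd_id x)).
- apply: ereal_inf_lbound; exists (5 * delta) => //; split; first by rewrite mulr_gt0.
    by move=> x /XM4 ?; apply/tubeP.
  by move=> y /MX4 ?; apply/tubeP.
- move=> x u v Mx Tu Tv.
  have H := second_fundamental_form_le Om_smooth Om_near M_Om v C0 Mx (Om_d2 x (M_Om x Mx)) Tu.
  apply: le_trans H _; apply: ler_wpM2r => //; apply: ler_wpM2r => //.
  rewrite (_ : K 1%N * (e / r ^+ 2) = 6 / 5 * K 1%N * (delta / r ^+ 2)); last by rewrite /e; ring.
  by rewrite -[leRHS]mulrA ler_pM2r//; lra.
- apply: ereal_sup_ubound; exists (r / 3) => //; split; first by rewrite divr_gt0.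
  move=> x /tube_Om Ox; exists (nproj M x); split; first exact: Om_near.
  move=> y ny; case: Ox => q Xq Bx.
  exact/esym/(pd_uniq (data q Xq) Bx ny).
split.
- move=> k x /tube_Om[q Xq Bx].
  exact: (smooth_onP (pd_smooth (data q Xq))).
- move=> x [|[|k]] // /tube_Om[q Xq Bx] _.
  apply: le_lt_trans (pd_bound (data q Xq) k Bx) _.
  have drk : 0 < delta / r ^+ k.+2 by rewrite divr_gt0// exprn_gt0.
  rewrite (_ : K k.+1 * (e / r ^+ k.+2) = 6 / 5 * K k.+1 * (delta / r ^+ k.+2)); last by rewrite /e; ring.
  by rewrite -[ltRHS]mulrA ltr_pM2r// /C13 /=; lra.
- move=> x Tx; have Ox := tube_Om x Tx.
  rewrite (orth_projector_tangent Om_smooth Om_near M_Om (Mnp x Ox)).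
  have xy : `|x - nproj M x| < r / 3.
    have [y My] := (tubeP M (r / 3) x).1 Tx; apply: le_lt_trans.
    by have [_] := Om_near x Ox; apply.
  (* The orthogonal projector is the differential of [nproj M] at the foot point. The bound on the
     second differential is integrated along the segment from there to [x], which stays in the
     tube. *)
  have H := @dnproj_dist R E M Om Om_smooth x (nproj M x) _ C0.
  apply: le_lt_trans (H _) _.
    move=> t /andP[t0 t1]; have : Om (nproj M x + t *: (x - nproj M x)).
      apply/tube_Om/tubeP; exists (nproj M x); first exact: Mnp.
      rewrite (_ : nproj M x + t *: (x - nproj M x) - nproj M x = t *: (x - nproj M x));
        last by modeq R E.
      by rewrite normrZ ger0_norm//; apply: le_lt_trans xy; rewrite ler_piMl.
    by move=> Oz; split=> //; apply: Om_d2.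
  apply: (@le_lt_trans _ _ (K 1%N * (e / r ^+ 2) * (r / 3))); first by rewrite ler_wpM2l// ltW.
  rewrite (_ : K 1%N * (e / r ^+ 2) * (r / 3) = 6 / 15 * K 1%N * (delta / r)); last first.
    by rewrite /e; field.
  by rewrite -[ltRHS]mulrA ltr_pM2r ?divr_gt0// /C13 /=; lra.
- move=> x Xx; have Bx : B x x by rewrite /B /= subrr normr0 mulr_gt0.
  have Ox : Om x by exists x.
  have [rP AE] := HP x Xx; have My := Mnp x Ox.
  (* The foot point of [x] is within [5 * delta] of [x], hence in the ball where the differential of
     [nproj M] is compared with [P x]; at the foot point this differential is the projector onto the
     tangent directions. *)
  have Bnx : B x (nproj M x).
    have [y My' xy] := XM4 x Xx; have [_ /(_ y My') h] := Om_near x Ox.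
    by rewrite /B /= distrC; apply: le_lt_trans h _; lra.
  have TE := tangent_dirE Om_smooth Om_near M_Om My.
  have SS := dnproj_sym_idem Om_smooth Om_near M_Om My.
  have PP := rank_proj_sym_idem rP.
  have f1 := pd_fst (data x Xx) Bnx.
  have Ke : K 0%N * (e / r) <= 2^-1.
    apply: (@le_trans _ _ ((K 0%N + 1) * (2 * (4 * (K 0%N + 1))^-1))).
      apply: ler_pM => //; [exact: ltW|by rewrite lerDl|rewrite er; lra].
    rewrite le_eqVlt; apply/orP; left; apply/eqP; field.
    by rewrite gt_eqF// ltr_wpDl.
  apply: le_lt_trans (affine_angle_le AE TE PP SS f1 Ke) _.
  rewrite er (_ : 2 * (K 0%N * (6 / 5 * (delta / r))) = 12 / 5 * K 0%N * (delta / r)); last by ring.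
  by rewrite -[ltRHS]mulrA ltr_pM2r ?divr_gt0//; lra.
Qed.
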